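(* Let $(m_1,m_2)\in\mathbb{Z}\times\mathbb{Z}_{\leq0}$ and $\mathbf m=(m_1,m_2)$. Then for $\varepsilon_1,\varepsilon_2\in\mathbb{C}$ (near $0$, with both sides defined), $$\zeta_2(m_1+\varepsilon_1,m_2+\varepsilon_2)=\frac{\zeta(m_1+m_2-1+\varepsilon_1+\varepsilon_2)}{m_2-1+\varepsilon_2}+\sum_{k_2=0}^{M_2(\mathbf{m})}\binom{-m_2-\varepsilon_2}{k_2}\zeta(-k_2)\zeta(m_1+m_2+k_2+\varepsilon_1+\varepsilon_2)+O(|\varepsilon_2|).$$
   Context: $\zeta_2(s_1,s_2)=\sum_{n_1,n_2\ge1}n_1^{-s_1}(n_1+n_2)^{-s_2}$ is the Euler–Zagier double zeta-function, meromorphically continued to $\mathbb{C}^2$; $\zeta$ is the Riemann zeta-function. $M_2(\mathbf{m})=\max\{1-(m_1+m_2),\,-m_2\}$. $\binom{x}{k}=x(x-1)\cdots(x-k+1)/k!$ for complex $x$. The $O(|\varepsilon_2|)$ term is bounded by a constant times $|\varepsilon_2|$ for $(\varepsilon_1,\varepsilon_2)$ in a neighbourhood of $(0,0)$. *)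

(* Defs.v *)
From Stdlib Require Import Reals ZArith.
From Coquelicot Require Import Coquelicot.

Open Scope C_scope.

Definition ZtoC (m : Z) : C := RtoC (IZR m).

(** [natpow n s] is [n ^ s = exp (s * ln n)], for [n >= 1] and complex [s]. *)
Definition natpow (n : nat) (s : C) : C :=
  let L := ln (INR n) in
  RtoC (exp (Re s * L)) * (cos (Im s * L), sin (Im s * L)).

Fixpoint Cfalling (x : C) (k : nat) : C :=
  match k with
  | O => RtoC 1
  | S j => Cfalling x j * (x - RtoC (INR j))
  end.

Definition Cbinom (x : C) (k : nat) : C :=
  Cfalling x k / RtoC (INR (fact k)).

(** The double series [u] converges absolutely and has sum [l]; the rectangular
    partial sums converge with both bounds tending independently to infinity. *)
Definition is_double_series (u : nat -> nat -> C) (l : C) : Prop :=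
  (exists B : R, forall M N : nat,
     (sum_n (fun i => sum_n (fun j => Cmod (u i j)) N) M <= B)%R) /\
  filterlim (fun MN : nat * nat =>
               sum_n (fun i => sum_n (fun j => u i j) (snd MN)) (fst MN))
    (filter_prod eventually eventually) (locally l).

(** Holomorphy at a point means being given, near the point, by a convergent
    power series in the one or two complex variables. *)
Definition holomorphic_at (f : C -> C) (p : C) : Prop :=
  exists (a : nat -> C) (r : R), (0 < r)%R /\
    forall z : C, (Cmod (z - p) < r)%R ->
      is_pseries (K := C_AbsRing) (V := C_NormedModule) a (z - p) (f z).

Definition in_polydisc (p1 p2 : C) (r : R) (z1 z2 : C) : Prop :=
  (Cmod (z1 - p1) < r)%R /\ (Cmod (z2 - p2) < r)%R.

Definition holomorphic2_at (f : C -> C -> C) (p1 p2 : C) : Prop :=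
  exists (a : nat -> nat -> C) (r : R), (0 < r)%R /\
    forall z1 z2 : C, in_polydisc p1 p2 r z1 z2 ->
      is_double_series
        (fun i j => a i j * Cpow (z1 - p1) i * Cpow (z2 - p2) j) (f z1 z2).

(** Near every point of [C^2], [f] is a quotient [g / h] of holomorphic functions
    with [h] not identically zero.  As [f] is a total function, its values on the
    thin set where [h] vanishes are not constrained: at a pole they mean nothing.
    The points where [f] is defined as a meromorphic function are to be expressed
    with [holomorphic2_at f]. *)
Definition meromorphic2 (f : C -> C -> C) : Prop :=
  forall p1 p2 : C, exists (r : R) (g h : C -> C -> C), (0 < r)%R /\
    (forall z1 z2 : C, in_polydisc p1 p2 r z1 z2 ->
       holomorphic2_at g z1 z2 /\ holomorphic2_at h z1 z2) /\
    (exists z1 z2 : C, in_polydisc p1 p2 r z1 z2 /\ h z1 z2 <> RtoC 0) /\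
    (forall z1 z2 : C, in_polydisc p1 p2 r z1 z2 -> h z1 z2 <> RtoC 0 ->
       f z1 z2 = g z1 z2 / h z1 z2).

(** These properties determine [zeta] away from the pole [1]. *)
Definition is_riemann_zeta (zeta : C -> C) : Prop :=
  (forall s : C, (1 < Re s)%R ->
     is_series (K := C_AbsRing) (V := C_NormedModule)
       (fun n => natpow (S n) (- s)) (zeta s)) /\
  (forall s : C, s <> RtoC 1 -> holomorphic_at zeta s).

(** The half-spaces [Re s2 > 1], [Re (s1 + s2) > 2] form the region of absolute
    convergence of the Euler-Zagier double series.  By the identity theorem the
    two properties determine [zeta2] at every point where it is holomorphic. *)
Definition is_euler_zagier_zeta2 (zeta2 : C -> C -> C) : Prop :=
  (forall s1 s2 : C, (1 < Re s2)%R -> (2 < Re (s1 + s2))%R ->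
     is_double_series
       (fun i j => natpow (S i) (- s1) * natpow (S i + S j) (- s2))
       (zeta2 s1 s2)) /\
  meromorphic2 zeta2.

Definition M2 (m1 m2 : Z) : Z := Z.max (1 - (m1 + m2)) (- m2).

(* Main.v *)
Require Import Defs.
From Stdlib Require Import Reals ZArith.
From Stdlib Require Import Lra Lia Psatz Classical ClassicalEpsilon.
From Coquelicot Require Import Coquelicot.
Open Scope C_scope.

(** Fix [P] and let [b 0, ..., b P] solve the linear recursion of the values
    [zeta (- k)].  Put [E s n = n^(1-s)/(s-1) + sum_(k <= P) Cbinom (-s) k b_k n^(-s-k)].
    Expanding [(m-1)^z] in powers of [1/m] by the binomial series gives
    [m^(-s) = E s (m-1) - E s m + D s m], where [D s m] is a series in
    [Cbinom (-s) l m^(-s-l)], [l >= P + 2], hence small and divisible by [s + N] for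
    every natural [N < P + 2].  Abel summation of [sum_(n < m) n^(-s1) m^(-s2)] turns
    [zeta2] into the right-hand side of the theorem, with [P] in place of [M2], plus
    [sum_m (sum_(n < m) n^(-s1)) D s2 m]; the latter, like the terms [M2 < k <= P], is
    [O(e2)].  This holds first for large [Re s1], [Re s2] and then everywhere by the
    identity theorem.  The same formula for [zeta] alone identifies [b k] with
    [zeta (- k)] and removes the pole of [zeta].

    Analyticity is only used along real lines, as expansion in an absolutely
    convergent power series of one real variable. *)

(** Nothing is assumed about [zeta] at nonpositive integers. The [b k] only make the low
    coefficients of [D] vanish; they are recognised as [zeta (- k)] because at [s = - N] the
    binomial series stop and the remainder disappears altogether. The order [P] is governed by
    growth. For [|s1|, |s2| < A] the inner sum over [n < m] costs at most [m^(A+1)] and [m^(-s2)] at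
    most [m^A], so [P = 2 A + 1] leaves a summable [m^(-2)] of the factor [m^(-(P+2))] in [D]. The
    main obstacle is that [zeta] at [1] and [zeta2] on its polar set take arbitrary values.
    Identities for [zeta2] are therefore continued in the cleared form [f * Q = G], in a version
    that survives the crossing of poles, and are evaluated only where [zeta2] is holomorphic.
    Segments reduce every continuation to the identity theorem on [[0, 1]], and weighted [l^1] norms
    of coefficients replace uniform convergence on complex domains. *)

(** * Series of complex numbers *)

(** Restores [C] or [R] as the type of an equation between values of [sum_n]. *)
Ltac gen_sums T :=
  repeat match goal with
  | |- context [@sum_n ?G ?u ?n] =>
      let x := fresh "x" in
      pose (x := (@sum_n G u n : T)); change (@sum_n G u n) with x; clearbody x
  end.
Ltac cring := match goal with |- @eq _ ?a ?b => change (@eq C a b) end; gen_sums C; ring.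
Ltac cfield := match goal with |- @eq _ ?a ?b => change (@eq C a b) end; gen_sums C; field.
Ltac rring := match goal with |- @eq _ ?a ?b => change (@eq R a b) end; gen_sums R; ring.

Notation Cseries := (@is_series C_AbsRing C_NormedModule).

Lemma csum_O (u : nat -> C) : sum_n u 0 = u 0%nat.
Proof. exact (sum_O u). Qed.

Lemma csum_S (u : nat -> C) n : sum_n u (S n) = sum_n u n + u (S n).
Proof. exact (sum_Sn u n). Qed.

Lemma rsum_O (u : nat -> R) : sum_n u 0 = u 0%nat.
Proof. exact (sum_O u). Qed.

Lemma rsum_S (u : nat -> R) n : sum_n u (S n) = (sum_n u n + u (S n))%R.
Proof. exact (sum_Sn u n). Qed.

Lemma csum_scal (c : C) (u : nat -> C) n :
  sum_n (fun k => c * u k) n = c * sum_n u n.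
Proof. exact (sum_n_mult_l (K := C_Ring) c u n). Qed.

Lemma csum_minus (u v : nat -> C) n :
  sum_n (fun k => u k - v k) n = sum_n u n - sum_n v n.
Proof.
  induction n as [|n IH]; rewrite ?csum_O, ?csum_S; [cring | rewrite IH; cring].
Qed.

Lemma rsum_minus (u v : nat -> R) n :
  sum_n (fun k => u k - v k)%R n = (sum_n u n - sum_n v n)%R.
Proof.
  induction n as [|n IH]; rewrite ?rsum_O, ?rsum_S; [rring | rewrite IH; rring].
Qed.

Lemma rsum_scal (c : R) (u : nat -> R) n :
  sum_n (fun k => c * u k)%R n = (c * sum_n u n)%R.
Proof. exact (sum_n_mult_l (K := R_Ring) c u n). Qed.

Lemma rsum_le (u v : nat -> R) n :
  (forall k, (k <= n)%nat -> (u k <= v k)%R) -> (sum_n u n <= sum_n v n)%R.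
Proof.
  induction n as [|n IH]; intros H; rewrite ?rsum_O, ?rsum_S.
  - apply H; lia.
  - apply Rplus_le_compat; [apply IH; intros; apply H; lia | apply H; lia].
Qed.

Lemma rsum_ge0 (u : nat -> R) n : (forall k, (0 <= u k)%R) -> (0 <= sum_n u n)%R.
Proof.
  intros H; induction n as [|n IH]; rewrite ?rsum_O, ?rsum_S; [apply H|].
  specialize (H (S n)); lra.
Qed.

Lemma rsum_mono (u : nat -> R) n m :
  (forall k, (0 <= u k)%R) -> (n <= m)%nat -> (sum_n u n <= sum_n u m)%R.
Proof.
  intros H L; induction L as [|m L IH]; [lra|].
  rewrite rsum_S; specialize (H (S m)); lra.
Qed.

Lemma rsum_term (u : nat -> R) n m :
  (forall k, (0 <= u k)%R) -> (n <= m)%nat -> (u n <= sum_n u m)%R.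
Proof.
  intros H L; apply Rle_trans with (sum_n u n); [|now apply rsum_mono].
  destruct n; [rewrite rsum_O; lra|].
  rewrite rsum_S; pose proof (rsum_ge0 u n H); lra.
Qed.

Lemma Cmod_csum (u : nat -> C) n :
  (Cmod (sum_n u n) <= sum_n (fun k => Cmod (u k)) n)%R.
Proof.
  induction n as [|n IH].
  - rewrite csum_O, rsum_O; lra.
  - rewrite csum_S, rsum_S.
    pose proof (Cmod_triangle (sum_n u n) (u (S n))); lra.
Qed.

Lemma Cmod_csum_diff (u : nat -> C) n m : (n <= m)%nat ->
  (Cmod (sum_n u m - sum_n u n)
   <= sum_n (fun k => Cmod (u k)) m - sum_n (fun k => Cmod (u k)) n)%R.
Proof.
  intros L; induction L as [|m L IH].
  - replace (sum_n u n - sum_n u n) with (RtoC 0) by cring. rewrite Cmod_0; lra.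
  - rewrite csum_S, rsum_S.
    replace (sum_n u m + u (S m) - sum_n u n)
      with ((sum_n u m - sum_n u n) + u (S m)) by cring.
    pose proof (Cmod_triangle (sum_n u m - sum_n u n) (u (S m))); lra.
Qed.

Lemma Cmod_sub_sym (a b : C) : Cmod (a - b) = Cmod (b - a).
Proof. replace (a - b) with (- (b - a)) by cring; apply Cmod_opp. Qed.

Lemma Cmod_sub_le (a b : C) : (Cmod (a - b) <= Cmod a + Cmod b)%R.
Proof.
  unfold Cminus; rewrite <- (Cmod_opp b); apply Cmod_triangle.
Qed.

Lemma filterlim_C_iff {T : Type} (F : (T -> Prop) -> Prop) {FF : Filter F}
  (f : T -> C) (l : C) :
  filterlim f F (locally l) <->
  (forall eps, (0 < eps)%R -> F (fun x => (Cmod (f x - l) < eps)%R)).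
Proof.
  rewrite (filterlim_locally_ball_norm (K := C_AbsRing) (U := C_NormedModule) f l).
  split.
  - intros H eps He. exact (H (mkposreal eps He)).
  - intros H eps. exact (H eps (cond_pos eps)).
Qed.

Lemma Cseries_iff (u : nat -> C) (l : C) :
  Cseries u l <->
  (forall eps, (0 < eps)%R ->
     exists N, forall n, (N <= n)%nat -> (Cmod (sum_n u n - l) < eps)%R).
Proof. exact (filterlim_C_iff eventually (sum_n u) l). Qed.

Lemma Cseries_unique (u : nat -> C) (l l' : C) :
  Cseries u l -> Cseries u l' -> l = l'.
Proof.
  intros H H'.
  exact (filterlim_locally_unique (K := C_AbsRing) (V := C_NormedModule) (F := eventually)
           _ l l' H H').
Qed.

Lemma Cseries_plus (u v : nat -> C) (l l' : C) :
  Cseries u l -> Cseries v l' -> Cseries (fun n => u n + v n) (l + l').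
Proof. exact (is_series_plus (K := C_AbsRing) (V := C_NormedModule) u v l l'). Qed.

Lemma Cseries_scal (c : C) (u : nat -> C) (l : C) :
  Cseries u l -> Cseries (fun n => c * u n) (c * l).
Proof. exact (is_series_scal (K := C_AbsRing) (V := C_NormedModule) c u l). Qed.

Lemma Cseries_ext (u v : nat -> C) (l l' : C) :
  (forall n, u n = v n) -> l = l' -> Cseries u l -> Cseries v l'.
Proof. intros E <-; now apply is_series_ext. Qed.

Lemma Cseries_eventually (u : nat -> C) (l : C) N :
  (forall n, (N <= n)%nat -> sum_n u n = l) -> Cseries u l.
Proof.
  intros H; apply Cseries_iff; intros eps He; exists N; intros n Hn.
  rewrite H by easy. replace (l - l) with (RtoC 0) by cring. now rewrite Cmod_0.
Qed.

Lemma Cseries_zero : Cseries (fun _ => RtoC 0) (RtoC 0).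
Proof.
  apply Cseries_eventually with 0%nat; intros n _.
  induction n as [|n IH]; [apply csum_O | rewrite csum_S, IH; cring].
Qed.

Lemma Cseries_sum (u : nat -> nat -> C) (l : nat -> C) K :
  (forall k, (k <= K)%nat -> Cseries (u k) (l k)) ->
  Cseries (fun n => sum_n (fun k => u k n) K) (sum_n l K).
Proof.
  induction K as [|K IH]; intros H.
  - refine (Cseries_ext _ _ _ _ _ _ (H 0%nat (le_n 0))); intros; now rewrite csum_O.
  - refine (Cseries_ext _ _ _ _ _ _
      (Cseries_plus _ _ _ _ (IH (fun k Hk => H k (le_S _ _ Hk))) (H (S K) (le_n _))));
      intros; now rewrite csum_S.
Qed.

Lemma Cseries_shift (u : nat -> C) (l : C) :
  Cseries (fun n => u (S n)) l <-> Cseries u (u 0%nat + l).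
Proof.
  split; intros H.
  - pose proof (is_series_decr_1 (K := C_AbsRing) (V := C_NormedModule) u (u 0%nat + l)) as D.
    apply D. refine (Cseries_ext _ _ _ _ _ _ H); [easy|].
    change (l = u 0%nat + l + - u 0%nat). ring.
  - pose proof (is_series_incr_1 (K := C_AbsRing) (V := C_NormedModule) u l) as D.
    apply D. refine (Cseries_ext _ _ _ _ _ _ H); [easy|].
    change (u 0%nat + l = l + u 0%nat). ring.
Qed.

Lemma Cseries_shift_n (u : nat -> C) (l : C) k :
  (forall n, (n < k)%nat -> u n = RtoC 0) ->
  Cseries (fun n => u (k + n)%nat) l -> Cseries u l.
Proof.
  revert u; induction k as [|k IH]; intros u Z H; [exact H|].
  replace l with (u 0%nat + l) by (rewrite Z by lia; ring).
  apply Cseries_shift. apply IH; [|exact H]. intros n Hn; apply Z; lia.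
Qed.

Lemma Cmod_limit_le (x : nat -> C) (l y : C) (B : R) N :
  (forall eps, (0 < eps)%R ->
     exists N, forall n, (N <= n)%nat -> (Cmod (x n - l) < eps)%R) ->
  (forall n, (N <= n)%nat -> (Cmod (x n - y) <= B)%R) -> (Cmod (l - y) <= B)%R.
Proof.
  intros L H. apply Rnot_lt_le; intros C0.
  destruct (L (Cmod (l - y) - B)%R) as [N' HN]; [now apply Rlt_0_minus|].
  specialize (HN (N + N')%nat ltac:(lia)). specialize (H (N + N')%nat ltac:(lia)).
  pose proof (Cmod_triangle (l - x (N + N')%nat) (x (N + N')%nat - y)) as T.
  replace (l - x (N + N')%nat + (x (N + N')%nat - y)) with (l - y) in T by cring.
  rewrite (Cmod_sub_sym l (x _)) in T. lra.
Qed.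

Lemma Cseries_bound (u : nat -> C) (l : C) (B : R) :
  Cseries u l -> (forall n, (sum_n (fun k => Cmod (u k)) n <= B)%R) -> (Cmod l <= B)%R.
Proof.
  intros H HB. pose proof (proj1 (Cseries_iff _ _) H) as H'; clear H; rename H' into H.
  replace l with (l - RtoC 0) by cring.
  apply (Cmod_limit_le (sum_n u) l 0 B 0 H). intros n _.
  replace (sum_n u n - RtoC 0) with (sum_n u n) by cring.
  eapply Rle_trans; [apply Cmod_csum | apply HB].
Qed.

Lemma Cseries_terms_bounded (u : nat -> C) (l : C) : Cseries u l ->
  exists K, (0 <= K)%R /\ forall n, (Cmod (u n) <= K)%R.
Proof.
  intros H. destruct (proj1 (Cseries_iff _ _) H 1%R Rlt_0_1) as [N HN].
  pose proof (rsum_ge0 (fun n => Cmod (u n)) N (fun k => Cmod_ge_0 _)) as P.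
  exists (sum_n (fun n => Cmod (u n)) N + 2)%R. split; [lra|]. intros n.
  destruct (Nat.le_gt_cases n N) as [L|L].
  - pose proof (rsum_term (fun n => Cmod (u n)) n N (fun k => Cmod_ge_0 _) L).
    cbv beta in *. lra.
  - destruct n as [|n]; [lia|].
    pose proof (HN n ltac:(lia)) as Q1. pose proof (HN (S n) ltac:(lia)) as Q2.
    pose proof (Cmod_sub_le (sum_n u (S n) - l) (sum_n u n - l)) as T.
    replace (sum_n u (S n) - l - (sum_n u n - l)) with (u (S n)) in T by (rewrite csum_S; cring).
    lra.
Qed.

Lemma bounded_incr_cauchy (a : nat -> R) (B : R) :
  (forall n m, (n <= m)%nat -> (a n <= a m)%R) -> (forall n, (a n <= B)%R) ->
  exists L, (forall n, (a n <= L)%R) /\ (L <= B)%R /\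
    forall eps, (0 < eps)%R -> exists N, forall n, (N <= n)%nat -> (L - a n < eps)%R.
Proof.
  intros I Hb.
  destruct (completeness (fun x => exists n, x = a n)) as [L [HL1 HL2]].
  - exists B; intros x [n ->]; apply Hb.
  - now exists (a 0%nat), 0%nat.
  - exists L; repeat split.
    + intros n; apply HL1; now exists n.
    + apply HL2; intros x [n ->]; apply Hb.
    + intros eps He. apply NNPP. intros C0.
      assert (L <= L - eps)%R; [|lra]. apply HL2. intros x [N ->].
      apply Rnot_lt_le; intros C1; apply C0; exists N; intros n Hn.
      specialize (I N n Hn); lra.
Qed.

(** Meaningless if the series diverges. *)
Definition Csum (u : nat -> C) : C :=
  (Series (fun n => Re (u n)), Series (fun n => Im (u n))).

Lemma re_csum (u : nat -> C) n : Re (sum_n u n) = sum_n (fun k => Re (u k)) n.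
Proof.
  induction n as [|n IH]; [now rewrite csum_O, rsum_O|].
  now rewrite csum_S, rsum_S, <- IH.
Qed.

Lemma im_csum (u : nat -> C) n : Im (sum_n u n) = sum_n (fun k => Im (u k)) n.
Proof.
  induction n as [|n IH]; [now rewrite csum_O, rsum_O|].
  now rewrite csum_S, rsum_S, <- IH.
Qed.

Lemma im_le_Cmod (c : C) : (Rabs (Im c) <= Cmod c)%R.
Proof. eapply Rle_trans; [apply Rmax_r | apply (Rmax_Cmod c)]. Qed.

Lemma Cmod_le_re_im (c : C) : (Cmod c <= Rabs (Re c) + Rabs (Im c))%R.
Proof.
  destruct c as [x y].
  assert (E : (x, y) = RtoC x + RtoC y * Ci)
    by (unfold RtoC, Cplus, Cmult, Ci; simpl; f_equal; ring).
  rewrite E at 1. eapply Rle_trans; [apply Cmod_triangle|].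
  rewrite Cmod_mult, Cmod_Ci, !Cmod_R; simpl. lra.
Qed.

Lemma ex_series_bounded (a : nat -> R) (B : R) :
  (forall n, (0 <= a n)%R) -> (forall n, (sum_n a n <= B)%R) -> ex_series a.
Proof.
  intros P H.
  destruct (bounded_incr_cauchy (sum_n a) B) as [L [H1 [_ H2]]].
  - intros n m; now apply rsum_mono.
  - exact H.
  - exists L. apply (filterlim_locally (U := R_UniformSpace)). intros eps.
    destruct (H2 eps (cond_pos eps)) as [N HN]. exists N; intros n Hn.
    change (Rabs (sum_n a n - L) < eps)%R.
    specialize (HN n Hn); specialize (H1 n). apply Rabs_def1; lra.
Qed.

Lemma Cseries_abs (u : nat -> C) (B : R) :
  (forall n, (sum_n (fun k => Cmod (u k)) n <= B)%R) -> Cseries u (Csum u).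
Proof.
  intros H.
  assert (E : ex_series (fun n => Cmod (u n)))
    by (apply ex_series_bounded with B; [intros; apply Cmod_ge_0 | exact H]).
  assert (A : forall p : C -> R, (forall c, (Rabs (p c) <= Cmod c)%R) ->
    is_series (fun n => p (u n)) (Series (fun n => p (u n)))).
  { intros p Hp. apply Series_correct.
    apply (ex_series_le (K := R_AbsRing) (V := R_CompleteNormedModule)
       (fun n => p (u n)) (fun n => Cmod (u n))); [intros; apply Hp | exact E]. }
  pose proof (A Re re_le_Cmod) as HR. pose proof (A Im im_le_Cmod) as HI.
  apply Cseries_iff. intros eps He.
  pose proof (proj1 (filterlim_locally (U := R_UniformSpace) _ _) HR
    (mkposreal (eps / 2) ltac:(lra))) as [N1 H1].
  pose proof (proj1 (filterlim_locally (U := R_UniformSpace) _ _) HI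
    (mkposreal (eps / 2) ltac:(lra))) as [N2 H2].
  exists (N1 + N2)%nat; intros n Hn.
  specialize (H1 n ltac:(lia)). specialize (H2 n ltac:(lia)).
  rewrite <- re_csum in H1. rewrite <- im_csum in H2.
  eapply Rle_lt_trans; [apply Cmod_le_re_im|].
  change (Rabs (Re (sum_n u n) - Series (fun n => Re (u n))) < eps / 2)%R in H1.
  change (Rabs (Im (sum_n u n) - Series (fun n => Im (u n))) < eps / 2)%R in H2.
  change (Rabs (Re (sum_n u n) - Series (fun n => Re (u n)))
    + Rabs (Im (sum_n u n) - Series (fun n => Im (u n))) < eps)%R. lra.
Qed.

Lemma Csum_unique (u : nat -> C) (l : C) (B : R) :
  (forall n, (sum_n (fun k => Cmod (u k)) n <= B)%R) -> Cseries u l -> Csum u = l.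
Proof.
  intros HB H. exact (Cseries_unique _ _ _ (Cseries_abs u B HB) H).
Qed.

Lemma csum_switch (u : nat -> nat -> C) m n :
  sum_n (fun i => sum_n (fun j => u i j) n) m = sum_n (fun j => sum_n (fun i => u i j) m) n.
Proof. exact (sum_n_switch u m n). Qed.

Lemma rsum_switch (u : nat -> nat -> R) m n :
  sum_n (fun i => sum_n (fun j => u i j) n) m = sum_n (fun j => sum_n (fun i => u i j) m) n.
Proof. exact (sum_n_switch u m n). Qed.

Lemma csum_ext (u v : nat -> C) n :
  (forall k, (k <= n)%nat -> u k = v k) -> sum_n u n = sum_n v n.
Proof. intros H; exact (sum_n_ext_loc u v n H). Qed.

Lemma rsum_ext (u v : nat -> R) n :
  (forall k, (k <= n)%nat -> u k = v k) -> sum_n u n = sum_n v n.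
Proof. intros H; exact (sum_n_ext_loc u v n H). Qed.

(** * Double series: squares, rows, columns and antidiagonals *)

Definition square_sum (u : nat -> nat -> C) (n : nat) : C :=
  sum_n (fun i => sum_n (fun j => u i j) n) n.

(** The supremum [L] of the absolute rectangle sums measures tails: any finite set of indices
    outside the square of side [n] carries absolute mass at most [L] minus the absolute sum over
    that square. *)
Lemma square_cauchy (u : nat -> nat -> C) (B : R) :
  (forall M N, (sum_n (fun i => sum_n (fun j => Cmod (u i j)) N) M <= B)%R) ->
  exists L, (L <= B)%R /\
    (forall M N, (sum_n (fun i => sum_n (fun j => Cmod (u i j)) N) M <= L)%R) /\
    forall eps, (0 < eps)%R -> exists N, forall n, (N <= n)%nat ->
      (L - sum_n (fun i => sum_n (fun j => Cmod (u i j)) n) n < eps)%R.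
Proof.
  intros H.
  assert (P : forall i j, (0 <= Cmod (u i j))%R) by (intros; apply Cmod_ge_0).
  assert (Mo : forall M N M' N', (M <= M')%nat -> (N <= N')%nat ->
     (sum_n (fun i => sum_n (fun j => Cmod (u i j)) N) M
      <= sum_n (fun i => sum_n (fun j => Cmod (u i j)) N') M')%R).
  { intros M N M' N' HM HN.
    apply Rle_trans with (sum_n (fun i => sum_n (fun j => Cmod (u i j)) N') M).
    - apply rsum_le; intros; now apply rsum_mono.
    - apply rsum_mono; [intros; now apply rsum_ge0 | easy]. }
  destruct (bounded_incr_cauchy
    (fun n => sum_n (fun i => sum_n (fun j => Cmod (u i j)) n) n) B) as [L [H1 [H2 H3]]].
  - intros n m L; now apply Mo.
  - intros n; apply H.
  - exists L; repeat split; try easy.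
    intros M N. apply Rle_trans with (2 := H1 (M + N)%nat). apply Mo; lia.
Qed.

(** The first row sums and the square of side [n] differ by tails of rows, whose mass is controlled
    through [L]. Both directions are used: an interchange of summations goes from rows to squares
    and then, for the transposed family, from squares back to rows. *)
Lemma square_rows (u : nat -> nat -> C) (r : nat -> C) (B : R) (l : C) :
  (forall M N, (sum_n (fun i => sum_n (fun j => Cmod (u i j)) N) M <= B)%R) ->
  (forall i, Cseries (u i) (r i)) ->
  (forall eps, (0 < eps)%R -> exists N, forall n, (N <= n)%nat ->
     (Cmod (square_sum u n - l) < eps)%R) <-> Cseries r l.
Proof.
  intros HB HR.
  destruct (square_cauchy u B HB) as [L [_ [HL Hc]]].
  assert (D : forall n, (Cmod (sum_n r n - square_sum u n)
     <= L - sum_n (fun i => sum_n (fun j => Cmod (u i j)) n) n)%R).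
  { intros n.
    pose proof (Cseries_sum u r n (fun k _ => HR k)) as S. pose proof (proj1 (Cseries_iff _ _) S) as S0.
    (* Row sums are limits of the [n] by [N] rectangles, so it suffices to bound the difference for
       each finite [N >= n]. *)
    refine (Cmod_limit_le _ _ _ _ n S0 _). intros N HN.
    rewrite <- (csum_switch u). unfold square_sum. rewrite <- csum_minus.
    eapply Rle_trans; [apply Cmod_csum|].
    eapply Rle_trans; [apply rsum_le; intros k _; apply (Cmod_csum_diff (u k) n N HN)|].
    rewrite rsum_minus. specialize (HL n N). lra. }
  rewrite Cseries_iff.
  split; intros H eps He;
    destruct (H (eps / 2)%R ltac:(lra)) as [N1 H1];
    destruct (Hc (eps / 2)%R ltac:(lra)) as [N2 H2];
    exists (N1 + N2)%nat; intros n Hn;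
    specialize (H1 n ltac:(lia)); specialize (H2 n ltac:(lia)); specialize (D n).
  - pose proof (Cmod_triangle (sum_n r n - square_sum u n) (square_sum u n - l)) as T.
    replace (sum_n r n - square_sum u n + (square_sum u n - l)) with (sum_n r n - l) in T by cring.
    lra.
  - pose proof (Cmod_triangle (square_sum u n - sum_n r n) (sum_n r n - l)) as T.
    replace (square_sum u n - sum_n r n + (sum_n r n - l)) with (square_sum u n - l) in T by cring.
    rewrite (Cmod_sub_sym _ (sum_n r n)) in T. lra.
Qed.

Lemma Cseries_fubini (u : nat -> nat -> C) (r c : nat -> C) (B : R) (l : C) :
  (forall M N, (sum_n (fun i => sum_n (fun j => Cmod (u i j)) N) M <= B)%R) ->
  (forall i, Cseries (fun j => u i j) (r i)) -> (forall j, Cseries (fun i => u i j) (c j)) ->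
  Cseries r l -> Cseries c l.
Proof.
  intros HB Hr Hc Hl.
  apply (square_rows (fun j i => u i j) c B).
  - intros M N. rewrite rsum_switch. apply HB.
  - exact Hc.
  - intros eps He.
    destruct (proj2 (square_rows u r B l HB Hr) Hl eps He) as [N HN].
    exists N; intros n Hn. specialize (HN n Hn).
    unfold square_sum in *. now rewrite <- csum_switch.
Qed.

(** Stated over an abelian monoid because it serves both for terms in [C] and for their moduli in
    [R]. *)
Lemma triangle_sum {G : AbelianMonoid} (u : nat -> nat -> G) n :
  sum_n (fun m => sum_n (fun i => u i (m - i)%nat) m) n
  = sum_n (fun i => sum_n (fun j => u i j) (n - i)) n.
Proof.
  induction n as [|n IH]; [now rewrite !sum_O|].
  rewrite sum_Sn, IH, (sum_Sn (fun i => sum_n (fun j => u i j) (S n - i)) n).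
  rewrite (sum_n_ext_loc (fun i => sum_n (fun j => u i j) (S n - i))
     (fun i => plus (sum_n (fun j => u i j) (n - i)) (u i (S n - i)%nat)) n).
  - rewrite sum_n_plus. rewrite (sum_Sn (fun i => u i (S n - i)%nat) n).
    replace (S n - S n)%nat with 0%nat by lia. rewrite sum_O.
    now rewrite plus_assoc.
  - intros k Hk. replace (S n - k)%nat with (S (n - k)) by lia. now rewrite sum_Sn.
Qed.

Lemma square_antidiagonal (u : nat -> nat -> C) (B : R) (l : C) :
  (forall M N, (sum_n (fun i => sum_n (fun j => Cmod (u i j)) N) M <= B)%R) ->
  (forall eps, (0 < eps)%R -> exists N, forall n, (N <= n)%nat ->
     (Cmod (square_sum u n - l) < eps)%R) ->
  Cseries (fun n => sum_n (fun i => u i (n - i)%nat) n) l.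
Proof.
  intros HB H.
  destruct (square_cauchy u B HB) as [L [_ [HL Hc]]].
  apply Cseries_iff. intros eps He.
  destruct (H (eps / 2)%R ltac:(lra)) as [N1 H1].
  destruct (Hc (eps / 2)%R ltac:(lra)) as [N2 H2].
  (* For [n >= 2 * N2] the triangle [i + j <= n] contains the square of side [N2], so the triangle
     and the square of side [n] differ only outside that small square. *)
  exists (N1 + 2 * N2)%nat; intros n Hn.
  specialize (H1 n ltac:(lia)). specialize (H2 N2 ltac:(lia)).
  rewrite (triangle_sum u n).
  assert (D : (Cmod (square_sum u n - sum_n (fun i => sum_n (fun j => u i j) (n - i)) n)
    <= L - sum_n (fun i => sum_n (fun j => Cmod (u i j)) N2) N2)%R).
  { unfold square_sum. rewrite <- csum_minus.
    eapply Rle_trans; [apply Cmod_csum|].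
    eapply Rle_trans;
      [apply rsum_le; intros k _; apply (Cmod_csum_diff (u k) (n - k) n ltac:(lia))|].
    rewrite rsum_minus. specialize (HL n n).
    assert (sum_n (fun i => sum_n (fun j => Cmod (u i j)) N2) N2 <=
       sum_n (fun i => sum_n (fun j => Cmod (u i j)) (n - i)) n)%R; [|lra].
    assert (P : forall i j, (0 <= Cmod (u i j))%R) by (intros; apply Cmod_ge_0).
    apply Rle_trans with (sum_n (fun i => sum_n (fun j => Cmod (u i j)) (n - i)) N2).
    - apply rsum_le; intros k Hk. apply rsum_mono; [intros; apply P | lia].
    - apply rsum_mono; [intros; now apply rsum_ge0 | lia]. }
  set (T := sum_n (fun i => sum_n (fun j => u i j) (n - i)) n) in *.
  pose proof (Cmod_triangle (T - square_sum u n) (square_sum u n - l)) as Q.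
  replace (T - square_sum u n + (square_sum u n - l)) with (T - l) in Q by cring.
  rewrite (Cmod_sub_sym T (square_sum u n)) in Q. lra.
Qed.

Lemma antidiagonal_abs (u : nat -> nat -> C) (B : R) :
  (forall M N, (sum_n (fun i => sum_n (fun j => Cmod (u i j)) N) M <= B)%R) ->
  forall n, (sum_n (fun m => Cmod (sum_n (fun i => u i (m - i)%nat) m)) n <= B)%R.
Proof.
  intros H n.
  eapply Rle_trans; [apply rsum_le; intros m _; apply Cmod_csum|].
  eapply Rle_trans;
    [apply Req_le; exact (triangle_sum (G := R_AbelianMonoid) (fun i j => Cmod (u i j)) n)|].
  eapply Rle_trans; [|apply (H n n)].
  apply rsum_le; intros k _. apply rsum_mono; [intros; apply Cmod_ge_0 | lia].
Qed.

(** Grouping by [i + j] has two uses: it turns a two-variable power series on a line into a power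
    series in the parameter, and the Euler-Zagier series into a sum over [m = n1 + n2]. *)
Lemma double_series_antidiagonal (u : nat -> nat -> C) (l : C) :
  is_double_series u l -> Cseries (fun n => sum_n (fun i => u i (n - i)%nat) n) l.
Proof.
  intros [[B HB] H].
  apply (square_antidiagonal u B l HB). intros eps He.
  rewrite (filterlim_C_iff (filter_prod eventually eventually)) in H.
  destruct (H eps He) as [P Q [N1 H1] [N2 H2] HPQ].
  exists (N1 + N2)%nat; intros n Hn.
  apply (HPQ n n); [apply H1 | apply H2]; lia.
Qed.

Lemma square_of_iterated (u : nat -> nat -> C) (r : nat -> C) (B : R) (l : C) :
  (forall M N, (sum_n (fun i => sum_n (fun j => Cmod (u i j)) N) M <= B)%R) ->
  (forall i, Cseries (u i) (r i)) -> Cseries r l ->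
  Cseries (fun n => sum_n (fun i => u i (n - i)%nat) n) l.
Proof.
  intros HB Hr Hl. apply (square_antidiagonal u B l HB).
  now apply (square_rows u r B l HB Hr).
Qed.

(** * Majorized power series of a real variable *)

(** [phi] is, for real [t] with [|t| <= r], the sum of a power series whose
    weighted [l^1] norm at radius [r] is at most [B]. *)
Definition maj (phi : R -> C) (r B : R) : Prop :=
  exists a : nat -> C,
    (forall N, (sum_n (fun n => Cmod (a n) * r ^ n) N <= B)%R) /\
    forall t, (Rabs t <= r)%R -> Cseries (fun n => a n * RtoC t ^ n) (phi t).

Lemma Cmod_mult_pow (a : C) (t : R) n : Cmod (a * RtoC t ^ n) = (Cmod a * Rabs t ^ n)%R.
Proof. now rewrite Cmod_mult, Cmod_pow, Cmod_R. Qed.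

Lemma maj_term_le (a : C) (t r : R) n :
  (Rabs t <= r)%R -> (Cmod (a * RtoC t ^ n) <= Cmod a * r ^ n)%R.
Proof.
  intros H. rewrite Cmod_mult_pow. apply Rmult_le_compat_l; [apply Cmod_ge_0|].
  apply pow_incr; split; [apply Rabs_pos | easy].
Qed.

Lemma maj_bound (phi : R -> C) (r B t : R) :
  maj phi r B -> (Rabs t <= r)%R -> (Cmod (phi t) <= B)%R.
Proof.
  intros [a [H1 H2]] Ht. apply (Cseries_bound _ _ _ (H2 t Ht)). intros n.
  eapply Rle_trans; [|apply (H1 n)]. apply rsum_le; intros k _. now apply maj_term_le.
Qed.

Lemma maj_ge0 (phi : R -> C) (r B : R) : (0 <= r)%R -> maj phi r B -> (0 <= B)%R.
Proof.
  intros Hr H. eapply Rle_trans; [apply Cmod_ge_0|].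
  apply (maj_bound phi r B 0 H). now rewrite Rabs_R0.
Qed.

Lemma maj_le (phi : R -> C) (r B B' : R) : maj phi r B -> (B <= B')%R -> maj phi r B'.
Proof.
  intros [a [H1 H2]] H. exists a; split; [|exact H2].
  intros N; eapply Rle_trans; [apply H1 | exact H].
Qed.

Lemma maj_shrink (phi : R -> C) (r r' B : R) :
  (0 <= r')%R -> (r' <= r)%R -> maj phi r B -> maj phi r' B.
Proof.
  intros H0 H [a [H1 H2]]. exists a; split.
  - intros N; eapply Rle_trans; [|apply (H1 N)]. apply rsum_le; intros k _.
    apply Rmult_le_compat_l; [apply Cmod_ge_0|]. now apply pow_incr.
  - intros t Ht; apply H2; lra.
Qed.

Lemma maj_ext (phi psi : R -> C) (r B : R) :
  (forall t, (Rabs t <= r)%R -> phi t = psi t) -> maj phi r B -> maj psi r B.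
Proof.
  intros E [a [H1 H2]]. exists a; split; [exact H1|].
  intros t Ht. rewrite <- (E t Ht). now apply H2.
Qed.

Lemma maj_const (c : C) (r : R) : maj (fun _ => c) r (Cmod c).
Proof.
  exists (fun n => match n with O => c | _ => RtoC 0 end); split.
  - intros N. apply Req_le. induction N as [|N IH].
    + rewrite rsum_O; simpl; rring.
    + rewrite rsum_S, IH, Cmod_0; rring.
  - intros t _. apply Cseries_eventually with 0%nat. intros n _.
    induction n as [|n IH]; [rewrite csum_O; simpl; cring|].
    rewrite csum_S, IH. cring.
Qed.

Lemma maj_plus (phi psi : R -> C) (r B B' : R) : (0 <= r)%R ->
  maj phi r B -> maj psi r B' -> maj (fun t => phi t + psi t) r (B + B').
Proof.
  intros Hr [a [H1 H2]] [b [H3 H4]]. exists (fun n => a n + b n); split.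
  - intros N. specialize (H1 N). specialize (H3 N).
    assert (E : (sum_n (fun n => Cmod (a n) * r ^ n + Cmod (b n) * r ^ n) N
      = sum_n (fun n => Cmod (a n) * r ^ n) N + sum_n (fun n => Cmod (b n) * r ^ n) N)%R)
      by exact (sum_n_plus (G := R_AbelianMonoid) _ _ N).
    eapply Rle_trans; [|apply Rplus_le_compat; [exact H1 | exact H3]].
    rewrite <- E. apply rsum_le; intros k _.
    pose proof (Cmod_triangle (a k) (b k)).
    assert (0 <= r ^ k)%R by now apply pow_le. nra.
  - intros t Ht. refine (Cseries_ext _ _ _ _ _ _ (Cseries_plus _ _ _ _ (H2 t Ht) (H4 t Ht)));
      intros; cring.
Qed.

Lemma product_rect (x y : nat -> R) (B B' : R) :
  (forall n, (0 <= x n)%R) -> (forall n, (0 <= y n)%R) ->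
  (forall n, (sum_n x n <= B)%R) -> (forall n, (sum_n y n <= B')%R) ->
  forall M N, (sum_n (fun i => sum_n (fun j => x i * y j) N) M <= B * B')%R.
Proof.
  intros Px Py Hx Hy M N.
  rewrite (rsum_ext _ (fun i => sum_n y N * x i)%R)
    by (intros; rewrite rsum_scal; rring).
  rewrite rsum_scal, Rmult_comm.
  apply Rmult_le_compat; try apply rsum_ge0; easy.
Qed.

Lemma maj_mult (phi psi : R -> C) (r B B' : R) : (0 <= r)%R ->
  maj phi r B -> maj psi r B' -> maj (fun t => phi t * psi t) r (B * B').
Proof.
  intros Hr [a [H1 H2]] [b [H3 H4]].
  exists (fun n => sum_n (fun i => a i * b (n - i)%nat) n).
  assert (Q : forall t, (Rabs t <= r)%R -> forall M N,
    (sum_n (fun i => sum_n (fun j => Cmod ((a i * RtoC t ^ i) * (b j * RtoC t ^ j))) N) M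
       <= B * B')%R).
  { intros t Ht M N.
    rewrite (rsum_ext _ (fun i =>
      sum_n (fun j => Cmod (a i * RtoC t ^ i) * Cmod (b j * RtoC t ^ j))%R N))
      by (intros; apply rsum_ext; intros; apply Cmod_mult).
    apply (product_rect (fun i => Cmod (a i * RtoC t ^ i)) (fun j => Cmod (b j * RtoC t ^ j)));
      try (intros; apply Cmod_ge_0); intros n.
    - eapply Rle_trans; [|apply (H1 n)]. apply rsum_le; intros; now apply maj_term_le.
    - eapply Rle_trans; [|apply (H3 n)]. apply rsum_le; intros; now apply maj_term_le. }
  assert (E : forall t n, sum_n (fun i => (a i * RtoC t ^ i) * (b (n - i)%nat * RtoC t ^ (n - i)%nat)) n
     = sum_n (fun i => a i * b (n - i)%nat) n * RtoC t ^ n).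
  { intros t n. rewrite (Cmult_comm _ (RtoC t ^ n)), <- csum_scal. apply csum_ext; intros k Hk.
    replace (RtoC t ^ n) with (RtoC t ^ k * RtoC t ^ (n - k)); [cring|].
    rewrite <- Cpow_add_r. f_equal; lia. }
  split.
  - intros N. assert (Hr' : (Rabs r <= r)%R) by (rewrite Rabs_pos_eq; lra).
    pose proof (antidiagonal_abs _ _ (Q r Hr') N) as D. cbv beta in D.
    rewrite (rsum_ext _ (fun n => Cmod (sum_n (fun i => a i * b (n - i)%nat)%C n) * r ^ n)%R) in D;
      [exact D|].
    intros k _. rewrite E, Cmod_mult_pow. now rewrite (Rabs_pos_eq r Hr).
  - intros t Ht.
    apply (is_series_ext _ _ _ (fun n => E t n)).
    apply (square_of_iterated (fun i j => (a i * RtoC t ^ i) * (b j * RtoC t ^ j))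
       (fun i => a i * RtoC t ^ i * psi t) (B * B') _ (Q t Ht)).
    + intros i. apply Cseries_scal. now apply H4.
    + refine (Cseries_ext _ _ _ _ _ _ (Cseries_scal (psi t) _ _ (H2 t Ht))); intros; cring.
Qed.

Lemma maj_scal (c : C) (phi : R -> C) (r B : R) : (0 <= r)%R ->
  maj phi r B -> maj (fun t => c * phi t) r (Cmod c * B).
Proof. intros Hr H. apply maj_mult; [easy | apply maj_const | easy]. Qed.

Lemma maj_id (r : R) : (0 <= r)%R -> maj RtoC r r.
Proof.
  intros Hr.
  exists (fun n => match n with 1%nat => RtoC 1 | _ => RtoC 0 end); split.
  - intros N. destruct N as [|N]; [rewrite rsum_O, Cmod_0; lra|].
    apply Req_le. induction N as [|N IH].
    + rewrite rsum_S, rsum_O, Cmod_0, Cmod_1; simpl; rring.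
    + rewrite rsum_S, IH, Cmod_0; rring.
  - intros t _. apply Cseries_eventually with 1%nat. intros n Hn.
    destruct n as [|n]; [lia|]. clear Hn.
    induction n as [|n IH]; [rewrite csum_S, csum_O; simpl; cring|].
    rewrite csum_S, IH. cring.
Qed.

Definition line (c v : C) (t : R) : C := c + RtoC t * v.

Lemma line_shift c v t0 t : line c v (t0 + t) = line (line c v t0) v t.
Proof. unfold line. rewrite RtoC_plus. ring. Qed.

Lemma maj_line (c v : C) (r : R) : (0 <= r)%R -> maj (line c v) r (Cmod c + Cmod v * r).
Proof.
  intros Hr. unfold line.
  apply (maj_plus (fun _ => c)); [easy | apply maj_const|].
  rewrite Rmult_comm. apply maj_mult; [easy | now apply maj_id | apply maj_const].
Qed.

Lemma maj_sum (phi : nat -> R -> C) (B : nat -> R) (r : R) K : (0 <= r)%R ->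
  (forall k, (k <= K)%nat -> maj (phi k) r (B k)) ->
  maj (fun t => sum_n (fun k => phi k t) K) r (sum_n B K).
Proof.
  intros Hr; induction K as [|K IH]; intros H.
  - rewrite rsum_O. apply (maj_ext (phi 0%nat)); [intros; now rewrite csum_O|].
    now apply H.
  - rewrite rsum_S.
    apply (maj_ext (fun t => sum_n (fun k => phi k t) K + phi (S K) t));
      [intros; now rewrite csum_S|].
    apply maj_plus; [easy | apply IH; intros; apply H; lia | now apply H].
Qed.

(** The substitute for the theorem of Weierstrass on convergent series of analytic functions: when
    the norms are summable, coefficients may be added termwise, and [Cseries_fubini] interchanges
    this sum with the one over powers. *)
Lemma maj_series (phi : nat -> R -> C) (B : nat -> R) (r Bt : R) : (0 < r)%R ->
  (forall i, maj (phi i) r (B i)) -> (forall N, (sum_n B N <= Bt)%R) ->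
  maj (fun t => Csum (fun i => phi i t)) r Bt.
Proof.
  intros Hr H HB.
  (* [maj] only asserts that coefficients exist; here they are chosen for all [i] simultaneously. *)
  set (a i := proj1_sig (constructive_indefinite_description _ (H i))).
  assert (Ha1 : forall i N, (sum_n (fun n => Cmod (a i n) * r ^ n) N <= B i)%R)
    by (intros i; apply (proj2_sig (constructive_indefinite_description _ (H i)))).
  assert (Ha2 : forall i t, (Rabs t <= r)%R -> Cseries (fun n => a i n * RtoC t ^ n) (phi i t))
    by (intros i; apply (proj2_sig (constructive_indefinite_description _ (H i)))).
  clearbody a.
  assert (Q : forall M N,
    (sum_n (fun i => sum_n (fun n => Cmod (a i n) * r ^ n)%R N) M <= Bt)%R).
  { intros M N. eapply Rle_trans; [|apply (HB M)]. apply rsum_le; intros; apply Ha1. }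
  assert (Qt : forall t, (Rabs t <= r)%R -> forall M N,
    (sum_n (fun i => sum_n (fun n => Cmod (a i n * RtoC t ^ n)) N) M <= Bt)%R).
  { intros t Ht M N. eapply Rle_trans; [|apply (Q M N)].
    apply rsum_le; intros; apply rsum_le; intros. now apply maj_term_le. }
  assert (Qc : forall j M, (sum_n (fun i => Cmod (a i j)) M <= Bt / r ^ j)%R).
  { intros j M. apply (Rmult_le_reg_r (r ^ j)); [now apply pow_lt|].
    replace (Bt / r ^ j * r ^ j)%R with Bt
      by (field; apply pow_nonzero; lra).
    eapply Rle_trans; [|apply (Q M j)].
    rewrite Rmult_comm, <- rsum_scal. apply rsum_le; intros i _.
    rewrite Rmult_comm. apply (rsum_term (fun n => Cmod (a i n) * r ^ n)%R j j); [|easy].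
    intros k; apply Rmult_le_pos; [apply Cmod_ge_0 | apply pow_le; lra]. }
  assert (Qs : exists c : nat -> C, forall j, Cseries (fun i => a i j) (c j))
    by (exists (fun j => Csum (fun i => a i j)); intros j; exact (Cseries_abs _ _ (Qc j))).
  destruct Qs as [c Qs]. exists c; split.
  - intros N.
    set (v k := RtoC (r ^ k)).
    assert (Hv : forall k, Cmod (v k) = (r ^ k)%R)
      by (intros; unfold v; rewrite Cmod_R, Rabs_pos_eq; [easy | apply pow_le; lra]).
    (* [|w k| <= r ^ k] and [w k * c k = |c k| * r ^ k]: the weighted norm becomes a
       finite linear combination of the limits [c k]. *)
    pose (w := fun k => if Req_EM_T (Cmod (c k)) 0 then RtoC 0
      else Cconj (c k) * RtoC (/ Cmod (c k)) * v k).
    assert (Hw : forall k, (Cmod (w k) <= r ^ k)%R).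
    { intros k; unfold w. destruct (Req_EM_T (Cmod (c k)) 0) as [E|E].
      - rewrite Cmod_0. apply pow_le; lra.
      - rewrite !Cmod_mult, Cmod_conj, Hv, Cmod_R, Rabs_pos_eq.
        + apply Req_le. now field.
        + apply Rlt_le, Rinv_0_lt_compat.
          pose proof (Cmod_ge_0 (c k)); lra. }
    assert (Ew : forall k, w k * c k
        = RtoC (Cmod (c k) * r ^ k)).
    { intros k; unfold w. destruct (Req_EM_T (Cmod (c k)) 0) as [E|E].
      - rewrite E. rewrite Rmult_0_l. ring.
      - generalize dependent (c k); intros z E.
        transitivity ((z * Cconj z) * RtoC (/ Cmod z) * v k); [ring|].
        rewrite <- Cmod2_conj. unfold v.
        rewrite <- !RtoC_mult. f_equal. now field. }
    assert (S : Cseries (fun i => sum_n (fun k => w k * a i k) N)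
       (sum_n (fun k => w k * c k) N)).
    { apply (Cseries_sum (fun k i => w k * a i k)). intros k _. now apply Cseries_scal. }
    assert (E : sum_n (fun k => w k * c k) N
       = RtoC (sum_n (fun k => Cmod (c k) * r ^ k)%R N)).
    { clear S. induction N as [|N IH]; [now rewrite csum_O, rsum_O, Ew|].
      rewrite csum_S, rsum_S, IH, Ew. now rewrite RtoC_plus. }
    assert (HB0 : (Cmod (sum_n (fun k => w k * c k)%C N) <= Bt)%R).
    { apply (Cseries_bound _ _ _ S). intros M. eapply Rle_trans; [|apply (Q M N)].
      apply rsum_le; intros i _. eapply Rle_trans; [apply Cmod_csum|].
      apply rsum_le; intros k _. rewrite Cmod_mult, Rmult_comm.
      apply Rmult_le_compat_l; [apply Cmod_ge_0 | apply Hw]. }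
    rewrite E, Cmod_R in HB0. eapply Rle_trans; [apply Rle_abs | exact HB0].
  - intros t Ht.
    apply (Cseries_fubini (fun i j => a i j * RtoC t ^ j) (fun i => phi i t) _ Bt _ (Qt t Ht)).
    + intros i; now apply Ha2.
    + intros j. refine (Cseries_ext _ _ _ _ _ _ (Cseries_scal (RtoC t ^ j) _ _ (Qs j)));
        intros; ring.
    + apply Cseries_abs with Bt. intros n. eapply Rle_trans; [|apply (HB n)].
      apply rsum_le; intros k _. now apply (maj_bound (phi k) r).
Qed.

(** * Analyticity at a point of the real line; the identity theorem on an interval *)

Definition AN (phi : R -> C) (t0 : R) : Prop :=
  exists r B, (0 < r)%R /\ maj (fun t => phi (t0 + t)%R) r B.

Lemma AN_const c t0 : AN (fun _ => c) t0.
Proof. exists 1%R, (Cmod c). split; [lra | apply maj_const]. Qed.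

Lemma AN_ext_loc (phi psi : R -> C) t0 eps : (0 < eps)%R ->
  (forall t, (Rabs (t - t0) < eps)%R -> phi t = psi t) -> AN phi t0 -> AN psi t0.
Proof.
  intros He E [r [B [Hr H]]].
  assert (M : (0 < Rmin r (eps / 2))%R) by (apply Rmin_pos; lra).
  exists (Rmin r (eps / 2)), B; split; [exact M|].
  apply (maj_ext (fun t => phi (t0 + t)%R)).
  - intros t Ht. apply E. replace (t0 + t - t0)%R with t by ring.
    pose proof (Rmin_r r (eps / 2)). lra.
  - apply maj_shrink with r; [lra | apply Rmin_l | easy].
Qed.

Lemma AN_ext (phi psi : R -> C) t0 : (forall t, phi t = psi t) -> AN phi t0 -> AN psi t0.
Proof. intros E. apply (AN_ext_loc phi psi t0 1 Rlt_0_1). intros; apply E. Qed.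

Lemma AN_common (phi psi : R -> C) t0 : AN phi t0 -> AN psi t0 ->
  exists r B B', (0 < r)%R /\ maj (fun t => phi (t0 + t)%R) r B /\
    maj (fun t => psi (t0 + t)%R) r B'.
Proof.
  intros [r [B [Hr H]]] [r' [B' [Hr' H']]].
  assert (M : (0 < Rmin r r')%R) by now apply Rmin_pos.
  exists (Rmin r r'), B, B'; split; [easy|]. split.
  - apply maj_shrink with r; [lra | apply Rmin_l | easy].
  - apply maj_shrink with r'; [lra | apply Rmin_r | easy].
Qed.

Lemma AN_plus (phi psi : R -> C) t0 :
  AN phi t0 -> AN psi t0 -> AN (fun t => phi t + psi t) t0.
Proof.
  intros H H'. destruct (AN_common _ _ _ H H') as [r [B [B' [Hr [M M']]]]].
  exists r, (B + B')%R; split; [easy|].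
  apply (maj_plus (fun t => phi (t0 + t)%R) (fun t => psi (t0 + t)%R)); [lra | easy | easy].
Qed.

Lemma AN_mult (phi psi : R -> C) t0 :
  AN phi t0 -> AN psi t0 -> AN (fun t => phi t * psi t) t0.
Proof.
  intros H H'. destruct (AN_common _ _ _ H H') as [r [B [B' [Hr [M M']]]]].
  exists r, (B * B')%R; split; [easy|].
  apply (maj_mult (fun t => phi (t0 + t)%R) (fun t => psi (t0 + t)%R)); [lra | easy | easy].
Qed.

Lemma AN_minus (phi psi : R -> C) t0 :
  AN phi t0 -> AN psi t0 -> AN (fun t => phi t - psi t) t0.
Proof.
  intros H H'. apply (AN_ext (fun t => phi t + RtoC (-1) * psi t)).
  - intros t. cring.
  - apply AN_plus; [easy|]. apply AN_mult; [apply AN_const | easy].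
Qed.

Lemma AN_line c v t0 : AN (line c v) t0.
Proof.
  exists 1%R, (Cmod (line c v t0) + Cmod v * 1)%R; split; [lra|].
  apply (maj_ext (line (line c v t0) v)); [intros; now rewrite line_shift|].
  apply maj_line; lra.
Qed.

Lemma AN_sum (phi : nat -> R -> C) K t0 :
  (forall k, (k <= K)%nat -> AN (phi k) t0) -> AN (fun t => sum_n (fun k => phi k t) K) t0.
Proof.
  induction K as [|K IH]; intros H.
  - apply (AN_ext (phi 0%nat)); [intros; now rewrite csum_O | now apply H].
  - apply (AN_ext (fun t => sum_n (fun k => phi k t) K + phi (S K) t));
      [intros; now rewrite csum_S|].
    apply AN_plus; [apply IH; intros; apply H; lia | now apply H].
Qed.

Lemma pow_decr (q : R) n m : (0 <= q <= 1)%R -> (n <= m)%nat -> (q ^ m <= q ^ n)%R.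
Proof.
  intros Hq L. replace m with (n + (m - n))%nat by lia. rewrite pow_add.
  assert (q ^ (m - n) <= 1)%R by (rewrite <- (pow1 (m - n)); now apply pow_incr).
  assert (0 <= q ^ n)%R by now apply pow_le. nra.
Qed.

(** Let the coefficients below [n] vanish. The tail beyond [n] is at most [q^(n+1) * B] with
    [q = |t| / r], so a zero [t] of [phi] gives [|a n| * r^(n+1) <= |t| * B]; zeros arbitrarily
    close to [0] force [a n = 0]. *)
Lemma power_series_zero (a : nat -> C) (r B : R) (phi : R -> C) : (0 < r)%R ->
  (forall N, (sum_n (fun n => Cmod (a n) * r ^ n) N <= B)%R) ->
  (forall t, (Rabs t <= r)%R -> Cseries (fun n => a n * RtoC t ^ n) (phi t)) ->
  (forall eps, (0 < eps)%R -> exists t, (0 < Rabs t < eps)%R /\ phi t = RtoC 0) ->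
  forall n, a n = RtoC 0.
Proof.
  intros Hr HB HS HZ n. induction n as [n IH] using lt_wf_ind.
  assert (P0 : forall k, (0 <= Cmod (a k) * r ^ k)%R)
    by (intros; apply Rmult_le_pos; [apply Cmod_ge_0 | apply pow_le; lra]).
  assert (B0 : (0 <= B)%R) by (eapply Rle_trans; [|apply (HB 0%nat)]; now apply rsum_ge0).
  assert (K : forall t, (0 < Rabs t <= r)%R -> phi t = RtoC 0 ->
     (Cmod (a n) * r ^ S n <= Rabs t * B)%R).
  { intros t Ht Z.
    assert (In : forall k, (k < n)%nat -> sum_n (fun k => a k * RtoC t ^ k) k = RtoC 0).
    { induction k as [|k IHk]; intros Hk; [rewrite csum_O, IH by lia; cring|].
      rewrite csum_S, IHk, IH by lia. cring. }
    assert (Sn : sum_n (fun k => a k * RtoC t ^ k) n = a n * RtoC t ^ n).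
    { destruct n as [|m]; [now rewrite csum_O|].
      rewrite csum_S, In by lia. cring. }
    specialize (HS t (proj2 Ht)). rewrite Z in HS.
    pose proof (proj1 (Cseries_iff _ _) HS) as HL.
    set (q := (Rabs t / r)%R).
    assert (Hq : (0 < q <= 1)%R).
    { unfold q; split; [apply Rdiv_lt_0_compat; lra|].
      apply (Rmult_le_reg_r r); [easy|]. unfold Rdiv; rewrite Rmult_assoc, Rinv_l; lra. }
    assert (Et : Rabs t = (q * r)%R) by (unfold q; field; lra).
    assert (D : (Cmod (RtoC 0 - a n * RtoC t ^ n) <= q ^ S n * B)%R).
    { apply (Cmod_limit_le _ _ _ _ n HL). intros N HN. rewrite <- Sn.
      eapply Rle_trans; [apply Cmod_csum_diff; exact HN|].
      apply Rle_trans with (q ^ S n *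
        (sum_n (fun k => Cmod (a k) * r ^ k)%R N - sum_n (fun k => Cmod (a k) * r ^ k)%R n))%R.
      - induction HN as [|N HN IHN]; [lra|].
        rewrite !rsum_S, Cmod_mult_pow, Et, Rpow_mult_distr.
        assert (q ^ S N <= q ^ S n)%R by (apply pow_decr; [lra | lia]).
        specialize (P0 (S N)). nra.
      - apply Rmult_le_compat_l; [apply pow_le; lra|].
        specialize (HB N). pose proof (rsum_ge0 _ n P0). lra. }
    replace (RtoC 0 - a n * RtoC t ^ n) with (- (a n * RtoC t ^ n)) in D by ring.
    rewrite Cmod_opp, Cmod_mult_pow, Et, Rpow_mult_distr in D.
    assert (Qn : (0 < q ^ n)%R) by (apply pow_lt; lra).
    simpl in D |- *.
    apply (Rmult_le_reg_l (q ^ n)); [easy|]. rewrite Et.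
    apply Rmult_le_compat_r with (r := r) in D; [|lra]. nra. }
  apply Cmod_eq_0. apply Rle_antisym; [|apply Cmod_ge_0].
  apply Rnot_lt_le; intros P.
  set (c := (Cmod (a n) * r ^ S n)%R) in *.
  assert (Pc : (0 < c)%R) by (apply Rmult_lt_0_compat; [easy | now apply pow_lt]).
  (* A zero this close to [0] has [|t| * B < c], against [K]; adding [1] to [B] keeps the divisor
     positive. *)
  destruct (HZ (Rmin r (c / (B + 1)))) as [t [Ht Z]].
  { apply Rmin_pos; [easy|]. apply Rdiv_lt_0_compat; lra. }
  pose proof (Rmin_l r (c / (B + 1))). pose proof (Rmin_r r (c / (B + 1))).
  specialize (K t ltac:(lra) Z).
  assert (Rabs t * (B + 1) < c)%R; [|nra].
  replace c with (c / (B + 1) * (B + 1))%R by (field; lra).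
  apply Rmult_lt_compat_r; lra.
Qed.

Lemma AN_isolated_zeros (phi : R -> C) t0 : AN phi t0 ->
  (forall eps, (0 < eps)%R -> exists t, (0 < Rabs (t - t0) < eps)%R /\ phi t = RtoC 0) ->
  exists eps, (0 < eps)%R /\ forall t, (Rabs (t - t0) < eps)%R -> phi t = RtoC 0.
Proof.
  intros [r [B [Hr [a [H1 H2]]]]] HZ.
  assert (Z : forall n, a n = RtoC 0).
  { apply (power_series_zero a r B (fun t => phi (t0 + t)%R) Hr H1 H2).
    intros eps He. destruct (HZ eps He) as [t [Ht E]].
    exists (t - t0)%R; split; [easy|]. rewrite <- E. f_equal; ring. }
  exists r; split; [easy|]. intros t Ht.
  specialize (H2 (t - t0)%R ltac:(lra)).
  replace (t0 + (t - t0))%R with t in H2 by ring.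
  apply (Cseries_unique _ _ _ H2).
  refine (Cseries_ext _ _ _ _ _ _ Cseries_zero); [|easy]. intros n; rewrite Z; ring.
Qed.

(** Connectedness of [[0, 1]] as an induction principle: the supremum of the initial segments on
    which [P] holds is reached by the third hypothesis and could be passed by the second. It carries
    both the vanishing of an analytic function along an interval and the passage of an identity
    across poles. *)
Lemma real_induction (P : R -> Prop) :
  P 0%R ->
  (forall t, (0 <= t < 1)%R -> P t ->
     exists r, (0 < r)%R /\ forall t', (t < t' < t + r)%R -> (t' <= 1)%R -> P t') ->
  (forall t, (0 < t <= 1)%R -> (forall t', (0 <= t' < t)%R -> P t') -> P t) ->
  P 1%R.
Proof.
  intros P0 Pr Pl.
  pose (E t := (0 <= t <= 1)%R /\ forall t', (0 <= t' <= t)%R -> P t').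
  destruct (completeness E) as [s [Hs1 Hs2]].
  - exists 1%R; intros t [Ht _]; lra.
  - exists 0%R; split; [lra|]. intros t' Ht'. now replace t' with 0%R by lra.
  - assert (S0 : (0 <= s)%R).
    { apply Hs1; split; [lra|]. intros t' Ht'. now replace t' with 0%R by lra. }
    assert (S1 : (s <= 1)%R) by (apply Hs2; intros t [Ht _]; lra).
    assert (Below : forall t', (0 <= t' < s)%R -> P t').
    { intros t' Ht'. apply NNPP; intros C0.
      assert (s <= t')%R; [|lra]. apply Hs2. intros t [Ht Q].
      apply Rnot_lt_le; intros C1. apply C0, Q; lra. }
    assert (Ps : P s).
    { destruct (Rle_lt_or_eq_dec 0 s S0) as [L|<-]; [apply Pl; [lra | easy] | easy]. }
    destruct (Rle_lt_or_eq_dec s 1 S1) as [L| ->]; [|easy].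
    destruct (Pr s ltac:(lra) Ps) as [r [Hr Q]].
    set (t := Rmin 1 (s + r / 2)).
    assert (Ht : (s < t <= 1 /\ t <= s + r / 2)%R).
    { unfold t; repeat split; [apply Rmin_glb_lt; lra | apply Rmin_l | apply Rmin_r]. }
    assert (E t); [|specialize (Hs1 t H); lra].
    split; [lra|]. intros t' Ht'.
    destruct (Rlt_le_dec t' s) as [A|A]; [apply Below; lra|].
    destruct (Rle_lt_or_eq_dec s t' A) as [A'|<-]; [apply Q; lra | easy].
Qed.

Lemma AN_identity (phi : R -> C) eps : (0 < eps)%R ->
  (forall t, (0 <= t <= 1)%R -> AN phi t) ->
  (forall t, (0 < t < eps)%R -> phi t = RtoC 0) -> phi 1%R = RtoC 0.
Proof.
  intros He HA HZ.
  (* The property to propagate is vanishing on a two-sided neighbourhood; at [0] it already follows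
     from the zeros on the right. *)
  pose (Z t0 := exists d, (0 < d)%R /\ forall t, (Rabs (t - t0) < d)%R -> phi t = RtoC 0).
  assert (Z1 : Z 1%R).
  { apply real_induction.
    - apply AN_isolated_zeros; [apply HA; lra|]. intros d Hd.
      exists (Rmin (eps / 2) (d / 2)).
      pose proof (Rmin_l (eps / 2) (d / 2)). pose proof (Rmin_r (eps / 2) (d / 2)).
      assert (0 < Rmin (eps / 2) (d / 2))%R by (apply Rmin_pos; lra).
      split; [rewrite Rminus_0_r, Rabs_pos_eq; lra | apply HZ; lra].
    - intros t Ht [d [Hd Q]]. exists d; split; [easy|]. intros t' Ht' _.
      exists (Rmin (t' - t) (t + d - t')); split; [apply Rmin_pos; lra|].
      intros x Hx. apply Q.
      pose proof (Rmin_l (t' - t) (t + d - t')). pose proof (Rmin_r (t' - t) (t + d - t')).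
      apply Rabs_def2 in Hx. apply Rabs_def1; lra.
    - intros t Ht Q. apply AN_isolated_zeros; [apply HA; lra|]. intros d Hd.
      exists (t - Rmin t (d / 2))%R.
      pose proof (Rmin_l t (d / 2)). pose proof (Rmin_r t (d / 2)).
      assert (0 < Rmin t (d / 2))%R by (apply Rmin_pos; lra).
      split.
      + replace (t - Rmin t (d / 2) - t)%R with (- Rmin t (d / 2))%R by ring.
        rewrite Rabs_Ropp, Rabs_pos_eq; lra.
      + destruct (Q (t - Rmin t (d / 2))%R ltac:(lra)) as [d' [Hd' Q']].
        apply Q'. replace (t - Rmin t (d / 2) - (t - Rmin t (d / 2)))%R with 0%R by ring.
        now rewrite Rabs_R0. }
  destruct Z1 as [d [Hd Q]]. apply Q.
  replace (1 - 1)%R with 0%R by ring. now rewrite Rabs_R0.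
Qed.

(** Every term after the constant one gains a factor [|t| / r] over its weight at radius [r]. This
    explicit continuity makes nonvanishing an open condition. *)
Lemma maj_near_0 (phi : R -> C) (r B t : R) : (0 < r)%R ->
  maj phi r B -> (Rabs t <= r)%R -> (Cmod (phi t - phi 0%R) <= Rabs t / r * B)%R.
Proof.
  intros Hr [a [H1 H2]] Ht.
  assert (P0 : forall k, (0 <= Cmod (a k) * r ^ k)%R)
    by (intros; apply Rmult_le_pos; [apply Cmod_ge_0 | apply pow_le; lra]).
  assert (E : phi 0%R = a 0%nat).
  { apply (Cseries_unique (fun n => a n * RtoC 0 ^ n)).
    - apply H2. rewrite Rabs_R0; lra.
    - apply Cseries_eventually with 0%nat. intros n _.
      induction n as [|n IH]; [rewrite csum_O; simpl; cring|].
      rewrite csum_S, IH. simpl. cring. }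
  rewrite E.
  assert (Hq : (0 <= Rabs t / r <= 1)%R).
  { pose proof (Rabs_pos t). split.
    - apply Rmult_le_pos; [easy | apply Rlt_le, Rinv_0_lt_compat, Hr].
    - apply (Rmult_le_reg_r r); [easy|]. unfold Rdiv; rewrite Rmult_assoc, Rinv_l; lra. }
  pose proof (proj1 (Cseries_iff _ _) (H2 t Ht)) as HL.
  apply (Cmod_limit_le _ _ _ _ 0 HL). intros n _.
  replace (a 0%nat) with (sum_n (fun k => a k * RtoC t ^ k) 0)
    by (rewrite csum_O; simpl; cring).
  eapply Rle_trans; [apply Cmod_csum_diff; lia|].
  apply Rle_trans with (Rabs t / r *
    (sum_n (fun k => Cmod (a k) * r ^ k)%R n - sum_n (fun k => Cmod (a k) * r ^ k)%R 0))%R.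
  - induction n as [|n IH]; [lra|].
    rewrite !(rsum_S _ n), Cmod_mult_pow.
    replace (Rabs t ^ S n)%R with ((Rabs t / r) ^ S n * r ^ S n)%R
      by (rewrite <- Rpow_mult_distr; f_equal; field; lra).
    pose proof (pow_decr (Rabs t / r) 1 (S n) Hq ltac:(lia)) as D. rewrite pow_1 in D.
    specialize (P0 (S n)). nra.
  - apply Rmult_le_compat_l; [easy|]. specialize (H1 n). rewrite rsum_O.
    specialize (P0 0%nat). lra.
Qed.

(** * Holomorphic functions restricted to real lines *)

(** The terms are bounded at radius [s], hence dominated by a geometric series of ratio [1 / 2] at
    radius [s / 2]. [rho] and [B] do not depend on the direction [v], so that lines through [p] in
    all directions together cover a full disc. *)
Lemma holomorphic_at_maj (f : C -> C) (p : C) : holomorphic_at f p ->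
  exists rho B, (0 < rho)%R /\ forall v r, (0 <= r)%R -> (Cmod v * r <= rho)%R ->
    maj (fun t => f (line p v t)) r B.
Proof.
  intros [a [R0 [HR H]]].
  set (s := (R0 / 2)%R). assert (Hs : (0 < s < R0)%R) by (unfold s; lra).
  assert (A : forall z, (Cmod (z - p) < R0)%R -> Cseries (fun n => a n * (z - p) ^ n) (f z)).
  { intros z Hz. refine (Cseries_ext _ _ _ _ _ eq_refl (H z Hz)). intros n.
    change (pow_n (K := C_Ring) (z - p) n * a n = a n * (z - p) ^ n).
    apply Cmult_comm. }
  assert (Bd : exists K, forall n, (Cmod (a n) * s ^ n <= K)%R).
  { assert (E : Cmod (p + RtoC s - p) = s).
    { replace (p + RtoC s - p) with (RtoC s) by ring. rewrite Cmod_R, Rabs_pos_eq; lra. }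
    destruct (Cseries_terms_bounded _ _ (A (p + RtoC s) ltac:(lra))) as [K [_ HK]].
    exists K. intros n. specialize (HK n). now rewrite Cmod_mult, Cmod_pow, E in HK. }
  destruct Bd as [K HK].
  exists (s / 2)%R, (2 * K)%R. split; [lra|]. intros v r Hr Hv.
  exists (fun n => a n * v ^ n). split.
  - intros N. apply Rle_trans with (sum_n (fun n => K * (1 / 2) ^ n)%R N).
    + apply rsum_le; intros k _. rewrite Cmod_mult, Cmod_pow, Rmult_assoc, <- Rpow_mult_distr.
      apply Rle_trans with (Cmod (a k) * (s / 2) ^ k)%R.
      * apply Rmult_le_compat_l; [apply Cmod_ge_0|]. apply pow_incr; split; [|easy].
        apply Rmult_le_pos; [apply Cmod_ge_0 | easy].
      * replace (s / 2)%R with (s * (1 / 2))%R by field.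
        rewrite Rpow_mult_distr, <- Rmult_assoc. apply Rmult_le_compat_r; [|apply HK].
        apply pow_le; lra.
    + rewrite rsum_scal.
      assert (G : forall n, (sum_n (fun n => (1 / 2) ^ n)%R n = 2 - (1 / 2) ^ n)%R).
      { induction n as [|n IH]; [rewrite rsum_O; simpl; lra|].
        rewrite rsum_S, IH. simpl. lra. }
      rewrite G. assert (0 < (1 / 2) ^ N)%R by (apply pow_lt; lra).
      assert (0 <= K)%R.
      { eapply Rle_trans; [|apply (HK 0%nat)]. apply Rmult_le_pos; [apply Cmod_ge_0 | simpl; lra]. }
      nra.
  - intros t Ht.
    assert (E : line p v t - p = RtoC t * v) by (unfold line; ring).
    assert (L : (Cmod (line p v t - p) < R0)%R).
    { rewrite E, Cmod_mult, Cmod_R.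
      apply Rle_lt_trans with (Cmod v * r)%R; [|lra].
      rewrite Rmult_comm. apply Rmult_le_compat_l; [apply Cmod_ge_0 | easy]. }
    refine (Cseries_ext _ _ _ _ _ eq_refl (A _ L)). intros n.
    rewrite E, Cpow_mult_l. ring.
Qed.

Lemma AN_holomorphic_at (f : C -> C) c v t0 :
  holomorphic_at f (line c v t0) -> AN (fun t => f (line c v t)) t0.
Proof.
  intros H. destruct (holomorphic_at_maj f _ H) as [rho [B [Hr M]]].
  pose proof (Cmod_ge_0 v) as V.
  exists (rho / (Cmod v + 1))%R, B. split; [apply Rdiv_lt_0_compat; lra|].
  apply (maj_ext (fun t => f (line (line c v t0) v t))); [intros; now rewrite line_shift|].
  apply M; [apply Rlt_le, Rdiv_lt_0_compat; lra|].
  apply (Rmult_le_reg_r (Cmod v + 1)); [lra|].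
  replace (Cmod v * (rho / (Cmod v + 1)) * (Cmod v + 1))%R with (Cmod v * rho)%R by (field; lra).
  nra.
Qed.

(** Absolute convergence at the single point [(p1 + s, p2 + s)] bounds the series on the whole
    closed polydisc of radius [s]. On a line, the terms of total degree [n] combine to the
    coefficient of [t^n]. *)
Lemma holomorphic2_at_maj (f : C -> C -> C) (p1 p2 : C) : holomorphic2_at f p1 p2 ->
  exists rho B, (0 < rho)%R /\ forall v1 v2 r, (0 <= r)%R ->
    (Cmod v1 * r <= rho)%R -> (Cmod v2 * r <= rho)%R ->
    maj (fun t => f (line p1 v1 t) (line p2 v2 t)) r B.
Proof.
  intros [a [R0 [HR H]]].
  set (s := (R0 / 2)%R). assert (Hs : (0 < s < R0)%R) by (unfold s; lra).
  assert (D : forall p, Cmod (p + RtoC s - p) = s).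
  { intros p. replace (p + RtoC s - p) with (RtoC s) by ring. rewrite Cmod_R, Rabs_pos_eq; lra. }
  destruct (H (p1 + RtoC s) (p2 + RtoC s)) as [[B HB] _]; [split; rewrite D; lra|].
  assert (HB' : forall M N,
    (sum_n (fun i => sum_n (fun j => Cmod (a i j) * s ^ i * s ^ j)%R N) M <= B)%R).
  { intros M N. eapply Rle_trans; [|apply (HB M N)]. apply Req_le.
    apply rsum_ext; intros i _; apply rsum_ext; intros j _.
    now rewrite !Cmod_mult, !Cmod_pow, !D. }
  clear HB. exists s, B. split; [lra|]. intros v1 v2 r Hr H1 H2.
  assert (Bd : forall w1 w2, (Cmod w1 <= s)%R -> (Cmod w2 <= s)%R -> forall M N,
    (sum_n (fun i => sum_n (fun j => Cmod (a i j * w1 ^ i * w2 ^ j)) N) M <= B)%R).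
  { intros w1 w2 W1 W2 M N. eapply Rle_trans; [|apply (HB' M N)].
    apply rsum_le; intros i _; apply rsum_le; intros j _.
    rewrite !Cmod_mult, !Cmod_pow, !Rmult_assoc.
    apply Rmult_le_compat_l; [apply Cmod_ge_0|].
    apply Rmult_le_compat; try (apply pow_le, Cmod_ge_0);
      apply pow_incr; split; auto using Cmod_ge_0. }
  assert (W : forall v t, (Cmod v * r <= s)%R -> (Rabs t <= r)%R -> (Cmod (RtoC t * v) <= s)%R).
  { intros v t Hv Ht. rewrite Cmod_mult, Cmod_R.
    apply Rle_trans with (Cmod v * r)%R; [|easy].
    rewrite Rmult_comm. apply Rmult_le_compat_l; [apply Cmod_ge_0 | easy]. }
  assert (E : forall t n,
    sum_n (fun i => a i (n - i)%nat * (RtoC t * v1) ^ i * (RtoC t * v2) ^ (n - i)) n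
    = sum_n (fun i => a i (n - i)%nat * v1 ^ i * v2 ^ (n - i)) n * RtoC t ^ n).
  { intros t n. rewrite (Cmult_comm _ (RtoC t ^ n)), <- csum_scal. apply csum_ext; intros k Hk.
    rewrite !Cpow_mult_l.
    replace (RtoC t ^ n) with (RtoC t ^ k * RtoC t ^ (n - k)); [cring|].
    rewrite <- Cpow_add_r. f_equal; lia. }
  exists (fun n => sum_n (fun i => a i (n - i)%nat * v1 ^ i * v2 ^ (n - i)) n). split.
  - intros N. assert (Hr' : (Rabs r <= r)%R) by (rewrite Rabs_pos_eq; lra).
    pose proof (antidiagonal_abs _ _ (Bd _ _ (W v1 r H1 Hr') (W v2 r H2 Hr')) N) as Q.
    cbv beta in Q.
    rewrite (rsum_ext _ (fun n => Cmod (sum_n (fun i => a i (n - i)%nat * v1 ^ i * v2 ^ (n - i))%C n)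
        * r ^ n)%R) in Q; [exact Q|].
    intros k _. rewrite E, Cmod_mult_pow. now rewrite (Rabs_pos_eq r Hr).
  - intros t Ht.
    apply (is_series_ext _ _ _ (fun n => E t n)).
    assert (L : forall p v, line p v t - p = RtoC t * v) by (intros; unfold line; ring).
    assert (PD : in_polydisc p1 p2 R0 (line p1 v1 t) (line p2 v2 t)).
    { split; rewrite L; eapply Rle_lt_trans; try apply W; try easy; lra. }
    specialize (H _ _ PD). rewrite !L in H.
    exact (double_series_antidiagonal _ _ H).
Qed.

Lemma AN_holomorphic2_at (f : C -> C -> C) c1 v1 c2 v2 t0 :
  holomorphic2_at f (line c1 v1 t0) (line c2 v2 t0) ->
  AN (fun t => f (line c1 v1 t) (line c2 v2 t)) t0.
Proof.
  intros H. destruct (holomorphic2_at_maj f _ _ H) as [rho [B [Hr M]]].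
  pose proof (Cmod_ge_0 v1) as V1. pose proof (Cmod_ge_0 v2) as V2.
  set (V := (Cmod v1 + Cmod v2 + 1)%R).
  assert (HV : (0 < rho / V)%R) by (apply Rdiv_lt_0_compat; unfold V; lra).
  exists (rho / V)%R, B. split; [easy|].
  apply (maj_ext (fun t => f (line (line c1 v1 t0) v1 t) (line (line c2 v2 t0) v2 t)));
    [intros; now rewrite !line_shift|].
  assert (K : forall x, (0 <= x <= V)%R -> (x * (rho / V) <= rho)%R).
  { intros x Hx. apply Rle_trans with (V * (rho / V))%R; [apply Rmult_le_compat_r; lra|].
    apply Req_le; field; unfold V; lra. }
  apply M; [lra | apply K; unfold V; lra | apply K; unfold V; lra].
Qed.

Lemma holomorphic2_at_nonzero (f : C -> C -> C) (p1 p2 : C) :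
  holomorphic2_at f p1 p2 -> f p1 p2 <> RtoC 0 ->
  exists eta, (0 < eta)%R /\ forall z1 z2, in_polydisc p1 p2 eta z1 z2 -> f z1 z2 <> RtoC 0.
Proof.
  intros H NZ. destruct (holomorphic2_at_maj f _ _ H) as [rho [B [Hr M]]].
  assert (HB : (0 <= B)%R).
  { apply (maj_ge0 (fun t => f (line p1 0 t) (line p2 0 t)) 1 B Rle_0_1).
    apply M; rewrite ?Cmod_0; lra. }
  pose proof (proj1 (Cmod_gt_0 _) NZ) as P.
  set (m := Cmod (f p1 p2)) in *.
  (* Chosen so that [q * B < |f p1 p2|]: a change of at most [q * B] cannot bring the value to
     zero. *)
  set (q := Rmin 1 (m / (2 * (B + 1)))).
  assert (Hq : (0 < q <= 1 /\ q * B < m)%R).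
  { assert (0 < m / (2 * (B + 1)))%R by (apply Rdiv_lt_0_compat; lra).
    pose proof (Rmin_l 1 (m / (2 * (B + 1)))). pose proof (Rmin_r 1 (m / (2 * (B + 1)))).
    assert (0 < q)%R by (apply Rmin_pos; lra). fold q in H1, H2. repeat split; [lra | lra|].
    assert (q * (2 * (B + 1)) <= m)%R; [|nra].
    replace m with (m / (2 * (B + 1)) * (2 * (B + 1)))%R by (field; lra).
    apply Rmult_le_compat_r; lra. }
  exists (q * rho)%R; split; [apply Rmult_lt_0_compat; lra|].
  intros z1 z2 [H1 H2] Z.
  (* Stretching the displacement by [1 / q] puts [(z1, z2)] at parameter [q] of a line that is still
     majorized at radius [1]. *)
  set (v1 := (z1 - p1) / RtoC q). set (v2 := (z2 - p2) / RtoC q).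
  assert (Cq : RtoC q <> RtoC 0) by (intros E; apply RtoC_inj in E; lra).
  assert (Lv : forall z p, (Cmod (z - p) < q * rho)%R -> (Cmod ((z - p) / RtoC q) * 1 <= rho)%R).
  { intros z p Hz. rewrite Rmult_1_r, Cmod_div, Cmod_R, Rabs_pos_eq by (easy || lra).
    apply (Rmult_le_reg_r q); [lra|]. unfold Rdiv; rewrite Rmult_assoc, Rinv_l; lra. }
  pose proof (M v1 v2 1%R Rle_0_1 (Lv _ _ H1) (Lv _ _ H2)) as Mv.
  pose proof (maj_near_0 _ 1 B q Rlt_0_1 Mv) as Q. cbv beta in Q.
  rewrite Rabs_pos_eq in Q by lra. specialize (Q ltac:(lra)).
  replace (line p1 v1 q) with z1 in Q by (unfold line, v1; now field).
  replace (line p2 v2 q) with z2 in Q by (unfold line, v2; now field).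
  replace (line p1 v1 0) with p1 in Q by (unfold line; ring).
  replace (line p2 v2 0) with p2 in Q by (unfold line; ring).
  rewrite Z in Q. replace (RtoC 0 - f p1 p2) with (- f p1 p2) in Q by ring.
  rewrite Cmod_opp in Q. fold m in Q. lra.
Qed.

(** * Exponential and binomial series *)

Definition cexp (z : C) : C := RtoC (exp (Re z)) * (cos (Im z), sin (Im z)).

Lemma cexp_plus (z w : C) : cexp (z + w) = cexp z * cexp w.
Proof.
  unfold cexp. destruct z as [a b], w as [c d]. simpl.
  rewrite exp_plus, cos_plus, sin_plus.
  unfold RtoC, Cmult; simpl. f_equal; ring.
Qed.

Lemma cexp_0 : cexp 0 = 1.
Proof. unfold cexp; simpl. rewrite exp_0, cos_0, sin_0. unfold RtoC, Cmult; simpl. f_equal; ring. Qed.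

Lemma Cmod_cexp (z : C) : Cmod (cexp z) = exp (Re z).
Proof.
  unfold cexp. rewrite Cmod_mult, Cmod_R, Rabs_pos_eq by (apply Rlt_le, exp_pos).
  unfold Cmod; simpl.
  replace (cos (Im z) * (cos (Im z) * 1) + sin (Im z) * (sin (Im z) * 1))%R with 1%R
    by (pose proof (sin2_cos2 (Im z)) as H; unfold Rsqr in H; lra).
  rewrite sqrt_1; ring.
Qed.

Lemma cexp_neq0 (z : C) : cexp z <> RtoC 0.
Proof. apply Cmod_gt_0. rewrite Cmod_cexp. apply exp_pos. Qed.

Lemma cexp_opp (z : C) : cexp (- z) = / cexp z.
Proof.
  assert (E : cexp z * cexp (- z) = 1).
  { rewrite <- cexp_plus. replace (z + - z) with (RtoC 0) by ring. apply cexp_0. }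
  pose proof (cexp_neq0 z). rewrite <- (Cmult_1_l (/ cexp z)), <- E. now field.
Qed.

Lemma natpow_cexp n (s : C) : natpow n s = cexp (s * RtoC (ln (INR n))).
Proof.
  unfold natpow, cexp. destruct s as [a b]. simpl.
  replace (a * ln (INR n) - b * 0)%R with (a * ln (INR n))%R by ring.
  replace (a * 0 + b * ln (INR n))%R with (b * ln (INR n))%R by ring. reflexivity.
Qed.

(** The recursion says that the sum [f] satisfies [(1 + q x) f' = s f], while
    [lam' = 1 / (1 + q x)]; so [f * cexp (- s * lam)] is constant. The case [q = 0], [lam x = x] is
    the exponential series, and [q = 1], [lam x = ln (1 + x)] the binomial series with complex
    exponent. *)
Lemma ode_series (alpha : nat -> C) (s : C) (q R0 : R) (lam : R -> R) :
  (forall n, RtoC (INR (S n)) * alpha (S n) = (s - RtoC (q * INR n)) * alpha n) ->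
  (forall x, (0 <= x < R0)%R ->
     exists B, forall N, (sum_n (fun n => Cmod (alpha n) * x ^ n) N <= B)%R) ->
  (forall x, (Rabs x < R0)%R -> (1 + q * x <> 0)%R /\ is_derive lam x (/ (1 + q * x))%R) ->
  lam 0%R = 0%R ->
  forall x, (Rabs x < R0)%R ->
    Cseries (fun n => alpha n * RtoC x ^ n) (alpha 0%nat * cexp (s * RtoC (lam x))).
Proof.
  intros Hrec Habs Hlam Hlam0.
  set (A n := Re (alpha n)). set (B n := Im (alpha n)).
  assert (CV : forall p : C -> R, (forall c, (Rabs (p c) <= Cmod c)%R) ->
    forall x, (Rabs x < R0)%R -> Rbar_lt (Rabs x) (CV_radius (fun n => p (alpha n)))).
  { intros p Hp x Hx.
    set (y := ((Rabs x + R0) / 2)%R). pose proof (Rabs_pos x).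
    assert (Hy : (Rabs x < y < R0)%R) by (unfold y; lra).
    destruct (Habs y ltac:(lra)) as [K HK].
    apply Rbar_lt_le_trans with y; [simpl; lra|].
    apply CV_radius_bounded. exists K. intros n. rewrite Rabs_mult.
    rewrite (Rabs_pos_eq (y ^ n)) by (apply pow_le; lra).
    eapply Rle_trans; [|apply (HK n)].
    assert (P0 : forall k, (0 <= Cmod (alpha k) * y ^ k)%R)
      by (intros; apply Rmult_le_pos; [apply Cmod_ge_0 | apply pow_le; lra]).
    eapply Rle_trans; [|apply (rsum_term _ n n P0 (le_n n))].
    apply Rmult_le_compat_r; [apply pow_le; lra | apply Hp]. }
  pose proof (CV Re re_le_Cmod) as CA. pose proof (CV Im im_le_Cmod) as CB.
  change (fun n => Re (alpha n)) with A in CA. change (fun n => Im (alpha n)) with B in CB.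
  set (a := Re s). set (b := Im s).
  assert (RA : forall n, (INR (S n) * A (S n) = a * A n - b * B n - q * INR n * A n)%R).
  { intros n. pose proof (f_equal Re (Hrec n)) as E. unfold A, B, a, b.
    destruct (alpha (S n)), (alpha n), s. cbn [Re Im fst snd Cmult Cminus Cplus Copp RtoC] in *.
    lra. }
  assert (RB : forall n, (INR (S n) * B (S n) = b * A n + a * B n - q * INR n * B n)%R).
  { intros n. pose proof (f_equal Im (Hrec n)) as E. unfold A, B, a, b.
    destruct (alpha (S n)), (alpha n), s. cbn [Re Im fst snd Cmult Cminus Cplus Copp RtoC] in *.
    lra. }
  (* A single coefficient comparison serves both components: [(A, B)] with constants [a, - b] for
     the real part and [(B, A)] with [a, b] for the imaginary part. *)
  assert (Ode : forall (U V W : nat -> R) (c d : R) x, (Rabs x < R0)%R ->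
     (forall y, (Rabs y < R0)%R -> Rbar_lt (Rabs y) (CV_radius U)) ->
     (forall y, (Rabs y < R0)%R -> Rbar_lt (Rabs y) (CV_radius V)) ->
     (forall n, (INR (S n) * U (S n) = c * U n + d * V n - q * INR n * U n)%R) ->
     (PSeries (PS_derive U) x * (1 + q * x) = c * PSeries U x + d * PSeries V x)%R).
  { intros U V _ c d x Hx CU CV' E. specialize (CU x Hx). specialize (CV' x Hx).
    assert (CD : ex_pseries (PS_derive U) x)
      by (apply CV_radius_inside; now rewrite CV_radius_derive).
    pose proof (CV_radius_inside _ _ CU) as XU. pose proof (CV_radius_inside _ _ CV') as XV.
    replace (PSeries (PS_derive U) x * (1 + q * x))%R with
      (PSeries (PS_derive U) x + q * (x * PSeries (PS_derive U) x))%R by ring.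
    rewrite <- PSeries_incr_1, <- !PSeries_scal, <- PSeries_plus, <- PSeries_plus.
    - apply PSeries_ext. intros n. unfold PS_plus, PS_scal, PS_incr_1, PS_derive, plus, scal; simpl.
      unfold mult; simpl. specialize (E n).
      destruct n as [|n]; [simpl in *; unfold zero; simpl; lra|].
      change (match n with 0%nat => 1 | S _ => INR n + 1 end)%R with (INR (S n)) in *.
      change (match S n with 0%nat => 1 | S _ => INR (S n) + 1 end)%R with (INR (S (S n))) in *.
      rewrite (S_INR (S n)) in E; lra.
    - apply ex_pseries_scal; [apply Rmult_comm | easy].
    - apply ex_pseries_scal; [apply Rmult_comm | easy].
    - easy.
    - apply ex_pseries_scal; [apply Rmult_comm|]. now apply ex_pseries_incr_1. }
  set (fr := PSeries A) in *. set (fi := PSeries B) in *.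
  assert (Dr : forall x, (Rabs x < R0)%R ->
     is_derive fr x ((a * fr x - b * fi x) / (1 + q * x))%R).
  { intros x Hx. destruct (Hlam x Hx) as [NZ _].
    replace ((a * fr x - b * fi x) / (1 + q * x))%R with (PSeries (PS_derive A) x);
      [apply is_derive_PSeries; now apply CA|].
    apply (Rmult_eq_reg_r (1 + q * x)); [|easy].
    rewrite (Ode A B A a (- b)%R x Hx CA CB) by (intros n; rewrite RA; ring).
    unfold fr, fi; field; easy. }
  assert (Di : forall x, (Rabs x < R0)%R ->
     is_derive fi x ((b * fr x + a * fi x) / (1 + q * x))%R).
  { intros x Hx. destruct (Hlam x Hx) as [NZ _].
    replace ((b * fr x + a * fi x) / (1 + q * x))%R with (PSeries (PS_derive B) x);
      [apply is_derive_PSeries; now apply CB|].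
    apply (Rmult_eq_reg_r (1 + q * x)); [|easy].
    rewrite (Ode B A A a b x Hx CB CA) by (intros n; rewrite RB; ring).
    unfold fr, fi; field; easy. }
  (* [h1] and [h2] are the real and imaginary parts of [(fr + i fi) * cexp (- s * lam)]. *)
  set (h1 x := (exp (- a * lam x) * (fr x * cos (- b * lam x) - fi x * sin (- b * lam x)))%R).
  set (h2 x := (exp (- a * lam x) * (fr x * sin (- b * lam x) + fi x * cos (- b * lam x)))%R).
  assert (D1 : forall x, (Rabs x < R0)%R -> is_derive h1 x 0%R).
  { intros x Hx. specialize (Dr x Hx). specialize (Di x Hx). destruct (Hlam x Hx) as [NZ Dl].
    unfold h1. auto_derive.
    - repeat split; eexists; eassumption.
    - change (Derive (fun x => fr x) x) with (Derive fr x).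
      change (Derive (fun x => fi x) x) with (Derive fi x).
      change (Derive (fun x => lam x) x) with (Derive lam x).
      rewrite (is_derive_unique _ _ _ Dr), (is_derive_unique _ _ _ Di), (is_derive_unique _ _ _ Dl).
      field; easy. }
  assert (D2 : forall x, (Rabs x < R0)%R -> is_derive h2 x 0%R).
  { intros x Hx. specialize (Dr x Hx). specialize (Di x Hx). destruct (Hlam x Hx) as [NZ Dl].
    unfold h2. auto_derive.
    - repeat split; eexists; eassumption.
    - change (Derive (fun x => fr x) x) with (Derive fr x).
      change (Derive (fun x => fi x) x) with (Derive fi x).
      change (Derive (fun x => lam x) x) with (Derive lam x).
      rewrite (is_derive_unique _ _ _ Dr), (is_derive_unique _ _ _ Di), (is_derive_unique _ _ _ Dl).
      field; easy. }
  assert (Cst : forall h : R -> R, (forall x, (Rabs x < R0)%R -> is_derive h x 0%R) ->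
     forall x, (Rabs x < R0)%R -> h x = h 0%R).
  { intros h Dh x Hx. apply Rabs_def2 in Hx.
    destruct (Rtotal_order x 0) as [L|[-> |L]]; [| easy |].
    - apply (eq_is_derive h x 0); [|easy]. intros t Ht. apply Dh. apply Rabs_def1; lra.
    - symmetry. apply (eq_is_derive h 0 x); [|easy]. intros t Ht. apply Dh. apply Rabs_def1; lra. }
  intros x Hx.
  assert (S : Cseries (fun n => alpha n * RtoC x ^ n) (fr x, fi x)).
  { destruct (Habs (Rabs x)) as [K HK]; [split; [apply Rabs_pos | easy]|].
    pose proof (Cseries_abs (fun n => alpha n * RtoC x ^ n) K) as T.
    refine (Cseries_ext _ _ _ _ (fun n => eq_refl) _ (T _)).
    - unfold Csum, fr, fi, PSeries, A, B. f_equal; apply Series_ext; intros n;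
        rewrite <- RtoC_pow; destruct (alpha n); simpl; ring.
    - intros n. eapply Rle_trans; [|apply (HK n)]. apply Req_le.
      apply rsum_ext; intros; apply Cmod_mult_pow. }
  refine (Cseries_ext _ _ _ _ (fun n => eq_refl) _ S).
  pose proof (Cst h1 D1 x Hx) as E1. pose proof (Cst h2 D2 x Hx) as E2.
  unfold h1, h2 in E1, E2. rewrite Hlam0, !Rmult_0_r, exp_0, cos_0, sin_0 in E1, E2.
  assert (F : (fr x, fi x) * cexp (- (s * RtoC (lam x))) = alpha 0%nat).
  { unfold fr in E1 at 2, E2 at 2. unfold fi in E1 at 2, E2 at 2. rewrite !PSeries_0 in E1, E2.
    rewrite (surjective_pairing (alpha 0%nat)). unfold A, B, Re, Im in E1, E2.
    unfold cexp. rewrite (surjective_pairing s). unfold a, b, Re, Im in E1, E2.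
    unfold RtoC, Cmult, Copp, Re, Im; simpl.
    replace (- (fst s * lam x - snd s * 0))%R with (- fst s * lam x)%R by ring.
    replace (- (fst s * 0 + snd s * lam x))%R with (- snd s * lam x)%R by ring.
    f_equal; lra. }
  rewrite <- F, cexp_opp. pose (w := (fr x, fi x) : C). change (fr x, fi x) with w.
  field. apply cexp_neq0.
Qed.

Lemma rsum_le_series (u : nat -> R) (l : R) n :
  (forall k, (0 <= u k)%R) -> is_series u l -> (sum_n u n <= l)%R.
Proof.
  intros P H. apply Rnot_lt_le. intros L.
  pose proof (proj1 (filterlim_locally (U := R_UniformSpace) _ _) H
    (mkposreal (sum_n u n - l) ltac:(lra))) as [N HN].
  specialize (HN (n + N)%nat ltac:(lia)).
  change (Rabs (sum_n u (n + N) - l) < sum_n u n - l)%R in HN.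
  pose proof (rsum_mono u n (n + N) P ltac:(lia)).
  apply Rabs_def2 in HN. lra.
Qed.

Lemma exp_partial_sums (x : R) N : (0 <= x)%R ->
  (sum_n (fun n => x ^ n / INR (fact n)) N <= exp x)%R.
Proof.
  intros Hx. apply rsum_le_series.
  - intros k. apply Rmult_le_pos; [now apply pow_le|].
    apply Rlt_le, Rinv_0_lt_compat, INR_fact_lt_0.
  - exact (is_exp_Reals x).
Qed.

Lemma RtoC_neq0 (x : R) : x <> 0%R -> RtoC x <> RtoC 0.
Proof. intros H E; apply H; now apply RtoC_inj. Qed.

Lemma Cmod_div_R (z : C) (x : R) : (0 < x)%R -> Cmod (z / RtoC x) = (Cmod z / x)%R.
Proof.
  intros H. rewrite Cmod_div by (apply RtoC_neq0; lra). rewrite Cmod_R, Rabs_pos_eq; lra.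
Qed.

Lemma maj_cexp (c v : C) (r : R) : (0 <= r)%R ->
  maj (fun t => cexp (line c v t)) r (exp (Re c + Cmod v * r)).
Proof.
  intros Hr.
  assert (S : forall t, Cseries (fun n => v ^ n / RtoC (INR (fact n)) * RtoC t ^ n)
      (cexp (v * RtoC t))).
  { intros t. set (R0 := (Rabs t + 1)%R).
    replace (cexp (v * RtoC t)) with (v ^ 0 / RtoC (INR (fact 0)) * cexp (v * RtoC t))
      by (simpl; field; apply RtoC_neq0; lra).
    apply (ode_series (fun n => v ^ n / RtoC (INR (fact n))) v 0 R0 (fun x => x)).
    - intros n. rewrite fact_simpl, mult_INR, RtoC_mult, Rmult_0_l.
      cbn [Cpow]. field. split; apply RtoC_neq0; (apply INR_fact_neq_0 || (apply not_0_INR; lia)).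
    - intros x Hx. exists (exp (Cmod v * x)). intros N.
      eapply Rle_trans; [|apply (exp_partial_sums _ N)].
      + apply Req_le, rsum_ext. intros k _.
        rewrite Cmod_div_R by apply INR_fact_lt_0.
        rewrite Cmod_pow, Rpow_mult_distr. unfold Rdiv; rring.
      + apply Rmult_le_pos; [apply Cmod_ge_0 | lra].
    - intros x _. rewrite Rmult_0_l, Rplus_0_r. split; [lra|]. rewrite Rinv_1. apply (is_derive_id (K := R_AbsRing)).
    - easy.
    - unfold R0; lra. }
  exists (fun n => cexp c * (v ^ n / RtoC (INR (fact n)))). split.
  - intros N. rewrite exp_plus.
    rewrite (rsum_ext _ (fun n => exp (Re c) * ((Cmod v * r) ^ n / INR (fact n)))%R).
    + rewrite rsum_scal. apply Rmult_le_compat_l; [apply Rlt_le, exp_pos|].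
      apply exp_partial_sums. apply Rmult_le_pos; [apply Cmod_ge_0 | easy].
    + intros k _. rewrite Cmod_mult, Cmod_cexp, Cmod_div_R by apply INR_fact_lt_0.
      rewrite Cmod_pow, Rpow_mult_distr. unfold Rdiv; rring.
  - intros t _. refine (Cseries_ext _ _ _ _ _ _ (Cseries_scal (cexp c) _ _ (S t))).
    + intros n; ring.
    + rewrite <- cexp_plus. f_equal. unfold line; ring.
Qed.

Lemma ln_INR_ge0 n : (1 <= n)%nat -> (0 <= ln (INR n))%R.
Proof.
  intros H. rewrite <- ln_1. apply ln_le; [lra|]. apply (le_INR 1); easy.
Qed.

Lemma exp_INR_ln n A : (1 <= n)%nat -> exp (INR A * ln (INR n)) = (INR n ^ A)%R.
Proof. intros H. apply (Rpower_pow A). apply lt_0_INR; lia. Qed.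

(** Points of modulus at most [A] satisfy [|n^(-s)| <= n^A], and the same bound holds for the norm
    of the expansion. A natural number [A] keeps the later estimates within integer powers. *)
Lemma maj_natpow n A (c v : C) (r : R) : (1 <= n)%nat -> (0 <= r)%R ->
  (Cmod c + Cmod v * r <= INR A)%R ->
  maj (fun t => natpow n (- line c v t)) r (INR n ^ A).
Proof.
  intros Hn Hr HA. set (L := ln (INR n)).
  assert (HL : (0 <= L)%R) by now apply ln_INR_ge0.
  apply (maj_ext (fun t => cexp (line (- (c * RtoC L)) (- (v * RtoC L)) t))).
  { intros t _. rewrite natpow_cexp. f_equal. fold L. unfold line. ring. }
  eapply maj_le; [now apply maj_cexp|].
  rewrite <- exp_INR_ln by easy. fold L.
  assert (E : (Re (- (c * RtoC L)) + Cmod (- (v * RtoC L)) * r <= INR A * L)%R).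
  { rewrite Cmod_opp, Cmod_mult, Cmod_R, Rabs_pos_eq by easy.
    assert (Re (- (c * RtoC L)) <= Cmod c * L)%R.
    { eapply Rle_trans; [apply Rle_abs|]. eapply Rle_trans; [apply re_le_Cmod|].
      rewrite Cmod_opp, Cmod_mult, Cmod_R, Rabs_pos_eq by easy. lra. }
    nra. }
  destruct E as [E|E]; [apply Rlt_le; now apply exp_increasing | rewrite E; lra].
Qed.

Lemma natpow_plus n s s' : natpow n (s + s') = natpow n s * natpow n s'.
Proof. rewrite !natpow_cexp, <- cexp_plus. f_equal; ring. Qed.

Lemma natpow_opp n s : natpow n (- s) = / natpow n s.
Proof. rewrite !natpow_cexp, <- cexp_opp. f_equal; ring. Qed.

Lemma natpow_1 s : natpow 1 s = 1.
Proof. rewrite natpow_cexp. simpl. rewrite ln_1, Cmult_0_r. apply cexp_0. Qed.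

Lemma natpow_INR n k : (1 <= n)%nat -> natpow n (RtoC (INR k)) = RtoC (INR n) ^ k.
Proof.
  intros H. unfold natpow. simpl. rewrite Rmult_0_l, cos_0, sin_0.
  rewrite exp_INR_ln by easy. rewrite RtoC_pow. change (1, 0)%R with (RtoC 1). ring.
Qed.

Lemma Cmod_natpow n s : Cmod (natpow n s) = exp (Re s * ln (INR n)).
Proof.
  rewrite natpow_cexp, Cmod_cexp. f_equal. destruct s; simpl; ring.
Qed.

Lemma Cmod_natpow_le n s k : (1 <= n)%nat -> (Re s <= - INR k)%R ->
  (Cmod (natpow n s) <= / INR n ^ k)%R.
Proof.
  intros Hn H. rewrite Cmod_natpow, <- exp_INR_ln, <- exp_Ropp by easy.
  pose proof (ln_INR_ge0 n Hn).
  assert (E : (Re s * ln (INR n) <= - (INR k * ln (INR n)))%R) by nra.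
  destruct E as [E|E]; [apply Rlt_le; now apply exp_increasing | rewrite E; lra].
Qed.

(** [a (a+1) ... (a+n-1) / n!], a bound for [|Cbinom (- s) n|] when [|s| <= a]. *)
Fixpoint rising (a : R) (n : nat) : R :=
  match n with
  | O => 1
  | S m => rising a m * (a + INR m) / INR (S m)
  end%R.

Lemma rising_pos a n : (0 < a)%R -> (0 < rising a n)%R.
Proof.
  intros Ha; induction n as [|n IH]; [simpl; lra|].
  cbn [rising]. pose proof (pos_INR n). pose proof (lt_0_INR (S n) ltac:(lia)).
  apply Rdiv_lt_0_compat; [|easy]. apply Rmult_lt_0_compat; lra.
Qed.

Lemma Cbinom_0 z : Cbinom z 0 = 1.
Proof. unfold Cbinom; simpl. field. Qed.

Lemma Cbinom_S z n : Cbinom z (S n) = Cbinom z n * (z - RtoC (INR n)) / RtoC (INR (S n)).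
Proof.
  unfold Cbinom. rewrite fact_simpl, mult_INR, RtoC_mult. cbn [Cfalling].
  field. split; apply RtoC_neq0; (apply INR_fact_neq_0 || (apply not_0_INR; lia)).
Qed.

Lemma maj_Cbinom (c v : C) (a r : R) l : (0 <= r)%R -> (Cmod c + Cmod v * r <= a)%R ->
  maj (fun t => Cbinom (- line c v t) l) r (rising a l).
Proof.
  intros Hr Ha. pose proof (Cmod_ge_0 c). pose proof (Cmod_ge_0 v).
  induction l as [|l IH].
  - apply (maj_ext (fun _ => RtoC 1)); [intros; now rewrite Cbinom_0|].
    cbn [rising]. eapply maj_le; [apply maj_const | rewrite Cmod_1; lra].
  - pose proof (lt_0_INR (S l) ltac:(lia)).
    apply (maj_ext (fun t => Cbinom (- line c v t) l
       * (RtoC (/ INR (S l)) * line (- c - RtoC (INR l)) (- v) t))).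
    + intros t _. rewrite Cbinom_S. unfold line. rewrite RtoC_inv by lra.
      field. apply RtoC_neq0; lra.
    + cbn [rising]. unfold Rdiv. rewrite Rmult_assoc. apply maj_mult; [easy | easy|].
      eapply maj_le; [apply maj_scal; [easy | now apply maj_line]|].
      rewrite Cmod_R, Rabs_pos_eq by (apply Rlt_le, Rinv_0_lt_compat; lra).
      rewrite Rmult_comm. apply Rmult_le_compat_r; [apply Rlt_le, Rinv_0_lt_compat; lra|].
      rewrite Cmod_opp. pose proof (Cmod_sub_le (- c) (RtoC (INR l))) as T.
      rewrite Cmod_opp, Cmod_R, Rabs_pos_eq in T by apply pos_INR. lra.
Qed.

Lemma Cmod_Cbinom_le (z : C) (a : R) l : (Cmod z <= a)%R -> (Cmod (Cbinom z l) <= rising a l)%R.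
Proof.
  intros H. pose proof (maj_Cbinom (- z) 0 a 0 l (Rle_refl 0)) as M.
  rewrite Cmod_opp, Cmod_0 in M. specialize (M ltac:(lra)).
  apply (maj_bound _ _ _ 0) in M; [|rewrite Rabs_R0; lra].
  cbv beta in M. replace (- line (- z) 0 0) with z in M by (unfold line; ring). exact M.
Qed.

(** These are the terms of the expansion of [(1 - x)^(-a)]; the ratio of successive terms is
    [x + x (a - 1) / (n + 1)], which tends to [x < 1]. The case [x = 0] is separate because the
    ratio test needs nonzero terms. *)
Lemma rising_series a x : (0 < a)%R -> (0 <= x < 1)%R ->
  exists B, forall N, (sum_n (fun n => rising a n * x ^ n) N <= B)%R.
Proof.
  intros Ha Hx.
  destruct (Rle_lt_or_eq_dec 0 x (proj1 Hx)) as [Px|<-].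
  2:{ exists 1%R. intros N. apply Req_le. induction N as [|N IH].
      - rewrite rsum_O. simpl. rring.
      - rewrite rsum_S, IH. simpl. rring. }
  assert (PT : forall n, (0 < rising a n * x ^ n)%R).
  { intros n. apply Rmult_lt_0_compat; [now apply rising_pos | now apply pow_lt]. }
  assert (E : ex_series (fun n => Rabs (rising a n * x ^ n))).
  { apply ex_series_DAlembert with x; [lra | intros n; apply Rgt_not_eq, PT|].
    apply is_lim_seq_ext with (fun n => x + x * (a - 1) * / INR (S n))%R.
    - intros n. rewrite Rabs_pos_eq.
      + cbn [rising pow]. pose proof (rising_pos a n Ha). pose proof (pow_lt x n Px).
        pose proof (lt_0_INR (S n) ltac:(lia)). rewrite S_INR in *. field. repeat split; lra.
      + apply Rlt_le, Rdiv_lt_0_compat; apply PT.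
    - assert (L : is_lim_seq (fun n => / INR (S n))%R 0%R).
      { apply (is_lim_seq_inv (fun n => INR (S n)) p_infty); [|easy].
        apply (is_lim_seq_incr_1 INR), is_lim_seq_INR. }
      apply (is_lim_seq_scal_l _ (x * (a - 1))%R) in L. cbn [Rbar_mult Rbar_mult'] in L.
      pose proof (is_lim_seq_plus' _ _ _ _ (is_lim_seq_const x) L) as Q.
      replace x with (x + x * (a - 1) * 0)%R at 1 by ring. exact Q. }
  destruct E as [B HB]. exists B. intros N.
  eapply Rle_trans; [|apply (rsum_le_series _ _ N (fun k => Rabs_pos _) HB)].
  apply rsum_le; intros; apply Rle_abs.
Qed.

Lemma binomial_series (z : C) (x : R) : (Rabs x < 1)%R ->
  Cseries (fun n => Cbinom z n * RtoC x ^ n) (cexp (z * RtoC (ln (1 + x)))).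
Proof.
  intros Hx.
  rewrite <- (Cmult_1_l (cexp _)), <- (Cbinom_0 z).
  apply (ode_series (Cbinom z) z 1 1 (fun x => ln (1 + x))%R).
  - intros n. rewrite Cbinom_S, Rmult_1_l. field. apply RtoC_neq0, not_0_INR; lia.
  - intros y Hy. pose proof (Cmod_ge_0 z).
    destruct (rising_series (Cmod z + 1) y ltac:(lra) Hy) as [B HB]. exists B. intros N.
    eapply Rle_trans; [|apply (HB N)]. apply rsum_le; intros k _.
    apply Rmult_le_compat_r; [apply pow_le; lra|]. apply Cmod_Cbinom_le; lra.
  - intros y Hy. apply Rabs_def2 in Hy. rewrite Rmult_1_l. split; [lra|].
    auto_derive; [lra | field; lra].
  - rewrite Rplus_0_r. apply ln_1.
  - exact Hx.
Qed.

Lemma natpow_pred n z : (1 <= n)%nat ->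
  natpow n z = natpow (S n) z * cexp (z * RtoC (ln (1 + - / INR (S n)))).
Proof.
  intros H. rewrite !natpow_cexp, <- cexp_plus. f_equal.
  rewrite <- Cmult_plus_distr_l, <- RtoC_plus. f_equal. f_equal.
  assert (P : (0 < INR n)%R) by (apply lt_0_INR; lia).
  pose proof (lt_0_INR (S n) ltac:(lia)).
  rewrite <- ln_mult.
  - f_equal. rewrite S_INR in *. field. lra.
  - easy.
  - apply (Rmult_lt_reg_r (INR (S n))); [easy|]. rewrite Rmult_plus_distr_r, <- Ropp_mult_distr_l, Rinv_l by lra.
    rewrite S_INR. lra.
Qed.

(** * The Euler-Maclaurin step *)

Lemma INR_S_neq0 n : RtoC (INR (S n)) <> RtoC 0.
Proof. apply RtoC_neq0, not_0_INR; lia. Qed.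

Lemma RtoC_INR_S n : RtoC (INR (S n)) = RtoC (INR n) + 1.
Proof. now rewrite S_INR, RtoC_plus. Qed.

Lemma Cbinom_absorb z k : Cbinom (z + 1) (S k) = (z + 1) / RtoC (INR (S k)) * Cbinom z k.
Proof.
  induction k as [|k IH].
  - rewrite Cbinom_S, !Cbinom_0. simpl. field.
  - rewrite Cbinom_S, IH, Cbinom_S.
    pose proof (INR_S_neq0 k). pose proof (INR_S_neq0 (S k)).
    rewrite (RtoC_INR_S k) in *. field. split; easy.
Qed.

Lemma Cbinom_nat_gt l k : (l < k)%nat -> Cbinom (RtoC (INR l)) k = RtoC 0.
Proof.
  induction k as [|k IH]; intros H; [lia|].
  rewrite Cbinom_S. pose proof (INR_S_neq0 k).
  destruct (Nat.eq_dec l k) as [->|N]; [field; easy|].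
  rewrite IH by lia. field; easy.
Qed.

Lemma Cbinom_nat_diag k : Cbinom (RtoC (INR k)) k = 1.
Proof.
  induction k as [|k IH]; [apply Cbinom_0|].
  rewrite RtoC_INR_S at 1. rewrite Cbinom_absorb, IH, RtoC_INR_S.
  pose proof (INR_S_neq0 k) as H. rewrite RtoC_INR_S in H. now field.
Qed.

Lemma Cbinom_nat_pred k : Cbinom (RtoC (INR (S k))) k = RtoC (INR (S k)).
Proof.
  induction k as [|k IH]; [now rewrite Cbinom_0|].
  rewrite (RtoC_INR_S (S k)), Cbinom_absorb, IH.
  pose proof (INR_S_neq0 k). now field.
Qed.

(** Trinomial revision with a complex upper argument. It re-indexes the expansions of all the
    [(m - 1)^(- s - k)] by [l = k + j], so that each term carries the same factor
    [Cbinom (- s) l]. *)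
Lemma Cbinom_mult z k j :
  Cbinom z k * Cbinom (z - RtoC (INR k)) j
  = Cbinom z (k + j) * Cbinom (RtoC (INR (k + j))) k.
Proof.
  induction j as [|j IH].
  - rewrite Nat.add_0_r, Cbinom_0, Cbinom_nat_diag. ring.
  (* With [n = k + j], both sides equal [(k + 1) * Cbinom (n + 1) (k + 1)]. *)
  - assert (E : Cbinom (RtoC (INR (S (k + j)))) k * RtoC (INR (S j))
        = RtoC (INR (S (k + j))) * Cbinom (RtoC (INR (k + j))) k).
    { clear IH z. generalize (k + j)%nat (Nat.le_add_r k j) (Nat.add_comm k j).
      intros n Hk Hn. rewrite Nat.add_comm in Hn.
      assert (A : RtoC (INR (S n)) * Cbinom (RtoC (INR n)) k
         = Cbinom (RtoC (INR (S n))) (S k) * RtoC (INR (S k))).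
      { rewrite (RtoC_INR_S n), Cbinom_absorb. pose proof (INR_S_neq0 k). now field. }
      rewrite A, Cbinom_S. pose proof (INR_S_neq0 k).
      replace (RtoC (INR (S n)) - RtoC (INR k)) with (RtoC (INR (S j))); [now field|].
      rewrite !S_INR, Hn, plus_INR, <- RtoC_minus. f_equal; ring. }
    rewrite Nat.add_succ_r, !Cbinom_S.
    pose proof (INR_S_neq0 j). pose proof (INR_S_neq0 (k + j)).
    replace (z - RtoC (INR k) - RtoC (INR j)) with (z - RtoC (INR (k + j)))
      by (rewrite plus_INR, RtoC_plus; ring).
    transitivity (Cbinom z k * Cbinom (z - RtoC (INR k)) j * (z - RtoC (INR (k + j)))
      / RtoC (INR (S j))); [now field|].
    rewrite IH.
    transitivity (Cbinom z (k + j) * (z - RtoC (INR (k + j))) * (RtoC (INR (S (k + j)))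
      * Cbinom (RtoC (INR (k + j))) k) / (RtoC (INR (S (k + j))) * RtoC (INR (S j)))); [field; easy|].
    rewrite <- E. field. easy.
Qed.

Lemma Cmod_m1_pow k : Cmod ((- 1) ^ k) = 1%R.
Proof. rewrite Cmod_pow, Cmod_R, Rabs_left by lra. replace (- -1)%R with 1%R by ring. apply pow1. Qed.

(** With [b k = zeta (- k)], the coefficient of [Cbinom (- s) l * (- 1 / m) ^ l] in
    [(m ^ (- s) - em_tail b P s (m - 1) + em_tail b P s m) / m ^ (- s)]. *)
Definition em_coef (b : nat -> C) (P l : nat) : C :=
  (if (l =? 0)%nat then 1 else 0) - / RtoC (INR (S l))
  - sum_n (fun k => b k * (- 1) ^ k * Cbinom (RtoC (INR l)) k) P
  + (if (l <=? P)%nat then b l * (- 1) ^ l else 0).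

(** The Euler-Maclaurin approximation to the tail sum of [m^(-s)] over [m > n], with [b k] in the
    role usually given to Bernoulli numbers. *)
Definition em_tail (b : nat -> C) (P : nat) (s : C) (n : nat) : C :=
  natpow n (1 - s) / (s - 1)
  + sum_n (fun k => Cbinom (- s) k * b k * natpow n (- s - RtoC (INR k))) P.

(** A series rather than a difference of values of [em_tail]: in this form it also makes sense at
    [s = 1], where [em_tail] divides by zero, and its vanishing at [s = - N] can be read off
    termwise. *)
Definition em_step (b : nat -> C) (P : nat) (s : C) (m : nat) : C :=
  natpow m (- s)
  * Csum (fun l => Cbinom (- s) l * em_coef b P l * RtoC (- / INR m) ^ l).

Lemma Cbinom_sum_trunc (g : nat -> C) l P : (l <= P)%nat ->
  sum_n (fun k => g k * Cbinom (RtoC (INR l)) k) P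
  = sum_n (fun k => g k * Cbinom (RtoC (INR l)) k) l.
Proof.
  intros H. induction H as [|P H IH]; [easy|].
  rewrite csum_S, IH, Cbinom_nat_gt by lia. cring.
Qed.

(** For [1 <= l <= P] the term [k = l] of the sum cancels the last summand of [em_coef], so the
    equation of index [l = n + 1] involves only [b 0, ..., b n], the last one with the factor
    [n + 1] up to sign. The system is triangular, its [P + 1] equations settle [l = 1, ..., P + 1],
    and [l = 0] holds for any [b]. *)
Lemma em_coef_zero_exists P :
  exists b : nat -> C, forall l, (l <= S P)%nat -> em_coef b P l = RtoC 0.
Proof.
  assert (R : exists b : nat -> C, forall n, (n <= P)%nat ->
     sum_n (fun k => b k * (- 1) ^ k * Cbinom (RtoC (INR (S n))) k) n
     = - / RtoC (INR (S (S n)))).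
  { induction P as [|P [b IH]].
    - exists (fun _ => - / RtoC (INR 2)). intros n Hn. replace n with 0%nat by lia.
      rewrite csum_O, Cbinom_0. cbn [Cpow]. cring.
    - set (T := sum_n (fun k => b k * (- 1) ^ k * Cbinom (RtoC (INR (S (S P)))) k) P).
      (* The new value solves the equation at [n = S P], where [b (S P)] has the coefficient
         [INR (S (S P))] times a sign that is its own inverse. *)
      exists (fun k => if (k <=? P)%nat then b k else
        (- / RtoC (INR (S (S (S P)))) - T) / RtoC (INR (S (S P))) * (- 1) ^ (S P)).
      intros n Hn.
      assert (E : forall m, (m <= P)%nat -> forall z,
         sum_n (fun k => (if (k <=? P)%nat then b k else
        (- / RtoC (INR (S (S (S P)))) - T) / RtoC (INR (S (S P))) * (- 1) ^ (S P))
           * (- 1) ^ k * Cbinom z k) m = sum_n (fun k => b k * (- 1) ^ k * Cbinom z k) m).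
      { intros m Hm z. apply csum_ext. intros k Hk. now rewrite (leb_correct k P) by lia. }
      destruct (Nat.eq_dec n (S P)) as [->|N].
      + rewrite csum_S, E by lia. fold T. rewrite leb_correct_conv, Cbinom_nat_pred by lia.
        assert (Q : (- 1) ^ S P * (- 1) ^ S P = RtoC 1).
        { rewrite <- Cpow_mult_l. replace (RtoC (- 1) * RtoC (- 1)) with (RtoC 1) by ring. apply Cpow_1_l. }
        pose proof (INR_S_neq0 (S P)).
        transitivity (T + (- / RtoC (INR (S (S (S P)))) - T) * ((- 1) ^ S P * (- 1) ^ S P));
          [cfield; repeat split; apply INR_S_neq0 | rewrite Q; cring].
      + rewrite E by lia. apply IH; lia. }
  destruct R as [b Hb]. exists b. intros l Hl. unfold em_coef.
  destruct l as [|n].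
  - rewrite (Cbinom_sum_trunc (fun k => b k * (- 1) ^ k)) by lia.
    rewrite csum_O, Cbinom_0. simpl. field.
  - cbn [Nat.eqb]. destruct (Nat.leb_spec (S n) P) as [L|L].
    + rewrite (Cbinom_sum_trunc (fun k => b k * (- 1) ^ k)) by lia.
      rewrite csum_S, Hb, Cbinom_nat_diag by lia. cring.
    + replace n with P by lia. rewrite Hb by lia. ring.
Qed.

Lemma Cseries_Cbinom_shift (z y : C) (V : C) k :
  Cseries (fun j => Cbinom z k * Cbinom (z - RtoC (INR k)) j * y ^ j) V ->
  Cseries (fun l => Cbinom z l * Cbinom (RtoC (INR l)) k * y ^ l) (y ^ k * V).
Proof.
  intros H. apply Cseries_shift_n with k.
  - intros n Hn. rewrite (Cbinom_nat_gt n k Hn). ring.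
  - refine (Cseries_ext _ _ _ _ _ eq_refl (Cseries_scal (y ^ k) _ _ H)).
    intros n. rewrite Cbinom_mult, Cpow_add_r. ring.
Qed.

(** The sums [V1] and [V k] of the binomial series are left abstract because there are two
    applications: [y = - 1 / m], where they are powers of [1 - 1 / m], and [y = - 1] with [s] a
    nonpositive integer, where the series are finite. *)
Lemma em_coef_series b P (s y V1 : C) (V : nat -> C) : s <> RtoC 1 -> y <> RtoC 0 ->
  Cseries (fun j => Cbinom (1 - s) j * y ^ j) V1 ->
  (forall k, (k <= P)%nat ->
     Cseries (fun j => Cbinom (- s) k * Cbinom (- s - RtoC (INR k)) j * y ^ j) (V k)) ->
  Cseries (fun l => Cbinom (- s) l * em_coef b P l * y ^ l)
    (1 - (V1 - 1) / (y * (1 - s)) - sum_n (fun k => b k * (- 1) ^ k * (y ^ k * V k)) P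
     + sum_n (fun k => b k * (- 1) ^ k * Cbinom (- s) k * y ^ k) P).
Proof.
  intros Hs Hy H1 HV.
  assert (Hs' : 1 - s <> RtoC 0).
  { intros E; apply Hs. replace s with (1 - (1 - s)) by ring. rewrite E. ring. }
  assert (SA : Cseries (fun l => Cbinom (- s) l * (if (l =? 0)%nat then 1 else 0) * y ^ l) (RtoC 1)).
  { apply Cseries_eventually with 0%nat. intros n _. induction n as [|n IH].
    - rewrite csum_O, Cbinom_0. simpl. cring.
    - rewrite csum_S, IH. simpl Nat.eqb. cbv iota. cring. }
  (* Absorption turns the factor [1 / (l + 1)] into the binomial series of exponent [1 - s], shifted
     by one and without its constant term; this is where [s = 1] is excluded. *)
  assert (SB : Cseries (fun l => Cbinom (- s) l * / RtoC (INR (S l)) * y ^ l)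
     ((V1 - 1) / (y * (1 - s)))).
  { assert (SB' : Cseries (fun j => Cbinom (1 - s) (S j) * y ^ S j) (V1 - 1)).
    { apply (Cseries_shift (fun j => Cbinom (1 - s) j * y ^ j)).
      refine (Cseries_ext _ _ _ _ (fun n => eq_refl) _ H1). rewrite Cbinom_0. simpl. ring. }
    refine (Cseries_ext _ _ _ _ _ _ (Cseries_scal (/ (y * (1 - s))) _ _ SB'));
      [|unfold Cdiv; ring].
    intros n. replace (1 - s) with (- s + 1) in * by ring.
    rewrite Cbinom_absorb. cbn [Cpow]. pose proof (INR_S_neq0 n). now field. }
  assert (SC : Cseries (fun l => sum_n (fun k => b k * (- 1) ^ k
        * (Cbinom (- s) l * Cbinom (RtoC (INR l)) k * y ^ l)) P)
     (sum_n (fun k => b k * (- 1) ^ k * (y ^ k * V k)) P)).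
  { apply (Cseries_sum (fun k l => b k * (- 1) ^ k
        * (Cbinom (- s) l * Cbinom (RtoC (INR l)) k * y ^ l))).
    intros k Hk. apply Cseries_scal. apply Cseries_Cbinom_shift. now apply HV. }
  assert (SD : Cseries (fun l => if (l <=? P)%nat then b l * (- 1) ^ l * Cbinom (- s) l * y ^ l else RtoC 0)
     (sum_n (fun k => b k * (- 1) ^ k * Cbinom (- s) k * y ^ k) P)).
  { apply Cseries_eventually with P. intros n Hn. induction Hn as [|n Hn IH].
    - apply csum_ext. intros k Hk. now rewrite leb_correct.
    - rewrite csum_S, IH, leb_correct_conv by lia. cring. }
  refine (Cseries_ext _ _ _ _ _ _ (Cseries_plus _ _ _ _ (Cseries_plus _ _ _ _
    (Cseries_plus _ _ _ _ SA (Cseries_scal (- (1)) _ _ SB)) (Cseries_scal (- (1)) _ _ SC)) SD)).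
  - intros l. unfold em_coef.
    rewrite (csum_ext (fun k => b k * (- 1) ^ k * (Cbinom (- s) l * Cbinom (RtoC (INR l)) k * y ^ l))
      (fun k => (Cbinom (- s) l * y ^ l) * (b k * (- 1) ^ k * Cbinom (RtoC (INR l)) k)))
      by (intros; ring).
    rewrite csum_scal. destruct (l <=? P)%nat; cring.
  - unfold Cdiv. cring.
Qed.

(** The growth in [l] is only polynomial. The ratio [2 / 3] is chosen because
    [1 / 2 = 3 / 4 * (2 / 3)], which leaves the ratio [3 / 4] for the convergence of the series in
    [rising]. *)
Lemma em_coef_bounded b P : exists K, (0 <= K)%R /\
  forall l, (Cmod (em_coef b P l) * (2 / 3) ^ l <= K)%R.
Proof.
  (* The terms of a convergent series are bounded, and [|Cbinom (- 1) l| = 1]. *)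
  assert (T : forall k, exists K, (0 <= K)%R /\
     forall l, (Cmod (Cbinom (RtoC (INR l)) k) * (2 / 3) ^ l <= K)%R).
  { intros k.
    assert (H : Cseries (fun l => Cbinom (- (1)) l * Cbinom (RtoC (INR l)) k * RtoC (2 / 3) ^ l)
      (RtoC (2 / 3) ^ k * (Cbinom (- (1)) k
        * cexp ((- (1) - RtoC (INR k)) * RtoC (ln (1 + 2 / 3)))))).
    { apply Cseries_Cbinom_shift.
      refine (Cseries_ext _ _ _ _ _ eq_refl (Cseries_scal (Cbinom (- (1)) k) _ _
        (binomial_series (- (1) - RtoC (INR k)) (2 / 3) _))).
      - intros n; ring.
      - rewrite Rabs_pos_eq; lra. }
    destruct (Cseries_terms_bounded _ _ H) as [K [HK0 HK]]. exists K; split; [easy|].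
    intros l. specialize (HK l).
    rewrite !Cmod_mult, Cmod_pow, Cmod_R, Rabs_pos_eq in HK by lra.
    assert (E : Cmod (Cbinom (- (1)) l) = 1%R).
    { clear. induction l as [|l IH]; [rewrite Cbinom_0; apply Cmod_1|].
      rewrite Cbinom_S, Cmod_div_R, Cmod_mult, IH by (apply lt_0_INR; lia).
      replace (- (1) - RtoC (INR l)) with (- RtoC (INR (S l))) by (rewrite RtoC_INR_S; ring).
      rewrite Cmod_opp, Cmod_R, Rabs_pos_eq by apply pos_INR.
      field. apply not_0_INR; lia. }
    rewrite E in HK. lra. }
  assert (T2 : exists K, (0 <= K)%R /\ forall l,
     (Cmod (sum_n (fun k => b k * (- 1) ^ k * Cbinom (RtoC (INR l)) k)%C P) * (2 / 3) ^ l <= K)%R).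
  { induction P as [|P [K [HK0 HK]]].
    - destruct (T 0%nat) as [K [HK0 HK]].
      pose proof (Cmod_ge_0 (b 0%nat)).
      exists (Cmod (b 0%nat) * K)%R; split; [now apply Rmult_le_pos|].
      intros l. rewrite csum_O. cbn [Cpow]. rewrite !Cmod_mult, Cmod_1, Rmult_1_r, Rmult_assoc.
      now apply Rmult_le_compat_l.
    - destruct (T (S P)) as [K' [HK0' HK']]. pose proof (Cmod_ge_0 (b (S P))).
      exists (K + Cmod (b (S P)) * K')%R; split; [pose proof (Rmult_le_pos _ _ H HK0'); lra|].
      intros l. rewrite csum_S. specialize (HK l). specialize (HK' l).
      set (X := sum_n (fun k => b k * (- 1) ^ k * Cbinom (RtoC (INR l)) k) P) in *.
      pose proof (Cmod_triangle X (b (S P) * (- 1) ^ S P * Cbinom (RtoC (INR l)) (S P))) as Q.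
      rewrite !Cmod_mult, Cmod_m1_pow, Rmult_1_r in Q.
      assert (P0 : (0 <= (2 / 3) ^ l)%R) by (apply pow_le; lra).
      apply Rmult_le_compat_r with (1 := P0) in Q.
      apply Rmult_le_compat_l with (1 := H) in HK'.
      eapply Rle_trans; [exact Q|]. lra. }
  destruct T2 as [K [HK0 HK]].
  set (K' := sum_n (fun l => Cmod (b l)) P).
  assert (HK' : forall l, (Cmod (if (l <=? P)%nat then b l * (- 1) ^ l else RtoC 0) <= K')%R).
  { intros l. destruct (Nat.leb_spec l P) as [L|L].
    - rewrite Cmod_mult, Cmod_m1_pow, Rmult_1_r.
      apply (rsum_term (fun l => Cmod (b l))); [intros; apply Cmod_ge_0 | easy].
    - rewrite Cmod_0. apply rsum_ge0; intros; apply Cmod_ge_0. }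
  assert (0 <= K')%R by (apply rsum_ge0; intros; apply Cmod_ge_0).
  exists (2 + K + K')%R; split; [lra|]. intros l. unfold em_coef.
  specialize (HK l). specialize (HK' l).
  set (X := sum_n (fun k => b k * (- 1) ^ k * Cbinom (RtoC (INR l)) k) P) in *.
  set (Y := if (l <=? P)%nat then b l * (- 1) ^ l else RtoC 0) in *.
  set (Z := if (l =? 0)%nat then RtoC 1 else RtoC 0).
  assert (HZ : (Cmod Z <= 1)%R).
  { unfold Z. destruct (l =? 0)%nat; [rewrite Cmod_1 | rewrite Cmod_0]; lra. }
  assert (HI : (Cmod (/ RtoC (INR (S l))) <= 1)%R).
  { rewrite Cmod_inv, Cmod_R, Rabs_pos_eq by (apply pos_INR || apply INR_S_neq0).
    rewrite <- Rinv_1. apply Rinv_le_contravar; [lra|]. apply (le_INR 1); lia. }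
  pose proof (Cmod_triangle (Z - / RtoC (INR (S l)) - X) Y) as Q1.
  pose proof (Cmod_sub_le (Z - / RtoC (INR (S l))) X) as Q2.
  pose proof (Cmod_sub_le Z (/ RtoC (INR (S l)))) as Q3.
  assert (P0 : (0 <= (2 / 3) ^ l <= 1)%R).
  { split; [apply pow_le; lra|]. rewrite <- (pow1 l). apply pow_incr; lra. }
  assert (PX := Cmod_ge_0 X). pose proof (Cmod_ge_0 Y).
  apply Rle_trans with ((2 + Cmod X + K') * (2 / 3) ^ l)%R;
    [apply Rmult_le_compat_r; lra | nra].
Qed.

(** Since [1 / 2] is the largest value of [1 / m] for [m >= 2], one constant [G] controls the series
    of [em_step] for all [m] at once. *)
Lemma em_coef_summable b P a : (0 < a)%R -> exists G, (0 <= G)%R /\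
  forall N, (sum_n (fun l => rising a l * Cmod (em_coef b P l) * (1 / 2) ^ l) N <= G)%R.
Proof.
  intros Ha. destruct (em_coef_bounded b P) as [K [HK0 HK]].
  destruct (rising_series a (3 / 4) Ha ltac:(lra)) as [B HB].
  assert (PT : forall l, (0 <= rising a l * (3 / 4) ^ l)%R).
  { intros l. apply Rmult_le_pos; [now apply Rlt_le, rising_pos | apply pow_le; lra]. }
  assert (0 <= B)%R by (eapply Rle_trans; [|apply (HB 0%nat)]; now apply rsum_ge0).
  exists (K * B)%R; split; [now apply Rmult_le_pos|]. intros N.
  apply Rle_trans with (K * sum_n (fun l => rising a l * (3 / 4) ^ l)%R N)%R;
    [|now apply Rmult_le_compat_l].
  rewrite <- rsum_scal. apply rsum_le. intros l _.
  replace (1 / 2)%R with (3 / 4 * (2 / 3))%R by field. rewrite Rpow_mult_distr.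
  specialize (HK l). specialize (PT l). nra.
Qed.

(** In [/ m = 2 / m * (1 / 2)] the first factor supplies the decay in [m] and the second keeps the
    series in [l] convergent. *)
Lemma pow_inv_tail (m : R) P l : (2 <= m)%R -> (P <= l)%nat ->
  ((/ m) ^ l <= (2 / m) ^ P * (1 / 2) ^ l)%R.
Proof.
  intros Hm H. replace (/ m)%R with (2 / m * (1 / 2))%R by (field; lra).
  rewrite Rpow_mult_distr. apply Rmult_le_compat_r; [apply pow_le; lra|].
  apply pow_decr; [|easy]. split.
  - apply Rlt_le, Rdiv_lt_0_compat; lra.
  - apply (Rmult_le_reg_r m); [lra|]. unfold Rdiv; rewrite Rmult_assoc, Rinv_l; lra.
Qed.

(** The functions [phi l] stand for [Cbinom (- s) l], along a line or at a fixed [s]. The factor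
    [kappa] is [1] for convergence and analyticity and becomes [|e2|] in the final error estimate.
    Only [l >= P + 2] is constrained, as the lower coefficients vanish. *)
Lemma em_step_terms b P (a kappa G : R) (phi : nat -> R -> C) (r : R) m :
  (0 < a)%R -> (0 <= r)%R -> (0 <= kappa)%R -> (2 <= m)%nat ->
  (forall l, (l <= S P)%nat -> em_coef b P l = RtoC 0) ->
  (forall N, (sum_n (fun l => rising a l * Cmod (em_coef b P l) * (1 / 2) ^ l) N <= G)%R) ->
  (forall l, (P + 2 <= l)%nat -> maj (phi l) r (kappa * rising a l)) ->
  (forall l, maj (fun t => phi l t * em_coef b P l * RtoC (- / INR m) ^ l) r
      (kappa * (2 / INR m) ^ (P + 2) * (rising a l * Cmod (em_coef b P l) * (1 / 2) ^ l))) /\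
  (forall N, (sum_n (fun l => kappa * (2 / INR m) ^ (P + 2)
       * (rising a l * Cmod (em_coef b P l) * (1 / 2) ^ l)) N
     <= kappa * (2 / INR m) ^ (P + 2) * G)%R).
Proof.
  intros Ha Hr Hk Hm Hb HG Hphi.
  assert (M2 : (2 <= INR m)%R) by (apply (le_INR 2); easy).
  assert (Q0 : (0 <= (2 / INR m) ^ (P + 2))%R)
    by (apply pow_le, Rlt_le, Rdiv_lt_0_compat; lra).
  split.
  - intros l. destruct (Nat.le_gt_cases (P + 2) l) as [L|L].
    + set (c := em_coef b P l * RtoC (- / INR m) ^ l).
      apply (maj_ext (fun t => c * phi l t)); [intros; unfold c; ring|].
      eapply maj_le; [apply maj_scal; [easy | now apply Hphi]|].
      unfold c. rewrite Cmod_mult_pow, Rabs_Ropp, Rabs_pos_eq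
        by (apply Rlt_le, Rinv_0_lt_compat; lra).
      pose proof (pow_inv_tail (INR m) (P + 2) l M2 L) as T.
      pose proof (rising_pos a l Ha) as Rp. pose proof (Cmod_ge_0 (em_coef b P l)) as Cp.
      assert (0 <= Cmod (em_coef b P l) * (kappa * rising a l))%R
        by (apply Rmult_le_pos; [easy | apply Rmult_le_pos; lra]).
      apply Rmult_le_compat_l with (1 := H) in T. lra.
    + rewrite (Hb l) by lia.
      apply (maj_ext (fun _ => RtoC 0)); [intros; ring|].
      eapply maj_le; [apply maj_const|]. rewrite Cmod_0. lra.
  - intros N. rewrite rsum_scal. apply Rmult_le_compat_l; [|apply HG].
    now apply Rmult_le_pos.
Qed.

Lemma maj_em_step b P A (a kappa G : R) (c v : C) (r : R) m :
  (0 < a)%R -> (0 < r)%R -> (0 <= kappa)%R -> (2 <= m)%nat ->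
  (Cmod c + Cmod v * r <= INR A)%R ->
  (forall l, (l <= S P)%nat -> em_coef b P l = RtoC 0) ->
  (forall N, (sum_n (fun l => rising a l * Cmod (em_coef b P l) * (1 / 2) ^ l) N <= G)%R) ->
  (forall l, (P + 2 <= l)%nat -> maj (fun t => Cbinom (- line c v t) l) r (kappa * rising a l)) ->
  maj (fun t => em_step b P (line c v t) m) r
    (INR m ^ A * (kappa * (2 / INR m) ^ (P + 2) * G)).
Proof.
  intros Ha Hr Hk Hm HA Hb HG Hphi.
  destruct (em_step_terms b P a kappa G (fun l t => Cbinom (- line c v t) l) r m) as [T1 T2];
    try easy; try lra.
  unfold em_step. apply maj_mult; [lra | apply maj_natpow; [lia | lra | easy] |].
  exact (maj_series _ _ r _ Hr T1 T2).
Qed.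

Lemma em_step_closed b P (s : C) n : (1 <= n)%nat -> s <> RtoC 1 ->
  (forall l, (l <= S P)%nat -> em_coef b P l = RtoC 0) ->
  em_step b P s (S n) = natpow (S n) (- s) - em_tail b P s n + em_tail b P s (S n).
Proof.
  intros Hn Hs Hb.
  assert (M2 : (2 <= INR (S n))%R) by (apply (le_INR 2); lia).
  pose proof (INR_S_neq0 n) as NZ.
  set (x := (- / INR (S n))%R).
  assert (Hx : (Rabs x < 1)%R).
  { unfold x. rewrite Rabs_Ropp, Rabs_pos_eq by (apply Rlt_le, Rinv_0_lt_compat; lra).
    rewrite <- Rinv_1. apply Rinv_lt_contravar; lra. }
  assert (Ex : RtoC x = - / RtoC (INR (S n)))
    by (unfold x; rewrite RtoC_opp, RtoC_inv by lra; easy).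
  assert (Hs' : s - 1 <> RtoC 0).
  { intros E; apply Hs. replace s with (s - 1 + 1) by ring. rewrite E. ring. }
  (* With [m = S n] this is [((m - 1) / m)^z], so that [natpow n z = natpow m z * V z]. *)
  set (V z := cexp (z * RtoC (ln (1 + x)))).
  assert (S0 := em_coef_series b P s (RtoC x) (V (1 - s))
    (fun k => Cbinom (- s) k * V (- s - RtoC (INR k))) Hs).
  assert (Hx0 : RtoC x <> RtoC 0).
  { apply RtoC_neq0. unfold x. apply Ropp_neq_0_compat, Rinv_neq_0_compat; lra. }
  specialize (S0 Hx0 (binomial_series _ _ Hx)).
  assert (S1 : forall k, (k <= P)%nat -> Cseries
     (fun j => Cbinom (- s) k * Cbinom (- s - RtoC (INR k)) j * RtoC x ^ j)
     (Cbinom (- s) k * V (- s - RtoC (INR k)))).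
  { intros k _. refine (Cseries_ext _ _ _ _ _ eq_refl (Cseries_scal (Cbinom (- s) k) _ _
      (binomial_series (- s - RtoC (INR k)) x Hx))). intros; ring. }
  specialize (S0 S1).
  pose proof (Cmod_ge_0 s) as Ps.
  assert (Ha : (0 < Cmod s + 1)%R) by lra.
  destruct (em_coef_summable b P (Cmod s + 1) Ha) as [G [HG0 HG]].
  destruct (em_step_terms b P (Cmod s + 1) 1 G (fun l _ => Cbinom (- s) l) 1 (S n)) as [T1 T2];
    try easy; try lra; try lia.
  { intros l _. eapply maj_le; [apply maj_const|]. rewrite Rmult_1_l. apply Cmod_Cbinom_le.
    rewrite Cmod_opp. lra. }
  (* The absolute bound required for evaluating [Csum] is that of [em_step_terms] for constant
     functions, read at [t = 0]. *)
  unfold em_step. rewrite (Csum_unique _ _ (1 * (2 / INR (S n)) ^ (P + 2) * G)%R (fun N =>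
    Rle_trans _ _ _ (rsum_le _ _ N (fun l _ => maj_bound _ _ _ 0 (T1 l)
      (eq_ind_r (fun z => (z <= 1)%R) Rle_0_1 Rabs_R0))) (T2 N)) S0).
  unfold em_tail.
  assert (NP : forall z, natpow n z = natpow (S n) z * V z)
    by (intros z; now apply natpow_pred).
  assert (N1 : natpow (S n) (1 - s) = natpow (S n) (- s) * RtoC (INR (S n))).
  { replace (1 - s) with (- s + RtoC (INR 1)) by (simpl; ring).
    rewrite natpow_plus, natpow_INR by lia. cbn [Cpow]. ring. }
  assert (Nk : forall k, natpow (S n) (- s - RtoC (INR k)) = natpow (S n) (- s) * (- RtoC x) ^ k).
  { intros k. unfold Cminus. rewrite natpow_plus, (natpow_opp _ (RtoC (INR k))), natpow_INR by lia. f_equal.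
    rewrite Ex, <- Cpow_inv by easy. f_equal. ring. }
  assert (Sg : forall k, (- RtoC x) ^ k = (- 1) ^ k * RtoC x ^ k).
  { intros k. rewrite <- Cpow_mult_l. f_equal. ring. }
  rewrite (csum_ext (fun k => Cbinom (- s) k * b k * natpow n (- s - RtoC (INR k)))
    (fun k => natpow (S n) (- s) * (b k * (- 1) ^ k
       * (RtoC x ^ k * (Cbinom (- s) k * V (- s - RtoC (INR k))))))).
  2:{ intros k _. rewrite NP, Nk, Sg. ring. }
  rewrite (csum_ext (fun k => Cbinom (- s) k * b k * natpow (S n) (- s - RtoC (INR k)))
    (fun k => natpow (S n) (- s) * (b k * (- 1) ^ k * Cbinom (- s) k * RtoC x ^ k))).
  2:{ intros k _. rewrite Nk, Sg. ring. }
  rewrite !csum_scal, NP, N1.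
  replace ((V (1 - s) - 1) / (RtoC x * (1 - s)))
    with (RtoC (INR (S n)) * (V (1 - s) - 1) / (s - 1)).
  2:{ rewrite Ex. field. repeat split; try easy.
      intros E; apply Hs'. replace (s - 1) with (- (1 - s)) by ring. rewrite E. ring. }
  gen_sums C. field. exact Hs'.
Qed.

(** [W] will be either [1] (for the zeta function) or the partial sums of
    [n ^ (- s1)] (for the double zeta function). *)
Definition em_rem (b : nat -> C) (P : nat) (W : nat -> C) (s : C) : C :=
  Csum (fun i => W i * em_step b P s (i + 2)).

Lemma inv_succ_mult_partial N :
  (sum_n (fun i => / (INR (i + 2) * INR (i + 2))) N <= 1)%R.
Proof.
  apply Rle_trans with (1 - / INR (N + 2))%R.
  - induction N as [|N IH]; [rewrite rsum_O; simpl; lra|].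
    rewrite rsum_S. replace (S N + 2)%nat with (S (N + 2)) by lia. rewrite !S_INR.
    assert (H : (2 <= INR (N + 2))%R) by (apply (le_INR 2); lia).
    set (x := INR (N + 2)) in *.
    assert (/ ((x + 1) * (x + 1)) <= / x - / (x + 1))%R; [|lra].
    replace (/ x - / (x + 1))%R with (/ (x * (x + 1)))%R by (field; lra).
    apply Rinv_le_contravar; nra.
  - assert (0 < / INR (N + 2))%R by (apply Rinv_0_lt_compat, lt_0_INR; lia). lra.
Qed.

(** The power budget: [m^A] from [m^(-s)] and [m^A'] from [W] are absorbed by [m^P], so the decay
    [m^(-(P+2))] of the bracket leaves [m^(-2)], whose sum over [m >= 2] is at most [1]. *)
Lemma em_rem_terms b P A A' (a kappa G : R) (W : nat -> R -> C) (c v : C) (r : R) :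
  (0 < a)%R -> (0 < r)%R -> (0 <= kappa)%R -> (0 <= G)%R ->
  (Cmod c + Cmod v * r <= INR A)%R -> (A + A' <= P)%nat ->
  (forall l, (l <= S P)%nat -> em_coef b P l = RtoC 0) ->
  (forall N, (sum_n (fun l => rising a l * Cmod (em_coef b P l) * (1 / 2) ^ l) N <= G)%R) ->
  (forall l, (P + 2 <= l)%nat -> maj (fun t => Cbinom (- line c v t) l) r (kappa * rising a l)) ->
  (forall i, maj (W i) r (INR (i + 2) ^ A')) ->
  (forall i, maj (fun t => W i t * em_step b P (line c v t) (i + 2)) r
     (kappa * G * 2 ^ (P + 2) * / (INR (i + 2) * INR (i + 2)))) /\
  (forall N, (sum_n (fun i => kappa * G * 2 ^ (P + 2) * / (INR (i + 2) * INR (i + 2)))%R N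
     <= kappa * G * 2 ^ (P + 2))%R).
Proof.
  intros Ha Hr Hk HG0 HA HP Hb HG Hphi HW.
  assert (K0 : (0 <= kappa * G * 2 ^ (P + 2))%R)
    by (apply Rmult_le_pos; [now apply Rmult_le_pos | apply pow_le; lra]).
  split.
  - intros i.
    eapply maj_le; [apply maj_mult; [lra | apply HW |
      apply (maj_em_step b P A a kappa G); try easy; lia]|].
    assert (M2 : (2 <= INR (i + 2))%R) by (apply (le_INR 2); lia).
    set (m := INR (i + 2)) in *.
    unfold Rdiv. rewrite Rpow_mult_distr, pow_inv.
    assert (E : (m ^ A' * m ^ A <= m ^ P)%R).
    { rewrite <- pow_add. apply Rle_pow; [lra | lia]. }
    rewrite (pow_add m P 2).
    assert (Mp : (0 < m ^ P)%R) by (apply pow_lt; lra).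
    replace (m ^ A' * (m ^ A * (kappa * (2 ^ (P + 2) * / (m ^ P * m ^ 2)) * G)))%R
      with (kappa * G * 2 ^ (P + 2) * / (m * m) * (m ^ A' * m ^ A * / m ^ P))%R
      by (field; split; lra).
    assert (m ^ A' * m ^ A * / m ^ P <= 1)%R.
    { apply (Rmult_le_reg_r (m ^ P)); [easy|]. rewrite Rmult_assoc, Rinv_l; lra. }
    assert (0 <= kappa * G * 2 ^ (P + 2) * / (m * m))%R
      by (apply Rmult_le_pos; [easy | apply Rlt_le, Rinv_0_lt_compat; nra]).
    nra.
  - intros N. rewrite rsum_scal. pose proof (inv_succ_mult_partial N). nra.
Qed.

Lemma abel_sum (y W E : nat -> C) X : (forall i, W i = sum_n y i) ->
  sum_n (fun i => W i * (E (i + 1)%nat - E (i + 2)%nat)) X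
  = sum_n (fun j => y j * E (j + 1)%nat) X - W X * E (X + 2)%nat.
Proof.
  intros HW. induction X as [|X IH].
  - rewrite !csum_O, HW, csum_O. simpl. cring.
  - rewrite !(csum_S _ X), IH, (HW (S X)), csum_S, <- HW.
    replace (S X + 1)%nat with (X + 2)%nat by lia. cring.
Qed.

(** * Identity theorem for meromorphic functions of two variables *)

Lemma line_0 c v : line c v 0 = c.
Proof. unfold line. ring. Qed.

Lemma line_to a b : line a (b - a) 1 = b.
Proof. unfold line. ring. Qed.

Lemma Cmod_line_diff c v t t' : Cmod (line c v t - line c v t') = (Rabs (t - t') * Cmod v)%R.
Proof. rewrite <- Cmod_R, <- Cmod_mult. f_equal. unfold line. rewrite RtoC_minus. ring. Qed.

Lemma disc_convex (p a b : C) (r t : R) : (0 <= t <= 1)%R ->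
  (Cmod (a - p) < r)%R -> (Cmod (b - p) < r)%R -> (Cmod (line a (b - a) t - p) < r)%R.
Proof.
  intros Ht Ha Hb.
  replace (line a (b - a) t - p) with (RtoC (1 - t) * (a - p) + RtoC t * (b - p))
    by (unfold line; rewrite RtoC_minus; ring).
  eapply Rle_lt_trans; [apply Cmod_triangle|].
  rewrite !Cmod_mult, !Cmod_R, !Rabs_pos_eq by lra.
  destruct (Rle_lt_or_eq_dec 0 t (proj1 Ht)) as [L|<-]; nra.
Qed.

Lemma polydisc_convex p1 p2 r a1 a2 b1 b2 t : (0 <= t <= 1)%R ->
  in_polydisc p1 p2 r a1 a2 -> in_polydisc p1 p2 r b1 b2 ->
  in_polydisc p1 p2 r (line a1 (b1 - a1) t) (line a2 (b2 - a2) t).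
Proof. intros Ht [H1 H2] [H3 H4]; split; now apply disc_convex. Qed.

Lemma polydisc_center p1 p2 r : (0 < r)%R -> in_polydisc p1 p2 r p1 p2.
Proof.
  intros H; split; replace (p1 - p1) with (RtoC 0) by ring;
    replace (p2 - p2) with (RtoC 0) by ring; now rewrite Cmod_0.
Qed.

Lemma polydisc_open p1 p2 r c1 c2 : in_polydisc p1 p2 r c1 c2 ->
  exists e, (0 < e)%R /\ forall z1 z2, in_polydisc c1 c2 e z1 z2 -> in_polydisc p1 p2 r z1 z2.
Proof.
  intros [H1 H2]. exists (Rmin (r - Cmod (c1 - p1)) (r - Cmod (c2 - p2))).
  split; [apply Rmin_pos; lra|]. intros z1 z2 [Z1 Z2].
  pose proof (Rmin_l (r - Cmod (c1 - p1)) (r - Cmod (c2 - p2))).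
  pose proof (Rmin_r (r - Cmod (c1 - p1)) (r - Cmod (c2 - p2))).
  split.
  - replace (z1 - p1) with ((z1 - c1) + (c1 - p1)) by ring.
    eapply Rle_lt_trans; [apply Cmod_triangle | lra].
  - replace (z2 - p2) with ((z2 - c2) + (c2 - p2)) by ring.
    eapply Rle_lt_trans; [apply Cmod_triangle | lra].
Qed.

Lemma polydisc_le p1 p2 r r' z1 z2 : (r <= r')%R ->
  in_polydisc p1 p2 r z1 z2 -> in_polydisc p1 p2 r' z1 z2.
Proof. intros H [H1 H2]; split; lra. Qed.

Lemma line_near c1 v1 c2 v2 t0 e : (0 < e)%R ->
  exists d, (0 < d)%R /\ forall t, (Rabs (t - t0) < d)%R ->
    in_polydisc (line c1 v1 t0) (line c2 v2 t0) e (line c1 v1 t) (line c2 v2 t).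
Proof.
  intros He. pose proof (Cmod_ge_0 v1) as V1. pose proof (Cmod_ge_0 v2) as V2.
  set (V := (Cmod v1 + Cmod v2 + 1)%R). assert (HV : (0 < V)%R) by (unfold V; lra).
  exists (e / V)%R. split; [now apply Rdiv_lt_0_compat|]. intros t Ht.
  apply Rmult_lt_compat_r with (r := V) in Ht; [|easy].
  replace (e / V * V)%R with e in Ht by (field; lra).
  pose proof (Rabs_pos (t - t0)).
  split; rewrite Cmod_line_diff; unfold V in Ht; nra.
Qed.

(** Analytic along all real lines; this is all that the identity theorem needs
    of the explicit side. *)
Definition line_analytic (Om : C -> C -> Prop) (f : C -> C -> C) : Prop :=
  forall c1 v1 c2 v2 t0, Om (line c1 v1 t0) (line c2 v2 t0) ->
    AN (fun t => f (line c1 v1 t) (line c2 v2 t)) t0.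

Lemma AN_nonzero_near_0 (phi : R -> C) d : (0 < d)%R ->
  (forall t, (0 <= t <= 1)%R -> AN phi t) -> phi 1%R <> RtoC 0 ->
  exists t, (0 < t < d)%R /\ (t <= 1)%R /\ phi t <> RtoC 0.
Proof.
  intros Hd HA N1. apply NNPP. intros C0. apply N1.
  assert (Hm : (0 < Rmin d 1)%R) by (apply Rmin_pos; lra).
  apply (AN_identity phi (Rmin d 1) Hm HA). intros t Ht. apply NNPP. intros C1. apply C0.
  pose proof (Rmin_l d 1). pose proof (Rmin_r d 1).
  exists t; repeat split; try easy; lra.
Qed.

Lemma AN_holomorphic2_segment (h : C -> C -> C) x1 x2 r a1 a2 b1 b2 :
  (forall z1 z2, in_polydisc x1 x2 r z1 z2 -> holomorphic2_at h z1 z2) ->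
  in_polydisc x1 x2 r a1 a2 -> in_polydisc x1 x2 r b1 b2 ->
  forall t, (0 <= t <= 1)%R -> AN (fun t => h (line a1 (b1 - a1) t) (line a2 (b2 - a2) t)) t.
Proof.
  intros H Ha Hb t Ht. apply AN_holomorphic2_at, H. now apply polydisc_convex.
Qed.

(** If [h] vanished near [c], it would vanish along the segment from [c] to a point [a] with
    [h a <> 0]. Nonzero points thus occur arbitrarily close to [c], and each has a polydisc free of
    zeros. *)
Lemma holomorphic2_nonzero_dense (h : C -> C -> C) x1 x2 r a1 a2 c1 c2 e : (0 < e)%R ->
  (forall z1 z2, in_polydisc x1 x2 r z1 z2 -> holomorphic2_at h z1 z2) ->
  in_polydisc x1 x2 r a1 a2 -> h a1 a2 <> RtoC 0 -> in_polydisc x1 x2 r c1 c2 ->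
  exists b1 b2 eta, (0 < eta)%R /\ forall z1 z2, in_polydisc b1 b2 eta z1 z2 ->
    in_polydisc c1 c2 e z1 z2 /\ h z1 z2 <> RtoC 0.
Proof.
  intros He H Ha Na Hc.
  destruct (polydisc_open _ _ _ _ _ Hc) as [e' [He' Hsub]].
  assert (Hm : (0 < Rmin e e')%R) by now apply Rmin_pos.
  destruct (line_near c1 (a1 - c1) c2 (a2 - c2) 0 (Rmin e e') Hm) as [d [Hd L]].
  destruct (AN_nonzero_near_0 (fun t => h (line c1 (a1 - c1) t) (line c2 (a2 - c2) t)) d Hd
    (AN_holomorphic2_segment h x1 x2 r c1 c2 a1 a2 H Hc Ha)) as [t [Ht [Ht1 Nt]]].
  { now rewrite !line_to. }
  specialize (L t). rewrite Rminus_0_r, Rabs_pos_eq, !line_0 in L by lra. specialize (L ltac:(lra)).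
  set (b1 := line c1 (a1 - c1) t) in *. set (b2 := line c2 (a2 - c2) t) in *.
  assert (Hb : in_polydisc x1 x2 r b1 b2)
    by (apply Hsub; apply polydisc_le with (2 := L), Rmin_r).
  destruct (holomorphic2_at_nonzero h b1 b2 (H _ _ Hb) Nt) as [eta [Heta Hn]].
  destruct (polydisc_open _ _ _ _ _ L) as [e2 [He2 L2]].
  exists b1, b2, (Rmin eta e2). split; [now apply Rmin_pos|]. intros z1 z2 Hz. split.
  - apply polydisc_le with (Rmin e e'); [apply Rmin_l|]. apply L2.
    apply polydisc_le with (2 := Hz), Rmin_r.
  - apply Hn. apply polydisc_le with (2 := Hz), Rmin_l.
Qed.

Section MeromorphicIdentity.

Context (f Q G : C -> C -> C) (R0 : R).
Let Om := in_polydisc 0 0 R0.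
Context (Hf : meromorphic2 f) (HQ : line_analytic Om Q) (HG : line_analytic Om G).

(** The identity is required on some open polydisc arbitrarily near the point, not on a
    neighbourhood of it: near a pole the values of [f] on the zero set of the denominator are
    arbitrary. This weaker property is the one that can pass through poles. *)
Definition locally_dense_eq (x1 x2 : C) : Prop :=
  forall e, (0 < e)%R -> exists c1 c2 eta, (0 < eta)%R /\
    forall z1 z2, in_polydisc c1 c2 eta z1 z2 ->
      in_polydisc x1 x2 e z1 z2 /\ Om z1 z2 /\ f z1 z2 * Q z1 z2 = G z1 z2.

Definition local_quotient (x1 x2 : C) (r : R) (g h : C -> C -> C) : Prop :=
  (forall z1 z2 : C, in_polydisc x1 x2 r z1 z2 ->
     holomorphic2_at g z1 z2 /\ holomorphic2_at h z1 z2) /\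
  (exists z1 z2 : C, in_polydisc x1 x2 r z1 z2 /\ h z1 z2 <> RtoC 0) /\
  (forall z1 z2 : C, in_polydisc x1 x2 r z1 z2 -> h z1 z2 <> RtoC 0 ->
     f z1 z2 = g z1 z2 / h z1 z2).

(** Multiplication by [h] removes the unconstrained values: [g * Q - G * h] is analytic along
    segments and vanishes on a small polydisc near [y]. The polydisc and [Om] are convex, so a
    segment from there reaches [w] within both. *)
Lemma quotient_eq x1 x2 r g h y1 y2 : local_quotient x1 x2 r g h ->
  in_polydisc x1 x2 r y1 y2 -> locally_dense_eq y1 y2 ->
  forall w1 w2, in_polydisc x1 x2 r w1 w2 -> Om w1 w2 ->
    g w1 w2 * Q w1 w2 = G w1 w2 * h w1 w2.
Proof.
  intros [Hgh [[a1 [a2 [Ha Na]]] Hq]] Hy Dy w1 w2 Hw Ow.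
  assert (Hh : forall z1 z2, in_polydisc x1 x2 r z1 z2 -> holomorphic2_at h z1 z2)
    by (intros; now apply Hgh).
  assert (Hg : forall z1 z2, in_polydisc x1 x2 r z1 z2 -> holomorphic2_at g z1 z2)
    by (intros; now apply Hgh).
  destruct (polydisc_open _ _ _ _ _ Hy) as [e [He Sy]].
  destruct (Dy e He) as [c1 [c2 [eta [Heta Dc]]]].
  assert (Hc : in_polydisc x1 x2 r c1 c2)
    by (apply Sy; exact (proj1 (Dc c1 c2 (polydisc_center _ _ _ Heta)))).
  destruct (holomorphic2_nonzero_dense h x1 x2 r a1 a2 c1 c2 eta Heta Hh Ha Na Hc)
    as [b1 [b2 [eta' [Heta' Db]]]].
  assert (U0 : forall z1 z2, in_polydisc b1 b2 eta' z1 z2 ->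
    in_polydisc x1 x2 r z1 z2 /\ Om z1 z2 /\ g z1 z2 * Q z1 z2 - G z1 z2 * h z1 z2 = RtoC 0).
  { intros z1 z2 Hz. destruct (Db _ _ Hz) as [Z1 Nz]. destruct (Dc _ _ Z1) as [Z2 [Oz E]].
    pose proof (Sy _ _ Z2) as Z3. split; [easy | split; [easy|]].
    rewrite <- E, (Hq _ _ Z3 Nz). now field. }
  destruct (U0 b1 b2 (polydisc_center _ _ _ Heta')) as [Hb [Ob _]].
  destruct (line_near b1 (w1 - b1) b2 (w2 - b2) 0 eta' Heta') as [d [Hd L]].
  set (u t := g (line b1 (w1 - b1) t) (line b2 (w2 - b2) t)
       * Q (line b1 (w1 - b1) t) (line b2 (w2 - b2) t)
     - G (line b1 (w1 - b1) t) (line b2 (w2 - b2) t)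
       * h (line b1 (w1 - b1) t) (line b2 (w2 - b2) t)).
  assert (Z : u 1%R = RtoC 0).
  { apply (AN_identity u d Hd).
    - intros t Ht. apply AN_minus; apply AN_mult;
        try (apply (AN_holomorphic2_segment _ x1 x2 r); easy);
        [apply HQ | apply HG]; now apply polydisc_convex.
    - intros t Ht. apply U0. specialize (L t). rewrite !line_0 in L. apply L.
      rewrite Rminus_0_r, Rabs_pos_eq; lra. }
  unfold u in Z. rewrite !line_to in Z.
  replace (g w1 w2 * Q w1 w2) with (g w1 w2 * Q w1 w2 - G w1 w2 * h w1 w2 + G w1 w2 * h w1 w2)
    by ring. rewrite Z. ring.
Qed.

Lemma locally_dense_spread x1 x2 r g h y1 y2 : local_quotient x1 x2 r g h ->
  in_polydisc x1 x2 r y1 y2 -> locally_dense_eq y1 y2 ->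
  forall w1 w2, in_polydisc x1 x2 r w1 w2 -> Om w1 w2 -> locally_dense_eq w1 w2.
Proof.
  intros HL Hy Dy w1 w2 Hw Ow e He.
  pose proof (quotient_eq _ _ _ _ _ _ _ HL Hy Dy) as E.
  destruct HL as [Hgh [[a1 [a2 [Ha Na]]] Hq]].
  destruct (polydisc_open _ _ _ _ _ Hw) as [e1 [He1 S1]].
  destruct (polydisc_open _ _ _ _ _ Ow) as [e2 [He2 S2]].
  set (m := Rmin e (Rmin e1 e2)).
  assert (Hm : (0 < m)%R) by (apply Rmin_pos; [|apply Rmin_pos]; easy).
  assert (M : (m <= e /\ m <= e1 /\ m <= e2)%R).
  { unfold m. pose proof (Rmin_l e (Rmin e1 e2)). pose proof (Rmin_r e (Rmin e1 e2)).
    pose proof (Rmin_l e1 e2). pose proof (Rmin_r e1 e2). lra. }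
  destruct (holomorphic2_nonzero_dense h x1 x2 r a1 a2 w1 w2 m Hm
    (fun z1 z2 Hz => proj2 (Hgh z1 z2 Hz)) Ha Na Hw) as [b1 [b2 [eta [Heta Db]]]].
  exists b1, b2, eta; split; [easy|]. intros z1 z2 Hz. destruct (Db _ _ Hz) as [Z Nz].
  assert (Z1 : in_polydisc x1 x2 r z1 z2) by (apply S1, polydisc_le with m; easy).
  assert (Z2 : Om z1 z2) by (apply S2, polydisc_le with m; easy).
  split; [apply polydisc_le with m; easy | split; [easy|]].
  rewrite (Hq _ _ Z1 Nz). specialize (E _ _ Z1 Z2).
  replace (G z1 z2) with (G z1 z2 * h z1 z2 / h z1 z2) by now field.
  rewrite <- E. now field.
Qed.

(** Holomorphy of [f] is required only at the end point [p]. The segment from [q] to [p] may run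
    through poles, since around each of its points a local quotient spreads [locally_dense_eq] over
    a whole polydisc. *)
Lemma meromorphic2_identity q1 q2 eta p1 p2 :
  (0 < eta)%R -> Om q1 q2 ->
  (forall z1 z2, in_polydisc q1 q2 eta z1 z2 -> Om z1 z2 -> f z1 z2 * Q z1 z2 = G z1 z2) ->
  Om p1 p2 -> holomorphic2_at f p1 p2 -> f p1 p2 * Q p1 p2 = G p1 p2.
Proof.
  intros Heta Oq Hq Op Hp.
  set (l1 := line q1 (p1 - q1)). set (l2 := line q2 (p2 - q2)).
  assert (Ol : forall t, (0 <= t <= 1)%R -> Om (l1 t) (l2 t))
    by (intros; now apply polydisc_convex).
  assert (Dp : locally_dense_eq (l1 1%R) (l2 1%R)).
  { apply (real_induction (fun t => locally_dense_eq (l1 t) (l2 t))).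
    - unfold l1, l2. rewrite !line_0. intros e He.
      destruct (polydisc_open _ _ _ _ _ Oq) as [e2 [He2 S2]].
      exists q1, q2, (Rmin e (Rmin eta e2)).
      pose proof (Rmin_l e (Rmin eta e2)). pose proof (Rmin_r e (Rmin eta e2)).
      pose proof (Rmin_l eta e2). pose proof (Rmin_r eta e2).
      split; [apply Rmin_pos; [|apply Rmin_pos]; easy|]. intros z1 z2 Hz.
      assert (Oz : Om z1 z2) by (apply S2; apply polydisc_le with (2 := Hz); lra).
      split; [apply polydisc_le with (2 := Hz); lra | split; [easy|]].
      apply Hq; [apply polydisc_le with (2 := Hz); lra | easy].
    - intros t Ht Dt. destruct (Hf (l1 t) (l2 t)) as [r [g [h [Hr HL]]]].
      destruct (line_near q1 (p1 - q1) q2 (p2 - q2) t r Hr) as [d [Hd L]].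
      exists d; split; [easy|]. intros t' Ht' Ht1.
      apply (locally_dense_spread _ _ _ _ _ _ _ HL (polydisc_center _ _ _ Hr) Dt).
      + apply L. apply Rabs_def1; lra.
      + apply Ol; lra.
    - intros t Ht Dt. destruct (Hf (l1 t) (l2 t)) as [r [g [h [Hr HL]]]].
      destruct (line_near q1 (p1 - q1) q2 (p2 - q2) t r Hr) as [d [Hd L]].
      set (t' := (t - Rmin t (d / 2))%R).
      assert (M : (0 < Rmin t (d / 2))%R) by (apply Rmin_pos; lra).
      pose proof (Rmin_l t (d / 2)). pose proof (Rmin_r t (d / 2)).
      assert (Lt' : in_polydisc (l1 t) (l2 t) r (l1 t') (l2 t'))
        by (apply L; unfold t'; apply Rabs_def1; lra).
      apply (locally_dense_spread _ _ _ _ _ _ _ HL Lt').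
      + apply Dt; unfold t'; lra.
      + now apply polydisc_center.
      + apply Ol; lra. }
  unfold l1, l2 in Dp. rewrite !line_to in Dp.
  destruct (Hf p1 p2) as [r [g [h [Hr HL]]]].
  pose proof (quotient_eq _ _ _ _ _ _ _ HL (polydisc_center _ _ _ Hr) Dp) as E.
  destruct HL as [Hgh [[a1 [a2 [Ha Na]]] Hgq]].
  (* [f] is holomorphic at [p], so [psi] is analytic at [0]; it vanishes at parameters near [0] with
     [h] nonzero. These accumulate at [0], which carries the identity to [p] itself even if [h]
     vanishes there. *)
  set (psi t := f (line p1 (a1 - p1) t) (line p2 (a2 - p2) t)
      * Q (line p1 (a1 - p1) t) (line p2 (a2 - p2) t)
      - G (line p1 (a1 - p1) t) (line p2 (a2 - p2) t)).
  assert (Z : exists e, (0 < e)%R /\ forall t, (Rabs (t - 0) < e)%R -> psi t = RtoC 0).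
  { apply AN_isolated_zeros.
    - apply AN_minus; [apply AN_mult|].
      + apply AN_holomorphic2_at. now rewrite !line_0.
      + apply HQ. now rewrite !line_0.
      + apply HG. now rewrite !line_0.
    - intros e He.
      destruct (polydisc_open _ _ _ _ _ Op) as [e2 [He2 S2]].
      destruct (line_near p1 (a1 - p1) p2 (a2 - p2) 0 (Rmin r e2)) as [d [Hd L]];
        [now apply Rmin_pos|]. rewrite !line_0 in L.
      destruct (AN_nonzero_near_0 (fun t => h (line p1 (a1 - p1) t) (line p2 (a2 - p2) t))
        (Rmin e d)) as [t [Ht [Ht1 Nt]]].
      + now apply Rmin_pos.
      + apply (AN_holomorphic2_segment h p1 p2 r);
          [intros; now apply Hgh | now apply polydisc_center | easy].
      + now rewrite !line_to.
      + pose proof (Rmin_l e d). pose proof (Rmin_r e d).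
        exists t; split; [rewrite Rminus_0_r, Rabs_pos_eq; lra|].
        specialize (L t). rewrite Rminus_0_r, Rabs_pos_eq in L by lra. specialize (L ltac:(lra)).
        assert (L1 := polydisc_le _ _ _ r _ _ (Rmin_l r e2) L).
        assert (L2 := S2 _ _ (polydisc_le _ _ _ e2 _ _ (Rmin_r r e2) L)).
        unfold psi. rewrite (Hgq _ _ L1 Nt). specialize (E _ _ L1 L2).
        set (z1 := line p1 (a1 - p1) t) in *. set (z2 := line p2 (a2 - p2) t) in *.
        replace (G z1 z2) with (G z1 z2 * h z1 z2 / h z1 z2) by now field.
        rewrite <- E. now field. }
  destruct Z as [e [He Z]]. specialize (Z 0%R).
  rewrite Rminus_0_r, Rabs_R0 in Z. specialize (Z He).
  unfold psi in Z. rewrite !line_0 in Z.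
  replace (f p1 p2 * Q p1 p2) with (f p1 p2 * Q p1 p2 - G p1 p2 + G p1 p2) by ring.
  rewrite Z. ring.
Qed.

End MeromorphicIdentity.

(** * The Riemann zeta-function *)

Lemma Csub_neq0 (a b : C) : a <> b -> a - b <> RtoC 0.
Proof. intros H E; apply H. replace a with (a - b + b) by ring. rewrite E; ring. Qed.

Lemma Cmod_inv_INR_le (K : R) eps : (0 <= K)%R -> (0 < eps)%R ->
  exists N, forall n, (N <= n)%nat -> (K / INR (n + 2) < eps)%R.
Proof.
  intros HK He. destruct (INR_unbounded (K / eps)) as [N HN].
  exists N. intros n Hn. assert (P : (INR N <= INR (n + 2))%R) by (apply le_INR; lia).
  assert (P0 : (0 < INR (n + 2))%R) by (apply lt_0_INR; lia).
  apply (Rmult_lt_reg_r (INR (n + 2))); [easy|].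
  replace (K / INR (n + 2) * INR (n + 2))%R with K by (field; lra).
  apply (Rmult_lt_compat_r eps) in HN; [|easy].
  replace (K / eps * eps)%R with K in HN by (field; lra). nra.
Qed.

Lemma em_tail_bound b P (s : C) : (2 <= Re s)%R ->
  exists K, (0 <= K)%R /\ forall n, (1 <= n)%nat -> (Cmod (em_tail b P s n) <= K / INR n)%R.
Proof.
  intros Hs.
  assert (Hs1 : s - 1 <> RtoC 0).
  { apply Csub_neq0. intros ->. simpl in Hs. lra. }
  assert (N1 : forall n z, (1 <= n)%nat -> (Re z <= -1)%R -> (Cmod (natpow n z) <= / INR n)%R).
  { intros n z Hn Hz. rewrite <- (pow_1 (INR n)). apply Cmod_natpow_le; [easy | simpl; lra]. }
  exists (/ Cmod (s - 1) + sum_n (fun k => Cmod (Cbinom (- s) k * b k)) P)%R. split.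
  - assert (0 < / Cmod (s - 1))%R by (apply Rinv_0_lt_compat, Cmod_gt_0, Hs1).
    pose proof (rsum_ge0 (fun k => Cmod (Cbinom (- s) k * b k)) P (fun k => Cmod_ge_0 _)). lra.
  - intros n Hn. unfold em_tail, Rdiv. rewrite Rmult_plus_distr_r.
    eapply Rle_trans; [apply Cmod_triangle|]. apply Rplus_le_compat.
    + rewrite Cmod_div by easy. unfold Rdiv. rewrite Rmult_comm.
      apply Rmult_le_compat_l; [apply Rlt_le, Rinv_0_lt_compat, Cmod_gt_0, Hs1|].
      apply N1; [easy|]. destruct s; simpl in *; lra.
    + eapply Rle_trans; [apply Cmod_csum|]. rewrite Rmult_comm, <- rsum_scal.
      apply rsum_le. intros k _. rewrite Cmod_mult, Rmult_comm.
      apply Rmult_le_compat_r; [apply Cmod_ge_0|]. apply N1; [easy|].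
      pose proof (pos_INR k). destruct s; simpl in *; lra.
Qed.

(** Abel summation in the limit: the boundary term [W X * em_tail b P s (X + 2)] tends to [0], as
    [W] is bounded and [em_tail] is [O(1 / n)] for [Re s >= 2]. With [y = 1, 0, 0, ...] this treats
    [zeta], with [y j = (j + 1)^(- s1)] the double zeta-function. *)
Lemma em_rem_identity b P (s : C) (y W : nat -> C) (Lz Ly : C) (KW : R) :
  (2 <= Re s)%R -> (forall l, (l <= S P)%nat -> em_coef b P l = RtoC 0) ->
  (forall i, W i = sum_n y i) -> (forall i, (Cmod (W i) <= KW)%R) ->
  Cseries (fun i => W i * natpow (i + 2) (- s)) Lz ->
  Cseries (fun j => y j * em_tail b P s (j + 1)) Ly ->
  Cseries (fun i => W i * em_step b P s (i + 2)) (Lz - Ly).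
Proof.
  intros Hs Hb HW HK HZ HY.
  assert (Hs1 : s <> RtoC 1) by (intros ->; simpl in Hs; lra).
  assert (K0 : (0 <= KW)%R) by (eapply Rle_trans; [apply Cmod_ge_0 | apply (HK 0%nat)]).
  destruct (em_tail_bound b P s Hs) as [K [HK0 HE]].
  assert (Part : forall X, sum_n (fun i => W i * em_step b P s (i + 2)) X
     = sum_n (fun i => W i * natpow (i + 2) (- s)) X
       - (sum_n (fun j => y j * em_tail b P s (j + 1)) X - W X * em_tail b P s (X + 2))).
  { intros X. rewrite <- (abel_sum y W (em_tail b P s) X HW), <- csum_minus.
    apply csum_ext. intros i _. replace (i + 2)%nat with (S (i + 1)) by lia.
    rewrite em_step_closed by (easy || lia). ring. }
  apply Cseries_iff. intros eps He.
  destruct (proj1 (Cseries_iff _ _) HZ (eps / 3)%R ltac:(lra)) as [N1 H1].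
  destruct (proj1 (Cseries_iff _ _) HY (eps / 3)%R ltac:(lra)) as [N2 H2].
  destruct (Cmod_inv_INR_le (KW * K) (eps / 3) (Rmult_le_pos _ _ K0 HK0) ltac:(lra)) as [N3 H3].
  exists (N1 + N2 + N3)%nat. intros n Hn. rewrite Part.
  specialize (H1 n ltac:(lia)). specialize (H2 n ltac:(lia)). specialize (H3 n ltac:(lia)).
  set (A := sum_n (fun i => W i * natpow (i + 2) (- s)) n) in *.
  set (B := sum_n (fun j => y j * em_tail b P s (j + 1)) n) in *.
  assert (H4 : (Cmod (W n * em_tail b P s (n + 2)) <= KW * K / INR (n + 2))%R).
  { rewrite Cmod_mult. unfold Rdiv. rewrite Rmult_assoc.
    apply Rmult_le_compat; try apply Cmod_ge_0; [apply HK | apply HE; lia]. }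
  set (D := W n * em_tail b P s (n + 2)) in *.
  replace (A - (B - D) - (Lz - Ly)) with ((A - Lz - (B - Ly)) + D) by cring.
  pose proof (Cmod_triangle (A - Lz - (B - Ly)) D).
  pose proof (Cmod_sub_le (A - Lz) (B - Ly)). lra.
Qed.

Lemma disc_room (z v : C) (R0 : R) : (Cmod z < R0)%R ->
  exists r, (0 < r)%R /\ (Cmod z + Cmod v * r <= R0)%R.
Proof.
  intros H. pose proof (Cmod_ge_0 v).
  exists ((R0 - Cmod z) / (Cmod v + 1))%R. split; [apply Rdiv_lt_0_compat; lra|].
  assert (Cmod v * ((R0 - Cmod z) / (Cmod v + 1)) <= R0 - Cmod z)%R; [|lra].
  apply (Rmult_le_reg_r (Cmod v + 1)); [lra|].
  replace (Cmod v * ((R0 - Cmod z) / (Cmod v + 1)) * (Cmod v + 1))%R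
    with (Cmod v * (R0 - Cmod z))%R by (field; lra). nra.
Qed.

Lemma AN_Cbinom c v k t0 : AN (fun t => Cbinom (- line c v t) k) t0.
Proof.
  exists 1%R, (rising (Cmod (line c v t0) + Cmod v) k). split; [lra|].
  apply (maj_ext (fun t => Cbinom (- line (line c v t0) v t) k));
    [intros; now rewrite line_shift|].
  apply maj_Cbinom; lra.
Qed.

Lemma em_rem_one_analytic b P : (1 <= P)%nat ->
  (forall l, (l <= S P)%nat -> em_coef b P l = RtoC 0) ->
  (forall c v t0, (Cmod (line c v t0) < INR P)%R ->
    AN (fun t => em_rem b P (fun _ => RtoC 1) (line c v t)) t0) /\
  (forall s, (Cmod s < INR P)%R ->
    Cseries (fun i => 1 * em_step b P s (i + 2)) (em_rem b P (fun _ => RtoC 1) s)).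
Proof.
  intros HP Hb. assert (P0 : (0 < INR P)%R) by (apply lt_0_INR; lia).
  destruct (em_coef_summable b P (INR P) P0) as [G [HG0 HG]].
  assert (T : forall c v r, (0 < r)%R -> (Cmod c + Cmod v * r <= INR P)%R ->
    (forall i, maj (fun t => 1 * em_step b P (line c v t) (i + 2)) r
     (1 * G * 2 ^ (P + 2) * / (INR (i + 2) * INR (i + 2)))) /\
    (forall N, (sum_n (fun i => 1 * G * 2 ^ (P + 2) * / (INR (i + 2) * INR (i + 2)))%R N
     <= 1 * G * 2 ^ (P + 2))%R)).
  { intros c v r Hr Hc.
    apply (em_rem_terms b P P 0 (INR P) 1 G (fun _ _ => RtoC 1)); try easy; try lra; try lia.
    - intros l _. rewrite Rmult_1_l. apply maj_Cbinom; lra.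
    - intros i. eapply maj_le; [apply maj_const|]. rewrite Cmod_1. simpl. lra. }
  split.
  - intros c v t0 H. destruct (disc_room _ v _ H) as [r [Hr Hc]].
    destruct (T _ _ r Hr Hc) as [T1 T2].
    exists r, (1 * G * 2 ^ (P + 2))%R. split; [easy|].
    apply (maj_ext (fun t => Csum (fun i => 1 * em_step b P (line (line c v t0) v t) (i + 2)))).
    + intros t _. now rewrite line_shift.
    + exact (maj_series _ _ r _ Hr T1 T2).
  - intros s H. destruct (T s 0 1%R Rlt_0_1) as [T1 T2]; [rewrite Cmod_0; lra|].
    apply (Cseries_abs _ (1 * G * 2 ^ (P + 2))). intros N.
    eapply Rle_trans; [|apply (T2 N)]. apply rsum_le. intros i _.
    pose proof (maj_bound _ _ _ 0 (T1 i)) as M. cbv beta in M. rewrite line_0 in M.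
    apply M. rewrite Rabs_R0; lra.
Qed.

(** [(s - 1) * zeta s] from the Euler-Maclaurin formula, without the pole. *)
Definition em_zeta (b : nat -> C) (P : nat) (s : C) : C :=
  (s - 1) * (1 + sum_n (fun k => Cbinom (- s) k * b k) P + em_rem b P (fun _ => RtoC 1) s) + 1.

Lemma AN_em_zeta b P c v t0 : (1 <= P)%nat ->
  (forall l, (l <= S P)%nat -> em_coef b P l = RtoC 0) ->
  (Cmod (line c v t0) < INR P)%R -> AN (fun t => em_zeta b P (line c v t)) t0.
Proof.
  intros HP Hb H. unfold em_zeta. apply AN_plus; [|apply AN_const].
  apply AN_mult; [apply AN_minus; [apply AN_line | apply AN_const]|].
  apply AN_plus; [apply AN_plus; [apply AN_const|]|].
  - apply AN_sum. intros k _. apply AN_mult; [apply AN_Cbinom | apply AN_const].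
  - now apply em_rem_one_analytic.
Qed.

Lemma zeta_em_start zeta b P s : is_riemann_zeta zeta -> (1 <= P)%nat ->
  (forall l, (l <= S P)%nat -> em_coef b P l = RtoC 0) ->
  (2 <= Re s)%R -> (Cmod s < INR P)%R -> (s - 1) * zeta s = em_zeta b P s.
Proof.
  intros [Hz _] HP Hb Hs HsP.
  assert (Hs1 : s - 1 <> RtoC 0) by (apply Csub_neq0; intros ->; simpl in Hs; lra).
  assert (SZ : Cseries (fun i => 1 * natpow (i + 2) (- s)) (zeta s - 1)).
  { apply (Cseries_ext (fun n => natpow (S (S n)) (- s)) _ (zeta s - 1)); [|easy|].
    - intros n. replace (n + 2)%nat with (S (S n)) by lia. ring.
    - apply (Cseries_shift (fun n => natpow (S n) (- s))).
      refine (Cseries_ext _ _ _ _ (fun n => eq_refl) _ (Hz s ltac:(lra))).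
      rewrite natpow_1. ring. }
  (* The constant weight [1] has increments [1, 0, 0, ...], so the series of [em_tail] reduces to
     its value at [n = 1]. *)
  set (y j := match j with O => RtoC 1 | _ => RtoC 0 end).
  assert (Hy : forall i, RtoC 1 = sum_n y i).
  { induction i as [|i IH]; [now rewrite csum_O|]. rewrite csum_S, <- IH. simpl. cring. }
  assert (SY : Cseries (fun j => y j * em_tail b P s (j + 1)) (em_tail b P s 1)).
  { apply Cseries_eventually with 0%nat. intros n _. induction n as [|n IH].
    - rewrite csum_O. simpl. cring.
    - rewrite csum_S, IH. simpl y. cring. }
  pose proof (em_rem_identity b P s y (fun _ => RtoC 1) _ _ 1 Hs Hb Hy
    (fun _ => Req_le _ _ Cmod_1) SZ SY) as E.
  apply (Cseries_unique _ _ _ (proj2 (em_rem_one_analytic b P HP Hb) s HsP)) in E.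
  unfold em_zeta. rewrite E. unfold em_tail. rewrite natpow_1.
  rewrite (csum_ext (fun k => Cbinom (- s) k * b k * natpow 1 (- s - RtoC (INR k)))
    (fun k => Cbinom (- s) k * b k)) by (intros; rewrite natpow_1; ring).
  gen_sums C. field. exact Hs1.
Qed.

Lemma zeta_em zeta b P s : is_riemann_zeta zeta -> (4 <= P)%nat ->
  (forall l, (l <= S P)%nat -> em_coef b P l = RtoC 0) ->
  (Cmod s < INR P)%R -> s <> RtoC 1 -> (s - 1) * zeta s = em_zeta b P s.
Proof.
  intros HZ HP Hb HsP Hs.
  assert (P4 : (4 <= INR P)%R) by (replace 4%R with (INR 4) by (simpl; ring); now apply le_INR).
  (* The path starts at [3 + i] or [3 - i], on the side of the real axis where [s] lies: its
     imaginary part then stays nonzero before the end, and the pole [1] is avoided. The start has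
     modulus below [4], whence [P >= 4]. *)
  set (sg := (if Rle_dec 0 (Im s) then 1 else -1)%R).
  set (q := (3, sg) : C).
  assert (Hsg : (0 <= sg * Im s /\ sg * sg = 1)%R)
    by (unfold sg; destruct (Rle_dec 0 (Im s)); lra).
  assert (Hq : (Cmod q < 4)%R).
  { unfold Cmod, q; simpl. replace 4%R with (sqrt (4 * 4)) by (apply sqrt_square; lra).
    apply sqrt_lt_1; nra. }
  set (u t := (line q (s - q) t - 1) * zeta (line q (s - q) t) - em_zeta b P (line q (s - q) t)).
  assert (D : forall t, (0 <= t <= 1)%R -> (Cmod (line q (s - q) t) < INR P)%R).
  { intros t Ht. replace (line q (s - q) t) with (line q (s - q) t - 0) by ring.
    apply disc_convex; [easy | |]; [replace (q - 0) with q by ring; lra |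
      replace (s - 0) with s by ring; lra]. }
  assert (RI : forall t, Re (line q (s - q) t) = (3 + t * (Re s - 3))%R /\
     Im (line q (s - q) t) = (sg + t * (Im s - sg))%R).
  { intros t. unfold line, q. destruct s as [a c]. simpl. split; ring. }
  assert (U : u 1%R = RtoC 0).
  { destruct (Rle_lt_dec 2 (Re s)) as [R3|R3].
    - unfold u. rewrite line_to, (zeta_em_start zeta b P s); try easy; try lra; try lia. ring.
    (* For [t] below this bound the real part [3 - t * (3 - Re s)] exceeds [2], where the formula is
       already known. *)
    - apply (AN_identity u (/ (3 - Re s))%R).
      + apply Rinv_0_lt_compat; lra.
      + intros t Ht. apply AN_minus.
        * apply AN_mult; [apply AN_minus; [apply AN_line | apply AN_const]|].
          apply AN_holomorphic_at. apply HZ. intros E.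
          destruct (RI t) as [_ I]. rewrite E in I. simpl in I.
          assert (T1 : (t = 1)%R).
          { assert ((1 - t) * (sg * sg) + t * (sg * Im s) = 0)%R; [|nra].
            replace ((1 - t) * (sg * sg) + t * (sg * Im s))%R
              with (sg * (sg + t * (Im s - sg)))%R by ring. rewrite <- I. ring. }
          apply Hs. rewrite <- E, T1. now rewrite line_to.
        * apply AN_em_zeta; [lia | easy | now apply D].
      + intros t Ht.
        assert (T : (t * (3 - Re s) < 1)%R).
        { replace 1%R with (/ (3 - Re s) * (3 - Re s))%R by (field; lra).
          apply Rmult_lt_compat_r; lra. }
        unfold u. rewrite (zeta_em_start zeta b P); try easy; try lia; try ring.
        * destruct (RI t) as [-> _]. lra.
        * apply D. nra. }
  unfold u in U. rewrite line_to in U.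
  replace ((s - 1) * zeta s) with ((s - 1) * zeta s - em_zeta b P s + em_zeta b P s) by ring.
  rewrite U. ring.
Qed.

(** * The values of zeta at nonpositive integers *)

Lemma Cbinom_alternating z n :
  sum_n (fun j => Cbinom (z + 1) j * (- 1) ^ j) n = (- 1) ^ n * Cbinom z n.
Proof.
  induction n as [|n IH]; [rewrite csum_O, !Cbinom_0; simpl; cring|].
  rewrite csum_S, IH, Cbinom_absorb, Cbinom_S. cbn [Cpow].
  pose proof (INR_S_neq0 n) as H. rewrite RtoC_INR_S in *. cfield. exact H.
Qed.

Lemma Cseries_alternating n :
  Cseries (fun j => Cbinom (RtoC (INR n)) j * (- 1) ^ j) (if (n =? 0)%nat then RtoC 1 else RtoC 0).
Proof.
  apply Cseries_eventually with n. intros m Hm. destruct n as [|n]; cbn [Nat.eqb].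
  - clear Hm. induction m as [|m IH]; [rewrite csum_O, Cbinom_0; simpl; cring|].
    rewrite csum_S, IH, Cbinom_nat_gt by lia. cring.
  - rewrite RtoC_INR_S, Cbinom_alternating, Cbinom_nat_gt by lia. cring.
Qed.

Lemma csum_indicator (b : nat -> C) N P : (N <= P)%nat ->
  sum_n (fun k => b k * (if (k =? N)%nat then RtoC 1 else RtoC 0)) P = b N.
Proof.
  intros H. induction H as [|P H IH].
  - destruct N as [|N]; [rewrite csum_O; simpl; cring|].
    rewrite csum_S, Nat.eqb_refl.
    rewrite (csum_ext _ (fun _ => 0 * 0)).
    + rewrite csum_scal. cring.
    + intros k Hk. destruct (Nat.eqb_spec k (S N)); [lia | ring].
  - rewrite csum_S, IH. destruct (Nat.eqb_spec (S P) N); [lia | cring].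
Qed.

(** This is the expansion at [m = 1], that is [y = - 1], with [s = - N]. Every term on the left
    vanishes, by [em_coef] for [l <= S P] and by [Cbinom (INR N) l] beyond; on the right
    [V k = Cbinom (INR N) k * (1 - 1)^(N - k)] survives only for [k = N]. *)
Lemma em_coef_at_one b P N : (N <= P)%nat ->
  (forall l, (l <= S P)%nat -> em_coef b P l = RtoC 0) ->
  sum_n (fun k => Cbinom (RtoC (INR N)) k * b k) P = b N - 1 + / RtoC (INR (S N)).
Proof.
  intros HN Hb. set (s := - RtoC (INR N)).
  assert (En : - s = RtoC (INR N)) by (unfold s; ring).
  assert (E1 : 1 - s = RtoC (INR (S N))) by (rewrite RtoC_INR_S; unfold s; ring).
  assert (Hs : s <> RtoC 1).
  { unfold s. rewrite <- RtoC_opp. intros E. apply RtoC_inj in E. pose proof (pos_INR N). lra. }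
  pose (d k := (if (k =? N)%nat then RtoC 1 else RtoC 0) : C).
  assert (HV : forall k, (k <= P)%nat ->
    Cseries (fun j => Cbinom (- s) k * Cbinom (- s - RtoC (INR k)) j * (- 1) ^ j) (d k)).
  { intros k Hk. unfold d. rewrite En. destruct (Nat.le_gt_cases k N) as [L|L].
    - replace (RtoC (INR N) - RtoC (INR k)) with (RtoC (INR (N - k)))
        by (rewrite minus_INR, RtoC_minus; easy).
      refine (Cseries_ext _ _ _ _ _ _
        (Cseries_scal (Cbinom (RtoC (INR N)) k) _ _ (Cseries_alternating (N - k)))).
      + intros; ring.
      + destruct (Nat.eqb_spec k N) as [->|NE].
        * rewrite Nat.sub_diag, Cbinom_nat_diag. simpl. ring.
        * destruct (Nat.eqb_spec (N - k) 0); [lia | ring].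
    - destruct (Nat.eqb_spec k N); [lia|].
      refine (Cseries_ext _ _ _ _ _ eq_refl Cseries_zero). intros n0.
      rewrite Cbinom_nat_gt by lia. ring. }
  assert (H1 : Cseries (fun j => Cbinom (1 - s) j * (- 1) ^ j) (RtoC 0)).
  { rewrite E1. exact (Cseries_alternating (S N)). }
  assert (M1 : RtoC (- 1) <> RtoC 0) by (apply RtoC_neq0; lra).
  pose proof (em_coef_series b P s (RtoC (- 1)) _ _ Hs M1 H1 HV) as E.
  assert (Z : Cseries (fun l => Cbinom (- s) l * em_coef b P l * RtoC (- 1) ^ l) (RtoC 0)).
  { refine (Cseries_ext _ _ _ _ _ eq_refl Cseries_zero). intros l.
    destruct (Nat.le_gt_cases l (S P)) as [L|L]; [rewrite Hb by easy; ring|].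
    rewrite En, Cbinom_nat_gt by lia. ring. }
  apply (Cseries_unique _ _ _ Z) in E.
  assert (Sq : forall k, (- 1) ^ k * (- 1) ^ k = RtoC 1).
  { intros k. rewrite <- Cpow_mult_l. replace (RtoC (- 1) * RtoC (- 1)) with (RtoC 1) by ring.
    apply Cpow_1_l. }
  rewrite (csum_ext _ (fun k => b k * d k) P) in E.
  2:{ intros k _. transitivity (b k * ((- 1) ^ k * (- 1) ^ k) * d k); [ring | rewrite Sq; ring]. }
  rewrite (csum_ext (fun k => b k * (- 1) ^ k * Cbinom (- s) k * RtoC (- 1) ^ k)
    (fun k => Cbinom (RtoC (INR N)) k * b k) P) in E.
  2:{ intros k _. transitivity (Cbinom (- s) k * b k * ((- 1) ^ k * (- 1) ^ k));
        [ring | rewrite Sq, En; ring]. }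
  unfold d in E. rewrite csum_indicator, E1 in E by easy.
  pose (T := sum_n (fun k => Cbinom (RtoC (INR N)) k * b k) P : C).
  change (sum_n (fun k => Cbinom (RtoC (INR N)) k * b k) P) with T in E |- *. clearbody T.
  pose proof (INR_S_neq0 N).
  transitivity (T - 0); [cring|]. rewrite E. cfield. easy.
Qed.

Lemma Csum_zero (u : nat -> C) : (forall n, u n = RtoC 0) -> Csum u = RtoC 0.
Proof.
  intros H. apply (Csum_unique u 0 0).
  - intros n. apply Req_le. induction n as [|n IH].
    + rewrite rsum_O, H. apply Cmod_0.
    + rewrite rsum_S, IH, H, Cmod_0. rring.
  - refine (Cseries_ext _ _ _ _ _ eq_refl Cseries_zero). intros n; now rewrite H.
Qed.

(** At [s = - N] the remainder is zero term by term, and [em_coef_at_one] reduces [em_zeta] to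
    [- (N + 1) * b N], to be compared with [(s - 1) * zeta s = - (N + 1) * zeta s]. *)
Lemma zeta_neg zeta b P N : is_riemann_zeta zeta -> (4 <= P)%nat -> (N < P)%nat ->
  (forall l, (l <= S P)%nat -> em_coef b P l = RtoC 0) ->
  zeta (- RtoC (INR N)) = b N.
Proof.
  intros HZ HP HN Hb. set (s := - RtoC (INR N)).
  assert (HsP : (Cmod s < INR P)%R).
  { unfold s. rewrite Cmod_opp, Cmod_R, Rabs_pos_eq by apply pos_INR. now apply lt_INR. }
  assert (E1 : s - 1 = - RtoC (INR (S N))) by (rewrite RtoC_INR_S; unfold s; ring).
  pose proof (INR_S_neq0 N) as NZ.
  assert (Hs : s <> RtoC 1).
  { intros E. apply NZ. replace (RtoC (INR (S N))) with (- (s - 1)) by (rewrite E1; ring).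
    rewrite E. ring. }
  pose proof (zeta_em zeta b P s HZ HP Hb HsP Hs) as E. unfold em_zeta in E.
  assert (R0 : em_rem b P (fun _ => RtoC 1) s = RtoC 0).
  { apply Csum_zero. intros i. unfold em_step. rewrite Csum_zero; [ring|]. intros l.
    destruct (Nat.le_gt_cases l (S P)) as [L|L]; [rewrite Hb by easy; ring|].
    unfold s. replace (- - RtoC (INR N)) with (RtoC (INR N)) by ring.
    rewrite Cbinom_nat_gt by lia. ring. }
  rewrite R0 in E. unfold s in E at 4. replace (- - RtoC (INR N)) with (RtoC (INR N)) in E by ring.
  rewrite (em_coef_at_one b P N), E1 in E by (easy || lia).
  apply (f_equal (fun z => - z / RtoC (INR (S N)))) in E.
  transitivity (- (- RtoC (INR (S N)) * zeta s) / RtoC (INR (S N))); [now field|].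
  rewrite E. now field.
Qed.

(** The entire function [(s - 1) * zeta s]; the value of [zeta] at its pole is
    unconstrained and has to be replaced by the residue. *)
Definition zeta_reg (zeta : C -> C) (s : C) : C :=
  if excluded_middle_informative (s = RtoC 1) then RtoC 1 else (s - 1) * zeta s.

Lemma zeta_reg_eq zeta s : s <> RtoC 1 -> zeta_reg zeta s = (s - 1) * zeta s.
Proof. intros H. unfold zeta_reg. now destruct (excluded_middle_informative (s = RtoC 1)). Qed.

(** On lines through [1] the function agrees near that point with [em_zeta] of order [4], which is
    analytic for [|s| < 4] and takes the value [1] at [1] by its very form. Elsewhere [zeta] itself
    is holomorphic. *)
Lemma AN_zeta_reg zeta c v t0 : is_riemann_zeta zeta -> AN (fun t => zeta_reg zeta (line c v t)) t0.
Proof.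
  intros HZ. pose proof (Cmod_ge_0 v) as V.
  destruct (classic (line c v t0 = RtoC 1)) as [E|E].
  - destruct (em_coef_zero_exists 4) as [b Hb].
    assert (M : forall z, (Cmod (z - 1) < 2)%R -> (Cmod z < INR 4)%R).
    { intros z Hz. replace z with (z - 1 + 1) by ring.
      pose proof (Cmod_triangle (z - 1) 1) as T. rewrite Cmod_1 in T. simpl. lra. }
    apply (AN_ext_loc (fun t => em_zeta b 4 (line c v t)) _ t0 (1 / (Cmod v + 1))%R).
    + apply Rdiv_lt_0_compat; lra.
    + intros t Ht. unfold zeta_reg.
      destruct (excluded_middle_informative (line c v t = RtoC 1)) as [E1|E1].
      * unfold em_zeta. rewrite E1. ring.
      * symmetry. apply zeta_em; try easy; try lia. apply M. rewrite <- E, Cmod_line_diff.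
        apply Rmult_lt_compat_r with (r := (Cmod v + 1)%R) in Ht; [|lra].
        replace (1 / (Cmod v + 1) * (Cmod v + 1))%R with 1%R in Ht by (field; lra).
        pose proof (Rabs_pos (t - t0)). nra.
    + apply AN_em_zeta; [lia | easy|]. apply M. rewrite E.
      replace (RtoC 1 - 1) with (RtoC 0) by ring. rewrite Cmod_0. lra.
  - pose proof (proj1 (Cmod_gt_0 _) (Csub_neq0 _ _ E)) as P.
    apply (AN_ext_loc (fun t => (line c v t - 1) * zeta (line c v t)) _ t0
      (Cmod (line c v t0 - 1) / (Cmod v + 1))%R).
    + apply Rdiv_lt_0_compat; lra.
    + intros t Ht. symmetry. apply zeta_reg_eq. intros E1.
      apply Rmult_lt_compat_r with (r := (Cmod v + 1)%R) in Ht; [|lra].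
      replace (Cmod (line c v t0 - 1) / (Cmod v + 1) * (Cmod v + 1))%R
        with (Cmod (line c v t0 - 1))%R in Ht by (field; lra).
      pose proof (Rabs_pos (t - t0)).
      rewrite <- E1, Cmod_sub_sym, Cmod_line_diff in Ht. nra.
    + apply AN_mult; [apply AN_minus; [apply AN_line | apply AN_const]|].
      apply AN_holomorphic_at. now apply HZ.
Qed.

(** * The double zeta-function *)

(** The inner sum over [n < m] for [m = i + 2], matching the indexing of [em_rem]. *)
Definition power_sum (s : C) (i : nat) : C := sum_n (fun j => natpow (S j) (- s)) i.

Lemma maj_power_sum A c v r i : (0 <= r)%R -> (Cmod c + Cmod v * r <= INR A)%R ->
  maj (fun t => power_sum (line c v t) i) r (INR (i + 2) ^ (A + 1)).
Proof.
  intros Hr HA. unfold power_sum.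
  eapply maj_le;
    [apply (maj_sum (fun j t => natpow (S j) (- line c v t)) (fun j => INR (S j) ^ A)%R r i Hr);
     intros; apply maj_natpow; (easy || lia)|].
  assert (P2 : (0 < INR (i + 2))%R) by (apply lt_0_INR; lia).
  rewrite Nat.add_1_r. cbn [pow].
  assert (H : forall m, (m <= i)%nat ->
    (sum_n (fun j => INR (S j) ^ A)%R m <= INR (S m) * INR (i + 2) ^ A)%R).
  { assert (Q : forall j, (j <= i)%nat -> (INR (S j) ^ A <= INR (i + 2) ^ A)%R).
    { intros j Hj. apply pow_incr; split; [apply pos_INR | apply le_INR; lia]. }
    induction m as [|m IH]; intros Hm.
    - rewrite rsum_O. specialize (Q 0%nat ltac:(lia)). rewrite Rmult_1_l. exact Q.
    - rewrite rsum_S. specialize (IH ltac:(lia)). specialize (Q (S m) Hm).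
      set (x := (INR (S (S m)) ^ A)%R) in *. rewrite (S_INR (S m)). lra. }
  eapply Rle_trans; [apply (H i (le_n i))|].
  apply Rmult_le_compat_r; [apply pow_le; lra | apply le_INR; lia].
Qed.

(** The order [2 * A + 1] is [A] for [m^(- s2)] plus [A + 1] for [power_sum]. The constant [K] is
    independent of the point, so the last clause turns smallness of the binomial coefficients into
    smallness of the remainder. *)
Lemma rem2_properties b A : (1 <= A)%nat ->
  (forall l, (l <= S (2 * A + 1))%nat -> em_coef b (2 * A + 1) l = RtoC 0) ->
  line_analytic (in_polydisc 0 0 (INR A)) (fun s1 s2 => em_rem b (2 * A + 1) (power_sum s1) s2) /\
  (forall s1 s2, in_polydisc 0 0 (INR A) s1 s2 ->
    Cseries (fun i => power_sum s1 i * em_step b (2 * A + 1) s2 (i + 2))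
      (em_rem b (2 * A + 1) (power_sum s1) s2)) /\
  (exists K, (0 <= K)%R /\ forall s1 s2 kappa, in_polydisc 0 0 (INR A) s1 s2 -> (0 <= kappa)%R ->
    (forall l, (A <= l)%nat -> (Cmod (Cbinom (- s2) l) <= kappa * rising (INR A) l)%R) ->
    (Cmod (em_rem b (2 * A + 1) (power_sum s1) s2) <= kappa * K)%R).
Proof.
  intros HA Hb. set (P := (2 * A + 1)%nat) in *.
  assert (A0 : (0 < INR A)%R) by (apply lt_0_INR; lia).
  destruct (em_coef_summable b P (INR A) A0) as [G [HG0 HG]].
  assert (T : forall c1 v1 c2 v2 r kappa, (0 < r)%R -> (0 <= kappa)%R ->
    (Cmod c1 + Cmod v1 * r <= INR A)%R -> (Cmod c2 + Cmod v2 * r <= INR A)%R ->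
    (forall l, (P + 2 <= l)%nat ->
      maj (fun t => Cbinom (- line c2 v2 t) l) r (kappa * rising (INR A) l)) ->
    (forall i, maj (fun t => power_sum (line c1 v1 t) i * em_step b P (line c2 v2 t) (i + 2)) r
     (kappa * G * 2 ^ (P + 2) * / (INR (i + 2) * INR (i + 2)))) /\
    (forall N, (sum_n (fun i => kappa * G * 2 ^ (P + 2) * / (INR (i + 2) * INR (i + 2)))%R N
     <= kappa * G * 2 ^ (P + 2))%R)).
  { intros c1 v1 c2 v2 r kappa Hr Hk H1 H2 Hphi.
    apply (em_rem_terms b P A (A + 1) (INR A) kappa G (fun i t => power_sum (line c1 v1 t) i));
      try easy; [unfold P; lia|].
    intros i. apply maj_power_sum; lra. }
  assert (D : forall z, (Cmod (z - 0) < INR A)%R -> (Cmod z < INR A)%R).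
  { intros z H. now replace (z - 0) with z in H by ring. }
  assert (Sr : forall s1 s2 kappa, in_polydisc 0 0 (INR A) s1 s2 -> (0 <= kappa)%R ->
    (forall l, (A <= l)%nat -> (Cmod (Cbinom (- s2) l) <= kappa * rising (INR A) l)%R) ->
    forall N, (sum_n (fun i => Cmod (power_sum s1 i * em_step b P s2 (i + 2))) N
       <= kappa * (G * 2 ^ (P + 2)))%R).
  { intros s1 s2 kappa [H1 H2] Hk Hc N. apply D in H1. apply D in H2.
    destruct (T s1 0 s2 0 1%R kappa Rlt_0_1 Hk) as [T1 T2]; rewrite ?Cmod_0; try lra.
    - intros l Hl. apply (maj_ext (fun _ => Cbinom (- s2) l)).
      + intros t _. f_equal. unfold line. ring.
      + eapply maj_le; [apply maj_const | apply Hc; unfold P in Hl; lia].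
    - rewrite <- Rmult_assoc. eapply Rle_trans; [|apply (T2 N)].
      apply rsum_le. intros i _.
      pose proof (maj_bound _ _ _ 0 (T1 i)) as M. cbv beta in M. rewrite !line_0 in M.
      apply M. rewrite Rabs_R0; lra. }
  assert (S1 : forall s1 s2, in_polydisc 0 0 (INR A) s1 s2 ->
    forall N, (sum_n (fun i => Cmod (power_sum s1 i * em_step b P s2 (i + 2))) N
       <= 1 * (G * 2 ^ (P + 2)))%R).
  { intros s1 s2 H. apply Sr; [easy | lra|]. intros l _. rewrite Rmult_1_l.
    apply Cmod_Cbinom_le. rewrite Cmod_opp. apply Rlt_le, D, H. }
  split; [|split].
  - intros c1 v1 c2 v2 t0 [H1 H2]. apply D in H1. apply D in H2.
    destruct (disc_room _ v1 _ H1) as [r1 [Hr1 Hc1]].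
    destruct (disc_room _ v2 _ H2) as [r2 [Hr2 Hc2]].
    set (r := Rmin r1 r2). assert (Hr : (0 < r)%R) by now apply Rmin_pos.
    pose proof (Rmin_l r1 r2) as L1. pose proof (Rmin_r r1 r2) as L2. fold r in L1, L2.
    pose proof (Cmod_ge_0 v1). pose proof (Cmod_ge_0 v2).
    assert (K1 : (Cmod (line c1 v1 t0) + Cmod v1 * r <= INR A)%R) by nra.
    assert (K2 : (Cmod (line c2 v2 t0) + Cmod v2 * r <= INR A)%R) by nra.
    destruct (T _ v1 _ v2 r 1%R Hr Rle_0_1 K1 K2) as [T1 T2].
    { intros l _. rewrite Rmult_1_l. apply maj_Cbinom; lra. }
    exists r, (1 * G * 2 ^ (P + 2))%R. split; [easy|].
    apply (maj_ext (fun t => Csum (fun i => power_sum (line (line c1 v1 t0) v1 t) i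
       * em_step b P (line (line c2 v2 t0) v2 t) (i + 2)))).
    + intros t _. now rewrite !line_shift.
    + exact (maj_series _ _ r _ Hr T1 T2).
  - intros s1 s2 H. exact (Cseries_abs _ _ (S1 s1 s2 H)).
  - exists (G * 2 ^ (P + 2))%R. split; [apply Rmult_le_pos; [easy | apply pow_le; lra]|].
    intros s1 s2 kappa H Hk Hc.
    exact (Cseries_bound _ _ _ (Cseries_abs _ _ (S1 s1 s2 H)) (Sr s1 s2 kappa H Hk Hc)).
Qed.

(** The explicit side, up to the remainder, with [b k] in place of [zeta (- k)]. *)
Definition main_terms (zeta : C -> C) (b : nat -> C) (P : nat) (s1 s2 : C) : C :=
  zeta (s1 + s2 - 1) / (s2 - 1)
  + sum_n (fun k => Cbinom (- s2) k * b k * zeta (s1 + s2 + RtoC (INR k))) P.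

Lemma power_sum_bounded s i : (2 <= Re s)%R -> (Cmod (power_sum s i) <= 2)%R.
Proof.
  intros Hs. apply Rle_trans with (2 - / INR (S i))%R.
  2:{ assert (0 < / INR (S i))%R by (apply Rinv_0_lt_compat, lt_0_INR; lia). lra. }
  unfold power_sum. eapply Rle_trans; [apply Cmod_csum|].
  assert (Q : forall j, (Cmod (natpow (S j) (- s)) <= / INR (S j) ^ 2)%R).
  { intros j. apply Cmod_natpow_le; [lia|]. destruct s; simpl in *; lra. }
  induction i as [|i IH].
  - rewrite rsum_O. specialize (Q 0%nat). simpl in *. lra.
  - rewrite rsum_S. specialize (Q (S i)). rewrite (S_INR (S i)) in *.
    assert (H : (0 < INR (S i))%R) by (apply lt_0_INR; lia). set (x := INR (S i)) in *.
    assert (/ (x + 1) ^ 2 <= / x - / (x + 1))%R; [|lra].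
    replace (/ x - / (x + 1))%R with (/ (x * (x + 1)))%R by (field; lra).
    apply Rinv_le_contravar; nra.
Qed.

Lemma zeta2_start zeta zeta2 b A s1 s2 :
  is_riemann_zeta zeta -> is_euler_zagier_zeta2 zeta2 -> (1 <= A)%nat ->
  (forall l, (l <= S (2 * A + 1))%nat -> em_coef b (2 * A + 1) l = RtoC 0) ->
  (2 <= Re s1)%R -> (2 <= Re s2)%R -> in_polydisc 0 0 (INR A) s1 s2 ->
  zeta2 s1 s2 = main_terms zeta b (2 * A + 1) s1 s2 + em_rem b (2 * A + 1) (power_sum s1) s2.
Proof.
  intros [Hz _] [Hz2 _] HA Hb H1 H2 HD. set (P := (2 * A + 1)%nat) in *.
  (* Grouping by [m = n1 + n2]: the antidiagonal of index [n] is [m = n + 2], and its inner sum is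
     [power_sum s1 n]. *)
  assert (SZ : Cseries (fun i => power_sum s1 i * natpow (i + 2) (- s2)) (zeta2 s1 s2)).
  { assert (R2 : (2 < Re (s1 + s2))%R) by (destruct s1, s2; simpl in *; lra).
    pose proof (double_series_antidiagonal _ _ (Hz2 s1 s2 ltac:(lra) R2)) as SD.
    refine (Cseries_ext _ _ _ _ _ eq_refl SD). intros n.
    unfold power_sum. rewrite Cmult_comm, <- csum_scal. apply csum_ext. intros i Hi.
    replace (S i + S (n - i))%nat with (n + 2)%nat by lia. ring. }
  (* Multiplying [em_tail] at [n] by [n^(- s1)] shifts the exponents to [s1 + s2 - 1] and
     [s1 + s2 + k]; the sum over [n] produces the zeta values of the theorem. *)
  assert (SY : Cseries (fun j => natpow (S j) (- s1) * em_tail b P s2 (j + 1))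
    (main_terms zeta b P s1 s2)).
  { assert (Z : forall w, (1 < Re w)%R -> Cseries (fun n => natpow (S n) (- w)) (zeta w))
      by exact Hz.
    assert (R1 : (1 < Re (s1 + s2 - 1))%R) by (destruct s1, s2; simpl in *; lra).
    assert (Rk : forall k, (1 < Re (s1 + s2 + RtoC (INR k)))%R)
      by (intros k; pose proof (pos_INR k); destruct s1, s2; simpl in *; lra).
    refine (Cseries_ext _ _ _ _ _ _ (Cseries_plus _ _ _ _
      (Cseries_scal (/ (s2 - 1)) _ _ (Z _ R1))
      (Cseries_sum (fun k n => Cbinom (- s2) k * b k * natpow (S n) (- (s1 + s2 + RtoC (INR k))))
        (fun k => Cbinom (- s2) k * b k * zeta (s1 + s2 + RtoC (INR k))) P
        (fun k _ => Cseries_scal _ _ _ (Z _ (Rk k)))))).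
    - intros j. unfold em_tail. rewrite Nat.add_1_r, Cmult_plus_distr_l, <- csum_scal.
      apply f_equal2.
      + replace (- (s1 + s2 - 1)) with (- s1 + (1 - s2)) by ring.
        rewrite natpow_plus. unfold Cdiv. ring.
      + apply csum_ext. intros k _.
        replace (- (s1 + s2 + RtoC (INR k))) with (- s1 + (- s2 - RtoC (INR k))) by ring.
        rewrite natpow_plus. ring.
    - unfold main_terms, Cdiv. apply f_equal2; [ring | reflexivity]. }
  pose proof (em_rem_identity b P s2 (fun j => natpow (S j) (- s1)) (power_sum s1) _ _ 2 H2 Hb
    (fun i => eq_refl) (fun i => power_sum_bounded s1 i H1) SZ SY) as E.
  apply (Cseries_unique _ _ _ (proj1 (proj2 (rem2_properties b A HA Hb)) s1 s2 HD)) in E.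
  fold P in E. rewrite E. ring.
Qed.

(** Quotients of line-analytic functions, with the quotient formula asserted at
    the points satisfying [ok]. *)
Definition line_fraction (Om ok : C -> C -> Prop) (f : C -> C -> C) : Prop :=
  exists Q G, line_analytic Om Q /\ line_analytic Om G /\
    forall s1 s2, ok s1 s2 -> Q s1 s2 <> RtoC 0 /\ f s1 s2 * Q s1 s2 = G s1 s2.

Lemma line_fraction_quot Om (ok : C -> C -> Prop) f q g :
  line_analytic Om q -> line_analytic Om g ->
  (forall s1 s2, ok s1 s2 -> q s1 s2 <> RtoC 0 /\ f s1 s2 * q s1 s2 = g s1 s2) ->
  line_fraction Om ok f.
Proof. intros H1 H2 H3. now exists q, g. Qed.

Lemma line_fraction_plus Om ok f f' : line_fraction Om ok f -> line_fraction Om ok f' ->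
  line_fraction Om ok (fun s1 s2 => f s1 s2 + f' s1 s2).
Proof.
  intros [Q [G [HQ [HG H]]]] [Q' [G' [HQ' [HG' H']]]].
  exists (fun s1 s2 => Q s1 s2 * Q' s1 s2),
    (fun s1 s2 => G s1 s2 * Q' s1 s2 + G' s1 s2 * Q s1 s2).
  split; [|split].
  - intros c1 v1 c2 v2 t0 O. apply AN_mult; [apply HQ | apply HQ']; easy.
  - intros c1 v1 c2 v2 t0 O. apply AN_plus; apply AN_mult;
      [apply HG | apply HQ' | apply HG' | apply HQ]; easy.
  - intros s1 s2 O. destruct (H _ _ O) as [N E]. destruct (H' _ _ O) as [N' E'].
    split; [now apply Cmult_neq_0|]. rewrite <- E, <- E'. ring.
Qed.

Lemma line_fraction_sum Om ok (f : nat -> C -> C -> C) K :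
  (forall k, (k <= K)%nat -> line_fraction Om ok (f k)) ->
  line_fraction Om ok (fun s1 s2 => sum_n (fun k => f k s1 s2) K).
Proof.
  intros H. induction K as [|K IH].
  - destruct (H 0%nat (le_n 0)) as [Q [G [HQ [HG E]]]]. exists Q, G.
    repeat split; try easy; intros; rewrite ?csum_O; now apply E.
  - destruct (line_fraction_plus _ _ _ _ (IH (fun k Hk => H k (le_S _ _ Hk))) (H (S K) (le_n _)))
      as [Q [G [HQ [HG E]]]]. exists Q, G.
    repeat split; try easy; intros; rewrite ?csum_S; now apply E.
Qed.

Lemma line_sum c1 v1 c2 v2 c t :
  line c1 v1 t + line c2 v2 t + c = line (c1 + c2 + c) (v1 + v2) t.
Proof. unfold line. ring. Qed.

Lemma line_analytic_sum Om c : line_analytic Om (fun s1 s2 => s1 + s2 + c).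
Proof.
  intros c1 v1 c2 v2 t0 _. apply (AN_ext (line (c1 + c2 + c) (v1 + v2))); [|apply AN_line].
  intros t. now rewrite line_sum.
Qed.

Lemma line_analytic_zeta_reg Om zeta c : is_riemann_zeta zeta ->
  line_analytic Om (fun s1 s2 => zeta_reg zeta (s1 + s2 + c)).
Proof.
  intros HZ c1 v1 c2 v2 t0 _.
  apply (AN_ext (fun t => zeta_reg zeta (line (c1 + c2 + c) (v1 + v2) t)));
    [|now apply AN_zeta_reg]. intros t. now rewrite line_sum.
Qed.

(** A summand with [b k = 0] is the zero function and creates no pole, so it imposes no condition;
    this mirrors the hypotheses under which the theorem is stated. *)
Definition regular_point (b : nat -> C) (P : nat) (s1 s2 : C) : Prop :=
  s2 <> RtoC 1 /\ s1 + s2 - 1 <> RtoC 1 /\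
  forall k, (k <= P)%nat -> b k <> RtoC 0 -> s1 + s2 + RtoC (INR k) <> RtoC 1.

Lemma main_terms_fraction Om zeta b P : is_riemann_zeta zeta ->
  line_fraction Om (regular_point b P) (main_terms zeta b P).
Proof.
  intros HZ. apply line_fraction_plus.
  - apply (line_fraction_quot _ _ _
      (fun s1 s2 => (s2 + - (1)) * (s1 + s2 + - RtoC 2))
      (fun s1 s2 => zeta_reg zeta (s1 + s2 + - (1)))).
    + intros c1 v1 c2 v2 t0 O. apply AN_mult.
      * apply AN_plus; [apply AN_line | apply AN_const].
      * exact (line_analytic_sum Om _ c1 v1 c2 v2 t0 O).
    + now apply line_analytic_zeta_reg.
    + intros s1 s2 [N1 [N2 _]]. apply Csub_neq0 in N1. pose proof (Csub_neq0 _ _ N2) as N3.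
      replace (s1 + s2 - 1 - 1) with (s1 + s2 + - RtoC 2) in N3 by ring.
      split; [now apply Cmult_neq_0|].
      replace (s1 + s2 + - (1)) with (s1 + s2 - 1) by ring.
      rewrite zeta_reg_eq by easy. field. exact N1.
  - apply (line_fraction_sum _ _ (fun k s1 s2 =>
      Cbinom (- s2) k * b k * zeta (s1 + s2 + RtoC (INR k)))). intros k Hk.
    destruct (classic (b k = RtoC 0)) as [B|B].
    + apply (line_fraction_quot _ _ _ (fun _ _ => RtoC 1) (fun _ _ => RtoC 0)).
      * intros c1 v1 c2 v2 t0 _. apply AN_const.
      * intros c1 v1 c2 v2 t0 _. apply AN_const.
      * intros s1 s2 _. rewrite B. split; [apply RtoC_neq0; lra | ring].
    + apply (line_fraction_quot _ _ _ (fun s1 s2 => s1 + s2 + (RtoC (INR k) - 1))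
        (fun s1 s2 => Cbinom (- s2) k * b k * zeta_reg zeta (s1 + s2 + RtoC (INR k)))).
      * apply line_analytic_sum.
      * intros c1 v1 c2 v2 t0 O.
        apply AN_mult; [apply AN_mult; [apply AN_Cbinom | apply AN_const]|].
        exact (line_analytic_zeta_reg Om zeta _ HZ c1 v1 c2 v2 t0 O).
      * intros s1 s2 [_ [_ N]]. specialize (N k Hk B). rewrite zeta_reg_eq by easy.
        apply Csub_neq0 in N.
        replace (s1 + s2 + (RtoC (INR k) - 1)) with (s1 + s2 + RtoC (INR k) - 1) by ring.
        split; [easy | ring].
Qed.

(** The explicit side has poles, so it enters the identity theorem as a [line_fraction]; at a
    regular point its denominator [Q] is nonzero and can be cancelled at the end. *)
Lemma zeta2_formula zeta zeta2 b A s1 s2 :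
  is_riemann_zeta zeta -> is_euler_zagier_zeta2 zeta2 -> (4 <= A)%nat ->
  (forall l, (l <= S (2 * A + 1))%nat -> em_coef b (2 * A + 1) l = RtoC 0) ->
  in_polydisc 0 0 (INR A) s1 s2 -> regular_point b (2 * A + 1) s1 s2 ->
  holomorphic2_at zeta2 s1 s2 ->
  zeta2 s1 s2 = main_terms zeta b (2 * A + 1) s1 s2 + em_rem b (2 * A + 1) (power_sum s1) s2.
Proof.
  intros HZ HZ2 HA Hb HD Hok Hh. set (P := (2 * A + 1)%nat) in *.
  assert (A4 : (4 <= INR A)%R) by (replace 4%R with (INR 4) by (simpl; ring); now apply le_INR).
  destruct (rem2_properties b A ltac:(lia) Hb) as [HR _]. fold P in HR.
  assert (HF : line_fraction (in_polydisc 0 0 (INR A)) (regular_point b P)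
    (fun s1 s2 => main_terms zeta b P s1 s2 + em_rem b P (power_sum s1) s2)).
  { apply line_fraction_plus; [now apply main_terms_fraction|].
    apply (line_fraction_quot _ _ _ (fun _ _ => RtoC 1) _ (fun c1 v1 c2 v2 t0 _ => AN_const _ _) HR).
    intros; split; [apply RtoC_neq0; lra | ring]. }
  destruct HF as [Q [G [HQ [HG E]]]].
  (* [A >= 4] puts the base point [(3, 3)] inside the polydisc, and within distance [1] of it both
     real parts exceed [2]. *)
  assert (Hq : in_polydisc 0 0 (INR A) 3 3).
  { split; replace (RtoC 3 - 0) with (RtoC 3) by ring; rewrite Cmod_R, Rabs_pos_eq; lra. }
  pose proof (meromorphic2_identity zeta2 Q G (INR A) (proj2 HZ2) HQ HG 3 3 1 s1 s2 Rlt_0_1 Hq)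
    as I.
  destruct (E s1 s2 Hok) as [N1 E1].
  assert (EQ : zeta2 s1 s2 * Q s1 s2 = G s1 s2).
  { apply I; try easy. intros z1 z2 [H1 H2] Dz.
    assert (Re3 : forall z, (Cmod (z - 3) < 1)%R -> (2 <= Re z)%R).
    { intros z Hz. pose proof (re_le_Cmod (z - 3)) as R3.
      assert (R4 : (Rabs (Re (z - 3)) < 1)%R) by lra. apply Rabs_def2 in R4.
      destruct z; simpl in *; lra. }
    apply Re3 in H1. apply Re3 in H2.
    assert (ok : regular_point b P z1 z2).
    { repeat split.
      - intros ->. simpl in H2. lra.
      - intros X. apply (f_equal Re) in X. destruct z1, z2; simpl in *; lra.
      - intros k _ _ X. apply (f_equal Re) in X. pose proof (pos_INR k).
        destruct z1, z2; simpl in *; lra. }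
    destruct (E z1 z2 ok) as [_ E2]. rewrite <- E2. f_equal.
    apply zeta2_start; (easy || lia). }
  rewrite <- E1 in EQ.
  transitivity (zeta2 s1 s2 * Q s1 s2 / Q s1 s2); [now field|]. rewrite EQ. now field.
Qed.

(** * Terms of size [O(e2)] and the final estimate *)

(** For [k > N] the defining product contains the factor [N - e - N = - e], the source of every
    [O(e2)]. The other factors are bounded as in [rising], and [a >= 1] makes the factor [a + N]
    replaced by [|e|] at least [1]. *)
Lemma Cbinom_near_nat (N k : nat) (e : C) (a : R) :
  (1 <= a)%R -> (Cmod (RtoC (INR N) - e) <= a)%R -> (N < k)%nat ->
  (Cmod (Cbinom (RtoC (INR N) - e) k) <= Cmod e * rising a k)%R.
Proof.
  intros Ha He Hk.
  assert (St : forall j, (Cmod (Cbinom (RtoC (INR N) - e) (S j))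
    = Cmod (Cbinom (RtoC (INR N) - e) j) * Cmod (RtoC (INR N) - e - RtoC (INR j)) / INR (S j))%R).
  { intros j. rewrite Cbinom_S, Cmod_div_R, Cmod_mult by (apply lt_0_INR; lia). easy. }
  pose proof (Cmod_ge_0 e) as E0.
  induction Hk as [|k Hk IH].
  - rewrite St. replace (RtoC (INR N) - e - RtoC (INR N)) with (- e) by ring.
    rewrite Cmod_opp. cbn [rising].
    pose proof (Cmod_Cbinom_le (RtoC (INR N) - e) a N He). pose proof (pos_INR N).
    assert (0 < rising a N)%R by (apply rising_pos; lra).
    unfold Rdiv. rewrite <- (Rmult_assoc (Cmod e)).
    apply Rmult_le_compat_r; [apply Rlt_le, Rinv_0_lt_compat, lt_0_INR; lia|].
    rewrite Rmult_comm. apply Rmult_le_compat_l; [easy|]. nra.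
  - rewrite St. cbn [rising]. unfold Rdiv. rewrite <- (Rmult_assoc (Cmod e)).
    apply Rmult_le_compat_r; [apply Rlt_le, Rinv_0_lt_compat, lt_0_INR; lia|].
    rewrite <- Rmult_assoc. apply Rmult_le_compat; try apply Cmod_ge_0; [easy|].
    pose proof (Cmod_sub_le (RtoC (INR N) - e) (RtoC (INR k))) as T.
    rewrite (Cmod_R (INR k)), (Rabs_pos_eq (INR k)) in T by apply pos_INR. lra.
Qed.

Lemma holomorphic_at_bounded f p : holomorphic_at f p ->
  exists rho B, (0 < rho)%R /\ forall z, (Cmod (z - p) <= rho)%R -> (Cmod (f z) <= B)%R.
Proof.
  intros H. destruct (holomorphic_at_maj f p H) as [rho [B [Hr M]]].
  exists rho, B; split; [easy|]. intros z Hz.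
  pose proof (maj_bound _ _ _ 1 (M (z - p) 1%R Rle_0_1 ltac:(lra))) as Q.
  cbv beta in Q. rewrite line_to in Q. apply Q. rewrite Rabs_R1; lra.
Qed.

Lemma ZtoC_plus a b : ZtoC (a + b) = ZtoC a + ZtoC b.
Proof. unfold ZtoC. now rewrite plus_IZR, RtoC_plus. Qed.

Lemma ZtoC_of_nat k : ZtoC (Z.of_nat k) = RtoC (INR k).
Proof. unfold ZtoC. now rewrite <- INR_IZR_INZ. Qed.

Lemma ZtoC_opp a : ZtoC (- a) = - ZtoC a.
Proof. unfold ZtoC. now rewrite opp_IZR, RtoC_opp. Qed.

(** Both entries of the maximum [M2] appear here: [k > - m2] puts a factor [e2] into the binomial
    coefficient, and [k > 1 - (m1 + m2)] puts the argument of [zeta] near an integer at least [2],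
    where [zeta] is bounded. The induction is on the number [j] of omitted terms. *)
Lemma omitted_terms_bound zeta (b : nat -> C) (m : Z) (N M : nat) (a : R) :
  is_riemann_zeta zeta -> (1 <= a)%R -> (INR N + 1 <= a)%R -> (N <= M)%nat ->
  (1 < m + Z.of_nat (S M))%Z -> forall j,
  exists K delta, (0 <= K)%R /\ (0 < delta)%R /\
  forall e1 e2, (Cmod e1 < delta)%R -> (Cmod e2 < delta)%R ->
   (Cmod (sum_n (fun k => Cbinom (RtoC (INR N) - e2) k * b k
        * zeta (ZtoC m + e1 + e2 + RtoC (INR k))) (M + j)
     - sum_n (fun k => Cbinom (RtoC (INR N) - e2) k * b k
        * zeta (ZtoC m + e1 + e2 + RtoC (INR k))) M)%C <= K * Cmod e2)%R.
Proof.
  intros HZ Ha HN HM Hm j. induction j as [|j [K [delta [HK [Hd IH]]]]].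
  - exists 0%R, 1%R. repeat split; try lra. intros e1 e2 _ _. rewrite Nat.add_0_r.
    apply Req_le. rewrite Rmult_0_l, <- Cmod_0. f_equal. cring.
  - set (k := (M + S j)%nat). set (p := ZtoC (m + Z.of_nat k)).
    assert (Hp : p <> RtoC 1).
    { unfold p, ZtoC. intros E. apply RtoC_inj in E. apply (eq_IZR _ 1) in E. unfold k in E. lia. }
    destruct (holomorphic_at_bounded zeta p (proj2 HZ p Hp)) as [rho [B [Hr HB]]].
    assert (B0 : (0 <= B)%R).
    { eapply Rle_trans; [apply Cmod_ge_0 | apply (HB p)].
      replace (p - p) with (RtoC 0) by ring. rewrite Cmod_0; lra. }
    assert (R0 : (0 <= rising a k)%R) by (apply Rlt_le, rising_pos; lra).
    pose proof (Cmod_ge_0 (b k)) as Bk.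
    set (K' := (rising a k * Cmod (b k) * B)%R).
    assert (HK' : (0 <= K')%R) by (apply Rmult_le_pos; [now apply Rmult_le_pos | easy]).
    exists (K + K')%R, (Rmin delta (Rmin 1 (rho / 2))).
    split; [lra|]. split; [repeat apply Rmin_pos; lra|].
    intros e1 e2 H1 H2.
    pose proof (Rmin_l delta (Rmin 1 (rho / 2))). pose proof (Rmin_r delta (Rmin 1 (rho / 2))).
    pose proof (Rmin_l 1 (rho / 2)). pose proof (Rmin_r 1 (rho / 2)).
    specialize (IH e1 e2 ltac:(lra) ltac:(lra)).
    assert (Ek : k = S (M + j)) by (unfold k; lia). rewrite Ek, csum_S, <- Ek.
    set (X := sum_n (fun k => Cbinom (RtoC (INR N) - e2) k * b k
        * zeta (ZtoC m + e1 + e2 + RtoC (INR k))) (M + j)) in *.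
    set (Y := sum_n (fun k => Cbinom (RtoC (INR N) - e2) k * b k
        * zeta (ZtoC m + e1 + e2 + RtoC (INR k))) M) in *.
    set (T := Cbinom (RtoC (INR N) - e2) k * b k * zeta (ZtoC m + e1 + e2 + RtoC (INR k))).
    replace (X + T - Y) with (X - Y + T) by cring.
    eapply Rle_trans; [apply Cmod_triangle|].
    assert (HT : (Cmod T <= K' * Cmod e2)%R); [|lra].
    unfold T, K'. rewrite !Cmod_mult.
    assert (Q1 : (Cmod (Cbinom (RtoC (INR N) - e2) k)%C <= Cmod e2 * rising a k)%R).
    { apply Cbinom_near_nat; [easy | | unfold k; lia].
      pose proof (Cmod_sub_le (RtoC (INR N)) e2) as S1.
      rewrite (Cmod_R (INR N)), (Rabs_pos_eq (INR N)) in S1 by apply pos_INR. lra. }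
    assert (Q2 : (Cmod (zeta (ZtoC m + e1 + e2 + RtoC (INR k)))%C <= B)%R).
    { apply HB. unfold p. rewrite ZtoC_plus, ZtoC_of_nat.
      replace (ZtoC m + e1 + e2 + RtoC (INR k) - (ZtoC m + RtoC (INR k))) with (e1 + e2) by ring.
      pose proof (Cmod_triangle e1 e2). lra. }
    replace (rising a k * Cmod (b k) * B * Cmod e2)%R
      with (Cmod e2 * rising a k * Cmod (b k) * B)%R by ring.
    apply Rmult_le_compat; try apply Cmod_ge_0; try easy.
    + apply Rmult_le_pos; [apply Cmod_ge_0 | easy].
    + now apply Rmult_le_compat_r.
Qed.

Theorem theorem5p1 :
  forall (zeta : C -> C) (zeta2 : C -> C -> C),
  is_riemann_zeta zeta ->
  is_euler_zagier_zeta2 zeta2 ->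
  forall m1 m2 : Z, (m2 <= 0)%Z ->
  exists (K delta : R), (0 < delta)%R /\
  forall e1 e2 : C, (Cmod e1 < delta)%R -> (Cmod e2 < delta)%R ->
  (* both sides are defined at (e1, e2); on the right, a term whose constant
     coefficient zeta (- k) vanishes is the zero function *)
  holomorphic2_at zeta2 (ZtoC m1 + e1) (ZtoC m2 + e2) ->
  ZtoC (m1 + m2 - 1) + e1 + e2 <> RtoC 1 ->
  (forall k : nat, (Z.of_nat k <= M2 m1 m2)%Z ->
     zeta (ZtoC (- Z.of_nat k)) <> RtoC 0 ->
     ZtoC (m1 + m2 + Z.of_nat k) + e1 + e2 <> RtoC 1) ->
  (Cmod ((zeta2 (ZtoC m1 + e1) (ZtoC m2 + e2)
         - (zeta (ZtoC (m1 + m2 - 1) + e1 + e2) / (ZtoC (m2 - 1) + e2)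
            + sum_n (fun k : nat =>
                Cbinom (- ZtoC m2 - e2) k * zeta (ZtoC (- Z.of_nat k))
                * zeta (ZtoC (m1 + m2 + Z.of_nat k) + e1 + e2))
              (Z.to_nat (M2 m1 m2))))%C)
   <= K * Cmod e2)%R.
Proof.
  intros zeta zeta2 HZ HZ2 m1 m2 Hm2.
  set (M := Z.to_nat (M2 m1 m2)). set (N := Z.to_nat (- m2)).
  assert (HM : (Z.of_nat M = M2 m1 m2)%Z) by (unfold M, M2; lia).
  assert (HNM : (N <= M)%nat) by (unfold N, M, M2; lia).
  set (A := (M + Z.abs_nat m1 + N + 4)%nat).
  set (P := (2 * A + 1)%nat).
  destruct (em_coef_zero_exists P) as [b Hb].
  assert (Hzb : forall k, (k <= M)%nat -> zeta (ZtoC (- Z.of_nat k)) = b k).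
  { intros k Hk. rewrite ZtoC_opp, ZtoC_of_nat.
    apply (zeta_neg zeta b P k HZ); [unfold P, A; lia | unfold P, A; lia | easy]. }
  assert (A4 : (4 <= A)%nat) by (unfold A; lia).
  destruct (rem2_properties b A ltac:(lia) Hb) as [_ [_ [KR [HKR HR]]]]. fold P in HR.
  assert (EN : RtoC (INR N) = - ZtoC m2).
  { rewrite <- ZtoC_of_nat, <- ZtoC_opp. f_equal. unfold N. lia. }
  assert (LA : (INR N + 4 <= INR A)%R).
  { replace 4%R with (INR 4) by (simpl; ring). rewrite <- plus_INR. apply le_INR. unfold A; lia. }
  assert (LA1 : (Cmod (ZtoC m1) + 4 <= INR A)%R).
  { unfold ZtoC. rewrite Cmod_R, <- abs_IZR, <- Zabs2Nat.id_abs, <- INR_IZR_INZ.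
    replace 4%R with (INR 4) by (simpl; ring). rewrite <- plus_INR. apply le_INR. unfold A; lia. }
  pose proof (pos_INR N) as N0.
  destruct (omitted_terms_bound zeta b (m1 + m2) N M (INR A) HZ ltac:(lra) ltac:(lra) HNM
    ltac:(unfold M2 in HM; lia) (P - M)) as [K [delta [HK [Hd HT]]]].
  replace (M + (P - M))%nat with P in HT by (unfold P, A; lia).
  (* With [1 / 4] the real part of [e1 + e2] stays above [- 1 / 2], so an argument near an integer
     at least [2] cannot reach the pole [1]. *)
  exists (K + KR)%R, (Rmin delta (1 / 4)). split; [apply Rmin_pos; lra|].
  intros e1 e2 H1 H2 Hh Hp Hk.
  pose proof (Rmin_l delta (1 / 4)). pose proof (Rmin_r delta (1 / 4)).
  set (s1 := ZtoC m1 + e1) in *. set (s2 := ZtoC m2 + e2) in *.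
  assert (Es : s1 + s2 = ZtoC (m1 + m2) + e1 + e2)
    by (unfold s1, s2; rewrite ZtoC_plus; ring).
  assert (Es1 : ZtoC (m1 + m2 - 1) + e1 + e2 = s1 + s2 - 1).
  { rewrite Es. unfold Z.sub. rewrite (ZtoC_plus _ (- (1))), ZtoC_opp. unfold ZtoC at 2. ring. }
  assert (Esk : forall k, ZtoC (m1 + m2 + Z.of_nat k) + e1 + e2 = s1 + s2 + RtoC (INR k)).
  { intros k. rewrite Es, (ZtoC_plus _ (Z.of_nat k)), ZtoC_of_nat. ring. }
  assert (Em2 : - s2 = RtoC (INR N) - e2) by (rewrite EN; unfold s2; ring).
  assert (HD : in_polydisc 0 0 (INR A) s1 s2).
  { split.
    - replace (s1 - 0) with (ZtoC m1 + e1) by (unfold s1; ring).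
      pose proof (Cmod_triangle (ZtoC m1) e1). lra.
    - replace (s2 - 0) with (- (RtoC (INR N) - e2)) by (rewrite <- Em2; ring).
      rewrite Cmod_opp. pose proof (Cmod_sub_le (RtoC (INR N)) e2) as T.
      rewrite (Cmod_R (INR N)), (Rabs_pos_eq (INR N)) in T by easy. lra. }
  (* The poles of the terms [k <= M] are excluded by hypothesis; for [M < k <= P] the real part of
     [s1 + s2 + k] already exceeds [1]. *)
  assert (Hok : regular_point b P s1 s2).
  { pose proof (re_le_Cmod e1) as Q1. pose proof (re_le_Cmod e2) as Q2.
    assert (Q3 : (Rabs (Re e1) < 1 / 4)%R) by lra. assert (Q4 : (Rabs (Re e2) < 1 / 4)%R) by lra.
    apply Rabs_def2 in Q3. apply Rabs_def2 in Q4.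
    split; [|split].
    - intros E. apply (f_equal Re) in E.
      replace (Re s2) with (- INR N + Re e2)%R in E; [simpl in E; lra|].
      replace s2 with (- (RtoC (INR N) - e2)) by (rewrite <- Em2; ring).
      destruct e2; simpl; ring.
    - now rewrite <- Es1.
    - intros k HkP Bk. destruct (Nat.le_gt_cases k M) as [L|L].
      + rewrite <- Esk. apply Hk; [lia|]. now rewrite Hzb.
      + rewrite <- Esk. intros E. apply (f_equal Re) in E.
        assert (2 <= IZR (m1 + m2 + Z.of_nat k))%R
          by (apply (IZR_le 2); unfold M2 in HM; lia).
        unfold ZtoC in E. destruct e1, e2; simpl in *; lra. }
  rewrite (zeta2_formula zeta zeta2 b A s1 s2 HZ HZ2 A4 Hb HD Hok Hh). fold P.
  unfold main_terms. rewrite Es1.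
  replace (ZtoC (m2 - 1) + e2) with (s2 - 1).
  2:{ unfold s2, Z.sub. rewrite (ZtoC_plus _ (- (1))), ZtoC_opp. unfold ZtoC at 3. ring. }
  assert (Sum : forall n, sum_n (fun k => Cbinom (- s2) k * b k * zeta (s1 + s2 + RtoC (INR k))) n
     = sum_n (fun k => Cbinom (RtoC (INR N) - e2) k * b k
        * zeta (ZtoC (m1 + m2) + e1 + e2 + RtoC (INR k))) n).
  { intros n. apply csum_ext. intros k _. now rewrite Em2, Es. }
  rewrite (csum_ext (fun k : nat => Cbinom (- ZtoC m2 - e2) k * zeta (ZtoC (- Z.of_nat k))
                * zeta (ZtoC (m1 + m2 + Z.of_nat k) + e1 + e2))
    (fun k => Cbinom (RtoC (INR N) - e2) k * b k
        * zeta (ZtoC (m1 + m2) + e1 + e2 + RtoC (INR k)))).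
  2:{ intros k L. now rewrite EN, Hzb, Esk, Es. }
  rewrite Sum. specialize (HT e1 e2 ltac:(lra) ltac:(lra)).
  set (X := sum_n _ P) in *. set (Y := sum_n _ M) in *.
  set (R1 := em_rem b P (power_sum s1) s2).
  (* Here [kappa] is [Cmod e2], since the relevant binomial coefficients have index at least
     [A > N]. *)
  assert (HR1 : (Cmod R1 <= Cmod e2 * KR)%R).
  { apply HR; [easy | apply Cmod_ge_0|]. intros l Hl. rewrite Em2.
    apply Cbinom_near_nat; [lra | | unfold A in Hl; lia].
    rewrite <- Em2, Cmod_opp. destruct HD as [_ D2].
    replace (s2 - 0) with s2 in D2 by ring. lra. }
  set (Z0 := zeta (s1 + s2 - 1) / (s2 - 1)).
  replace (Z0 + X + R1 - (Z0 + Y)) with (X - Y + R1) by cring.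
  eapply Rle_trans; [apply Cmod_triangle|]. lra.
Qed.
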